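(* Let $\beta$ be a weakly finitary Pisot unit of degree $m$, let $T_\beta$ be the automorphism of $\mathbb{T}^m$ given by the companion matrix $M_\beta$, let $\xi\in\mathcal{P}_\beta$, and let $\varphi_\xi:X_\beta\to\mathbb{T}^m$ be $$\varphi_\xi(\bar\varepsilon)=\lim_{N\to+\infty}\Big(\sum_{k=-N}^{\infty}\varepsilon_k\beta^{-k}\Big)(\xi,\xi\beta^{-1},\dots,\xi\beta^{-m+1})^{T} \bmod \mathbb{Z}^m .$$ Then for almost every $x\in\mathbb{T}^m$ with respect to the Haar measure, $$\#\varphi_\xi^{-1}(x)=|D\,N(\xi)|,$$ where $D=D(\beta)=\prod_{i<j}(\beta_i-\beta_j)^2$ is the discriminant of $\beta$ ($\beta_1=\beta,\beta_2,\dots,\beta_m$ being the Galois conjugates of $\beta$) and $N(\cdot)$ is the norm of the extension $\mathbb{Q}(\beta)/\mathbb{Q}$.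
   Context: A Pisot number is a real algebraic integer $\beta>1$ all of whose other Galois conjugates have modulus less than 1; a Pisot unit is a Pisot number that is an algebraic unit. Write the minimal polynomial of $\beta$ as $x^m-k_1x^{m-1}-\cdots-k_m$. The companion matrix $M_\beta$ has first row $(k_1,k_2,\dots,k_m)$, entries $1$ in positions $(i+1,i)$, and zeros elsewhere; $T_\beta$ is $x\mapsto M_\beta x\bmod\mathbb{Z}^m$ on $\mathbb{T}^m=\mathbb{R}^m/\mathbb{Z}^m$. $\mathcal{P}_\beta=\{\xi\in\mathbb{R}:\|\xi\beta^n\|\to0 \text{ as } n\to+\infty\}$, where $\|\cdot\|$ is the distance to the nearest integer. It is a subgroup of $\mathbb{Q}(\beta)$. The point $\mathbf t=(\xi,\xi\beta^{-1},\dots,\xi\beta^{-m+1})\bmod\mathbb{Z}^m$, $\xi\in\mathcal P_\beta$, is homoclinic to $\mathbf 0$ for $T_\beta$, all homoclinic points are of this form, the limit defining $\varphi_\xi$ exists, and $\varphi_\xi(\bar\varepsilon)=\sum_{k\in\mathbb{Z}}\varepsilon_kT_\beta^{-k}\mathbf{t}$. $\beta$-expansions and the $\beta$-compactum. For $x\in[0,1)$ the $\beta$-expansion $x=\sum_{k\ge1}\varepsilon_k\beta^{-k}$ is the greedy one: $\varepsilon_k=[\beta\tau^{k-1}(x)]$, where $\tau(x)=\beta x \bmod 1$. For $x\ge 1$ it is extended as for decimal expansions (expand $\beta^{-n}x\in[0,1)$ and shift). $Fin(\beta)$ is the set of $x\ge0$ whose $\beta$-expansion is finite. Let $d'_1=[\beta]$,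 $d'_n=[\beta\tau^{n-1}(1)]$ ($n\ge 2$), with $\tau(1)=\beta-[\beta]$. If $(d'_n)$ has infinitely many nonzero terms put $d_n=d'_n$; otherwise, with $k=\max\{j:d'_j>0\}$, let $(d_n)_{n\ge1}$ be the purely periodic sequence with period $(d'_1,\dots,d'_{k-1},d'_k-1)$. With $\prec$ the strict lexicographic order, $$X_\beta=\{(\varepsilon_n)_{n\in\mathbb{Z}}:\varepsilon_n\in\{0,1,\dots,[\beta]\},\ (\varepsilon_n,\varepsilon_{n+1},\dots)\prec(d_1,d_2,\dots)\ \text{for all } n\in\mathbb{Z}\}.$$ A Pisot unit $\beta$ is weakly finitary if for every $\delta>0$ and every $x\in\mathbb{Z}[\beta]\cap[0,\infty)$ there exists $f\in Fin(\beta)\cap[0,\delta)$ such that $x+f\in Fin(\beta)$. *)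

(* Defs.v *)
From HB Require Import structures.
From mathcomp Require Import all_boot all_order all_algebra.
From mathcomp Require Import complex.
From mathcomp Require Import all_classical all_reals all_analysis.

Set Implicit Arguments.
Unset Strict Implicit.
Unset Printing Implicit Defensive.

Import Order.TTheory GRing.Theory Num.Theory.
Import numFieldNormedType.Exports.

Local Open Scope classical_set_scope.
Local Open Scope ring_scope.

Section Torus.
Variables (R : realType) (m : nat).

Definition int_rV : {pred 'rV[R]_m} :=
  [pred v : 'rV[R]_m | [forall i, v ord0 i \is a Num.int]].

Fact int_rV_zmod_closed : zmod_closed int_rV.
Proof.
split=> [|u v /forallP uZ /forallP vZ]; apply/forallP => i.
  by rewrite mxE rpred0.
by rewrite !mxE rpredB.
Qed.
HB.instance Definition _ :=
  GRing.isZmodClosed.Build 'rV[R]_m int_rV int_rV_zmod_closed.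

(* [ideal_quot] is, despite its name, the quotient of a Z-module by an
   arbitrary subgroup. *)
Definition torus : Type := {ideal_quot int_rV}.

HB.instance Definition _ := Topological.copy torus (quotient_topology torus).
HB.instance Definition _ := EqQuotient.on torus.
HB.instance Definition _ := isPointed.Build torus (\pi_torus 0)%qT.
HB.instance Definition _ := GRing.Zmodule.on torus.

Definition torus_pi (v : 'rV[R]_m) : torus := (\pi_torus v)%qT.

Definition torus_borel := g_sigma_algebraType [set A : set torus | open A].

(* The Haar measure is the unique mu : probability torus_borel R with this
   property. *)
Definition translation_invariant (mu : set torus -> \bar R) :=
  forall (a : torus) (A : set torus),
    (measurable : set (set torus_borel)) A ->
    mu [set a + x | x in A] = mu A.

End Torus.

Section Pisot.
Variable R : realType.
Implicit Types beta x xi : R.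

Definition is_minpoly (p : {poly rat}) beta :=
  [/\ p \is monic, irreducible_poly p & root (map_poly ratr p) beta].

Definition galois_conjugate beta (z : R[i]) :=
  exists2 p, is_minpoly p beta & root (map_poly ratr p) z.

Definition pisot beta :=
  [/\ 1 < beta, integralOver (intr : int -> R) beta &
      forall z : R[i], galois_conjugate beta z -> z != beta%:C%C -> `|z| < 1].

Definition pisot_unit beta :=
  pisot beta /\ integralOver (intr : int -> R) beta^-1.

Definition dist_int x : R := inf [set `|x - k%:~R| | k in [set: int]].

Definition P_ beta : set R :=
  [set xi | dist_int (xi * beta ^+ n) @[n --> \oo] --> (0 : R)].

Definition Zadj beta : set R :=
  [set (map_poly intr q).[beta] | q in [set: {poly int}]].

(* [Num.truncn] is the integer part, as a nat, on nonnegative arguments, the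
   only ones that occur below. *)
Definition tau beta x : R := beta * x - (Num.truncn (beta * x))%:R.

(* Sequences indexed by k >= 1 in the usual notation are indexed from 0 here:
   [digit beta x k] is the (k+1)-st digit, and [digit beta 1 k] is d'_(k+1). *)
Definition digit beta x (k : nat) : nat :=
  Num.truncn (beta * iter k (tau beta) x).

(* A number x >= 1 is expanded by shifting the expansion of x / beta ^+ n for
   an n making this less than 1; finiteness does not depend on n. *)
Definition Fin beta : set R :=
  [set x | 0 <= x /\ exists n : nat, x / beta ^+ n < 1 /\
     \forall k \near \oo, digit beta (x / beta ^+ n) k = 0%N].

Definition weakly_finitary beta :=
  forall delta x : R, 0 < delta -> Zadj beta x -> 0 <= x ->
    exists f : R, [/\ Fin beta f, f < delta & Fin beta (x + f)].

Definition last_nonzero (u : nat -> nat) (k : nat) :=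
  (0 < u k)%N /\ forall j, (k < j)%N -> u j = 0%N.

Definition quasi_greedy beta : nat -> nat :=
  let d' := digit beta 1 in
  if pselect (exists k, last_nonzero d' k) is left e then
    let k := sval (cid e) in
    fun n => if (n %% k.+1 == k)%N then (d' k).-1 else d' (n %% k.+1)%N
  else d'.

Definition lex_lt (u v : nat -> nat) :=
  exists j, (forall i, (i < j)%N -> u i = v i) /\ (u j < v j)%N.

Definition X_ beta : set (int -> nat) :=
  [set e | forall n : int, (e n <= Num.truncn beta)%N /\
     lex_lt (fun i : nat => e (n + i%:Z)) (quasi_greedy beta)].

(* The sum over k >= - N of e_k beta^-k, with k = j - N. *)
Definition tail_sum beta (e : int -> nat) (N : nat) : R :=
  limn (series (fun j : nat => (e (j%:Z - N%:Z))%:R * beta ^ (N%:Z - j%:Z))).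

Definition phi (m : nat) beta xi (e : int -> nat) : torus R m :=
  lim (torus_pi (tail_sum beta e N *: \row_(i < m) (xi / beta ^+ i))
         @[N --> \oo]).

(* The norm of Q(beta)/Q at xi, for beta of degree m: the determinant of the
   multiplication by xi, written in the basis 1, beta, ..., beta^(m-1).  It
   takes the junk value 0 when xi does not belong to Q(beta). *)
Definition field_norm (m : nat) beta xi : rat :=
  xget 0 [set c | exists2 A : 'M[rat]_m,
    (forall i : 'I_m,
       xi * beta ^+ i = \sum_(j < m) ratr (A i j) * beta ^+ j) &
    c = \det A].

Definition discr (m : nat) (b : 'I_m -> R[i]) : R[i] :=
  \prod_(i < m) \prod_(j < m | (i < j)%N) (b i - b j) ^+ 2.

End Pisot.

(* Main.v *)
Require Import Defs.
From HB Require Import structures.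
From mathcomp Require Import all_boot all_order all_algebra.
From mathcomp Require Import complex separable qpoly measurable_realfun.
From mathcomp Require Import all_classical all_reals all_analysis.
From mathcomp Require Import ring lra zify.
Import Order.TTheory GRing.Theory Num.Theory.
Import numFieldNormedType.Exports.
Local Open Scope classical_set_scope.
Local Open Scope ring_scope.
Set Implicit Arguments.
Unset Strict Implicit.
Unset Printing Implicit Defensive.

(* Let M be the transpose of M_beta, [lin] the linear form with
   lin (y M) = beta lin y, and [vv] the eigenvector of M for beta with lin vv = 1.
   Pisot's argument writes xi (1, 1/beta, ...) as vv q(M) with q in Z[x], so that
   phi_xi is the coding map of the homoclinic point [pi vv] followed by the
   endomorphism q(M).  The number of points in a fibre of q(M) is |det q(M)|, the
   absolute value of the product of the q(beta_i) = xi_i P'(beta_i) / beta_i^n,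
   that is |D N(xi)|.  It remains to see that almost every point has exactly one
   code for the homoclinic point [pi vv].

   Two codes of a point have remainders (values of their parts of positive index)
   whose difference belongs to a finite subset F of Z[beta].  Weak finitarity,
   applied successively to the elements of F, gives an interval of remainders y on
   which the beta-transformation orbits of y and of all the y + z, z in F, have
   merged after L steps.  Hence the codes of a point of the set A of points with a
   code whose remainder lies in this interval agree beyond the index L, and a point
   whose backward orbit meets A infinitely often has only one code.  Each expanding
   segment of length 2 meets A in an interval of fixed length, at every scale, so
   the points whose forward orbit avoids A form a null set; by invariance of the
   Haar measure almost every backward orbit meets A infinitely often. *)

(** * The torus and its Haar measure *)

(** Weak finitarity speaks of single points. It spreads to intervals because the beta-transformation
    is affine on a short interval to the right of each point of [0, 1), but in general on none to
    the left; hence the intervals of remainders start at the point produced. They are also kept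
    below a constant c. Whether a past is admissible depends on the future attached to it, but
    finiteness of a set of integer vectors keeps the sums of all pasts at distance at least c below
    their bounds, so a past that may precede zeros may precede any remainder below c. Membership in
    A thus needs no matching condition, which makes A the image of a compact product and lets the
    expanding lines meet it in whole intervals. The Haar measure is given only by translation
    invariance; its invariance under endomorphisms comes from uniqueness, and this is why addition
    has to be measurable for the product sigma-algebra. Counting in the fibres of q(M) requires det
    q(M) nonzero, hence xi nonzero. For xi = 0 the map phi_xi is constant, and the count is 0 off
    one point, of measure 0. *)

Section TorusTopology.
Variables (R : realType) (m : nat).
Local Notation pi := (@torus_pi R m).
Local Notation T := (torus R m).

Lemma torus_piD (a b : 'rV[R]_m) : pi (a + b) = pi a + pi b.
Proof. exact: Quotient.pi_add. Qed.

Lemma torus_pi0 : pi 0 = 0 :> T.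
Proof. by apply: (addrI (pi 0)); rewrite -torus_piD !addr0. Qed.

Lemma torus_piN (a : 'rV[R]_m) : pi (- a) = - pi a.
Proof. by apply: (addrI (pi a)); rewrite -torus_piD !subrr torus_pi0. Qed.

Lemma torus_piB (a b : 'rV[R]_m) : pi (a - b) = pi a - pi b.
Proof. by rewrite torus_piD torus_piN. Qed.

Lemma torus_piP (x : T) : exists a, x = pi a.
Proof. by exists (repr x); rewrite /torus_pi reprK. Qed.

Lemma torus_pi_eq (a b : 'rV[R]_m) : pi a = pi b <-> a - b \in @int_rV R m.
Proof.
split=> h.
  by rewrite (Quotient.idealrBE (@int_rV R m)); apply/eqP.
by move: h; rewrite (Quotient.idealrBE (@int_rV R m)) => /eqP.
Qed.

Lemma int_rVP (a : 'rV[R]_m) :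
  reflect (forall i, a ord0 i \is a Num.int) (a \in @int_rV R m).
Proof. exact: forallP. Qed.

Lemma torus_pi_continuous : continuous pi.
Proof. exact: pi_continuous. Qed.

Lemma torus_openE (O : set T) : open O = open (pi @^-1` O).
Proof. by []. Qed.

Lemma torus_pi_open (O : set 'rV[R]_m) : open O -> open (pi @` O).
Proof.
move=> oO; rewrite torus_openE.
have -> : pi @^-1` (pi @` O) =
    \bigcup_(z in [set z | z \in @int_rV R m]) ((fun x => x - z) @^-1` O).
  apply/seteqP; split => x /=.
    move=> [y Oy /torus_pi_eq yx]; exists (x - y) => /=.
      by rewrite -rpredN opprB.
    by rewrite subKr.
  move=> [z /= zi Oz]; exists (x - z) => //; apply/torus_pi_eq.
  by rewrite addrAC subrr sub0r rpredN.
apply: bigcup_open => z _; move: oO; apply: ((continuousP _).1 _) => x.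
by apply: continuousB; [exact: cvg_id | exact: cst_continuous].
Qed.

Lemma rV_coord_le (x : 'rV[R]_m) i : `|x ord0 i| <= `|x|.
Proof.
rewrite [leRHS]/Num.norm /= mx_normrE; apply/bigmax_geP; right => /=.
by exists (ord0, i).
Qed.

Lemma rV_norm_le (x : 'rV[R]_m) (c : R) : 0 <= c ->
  (forall i, `|x ord0 i| <= c) -> `|x| <= c.
Proof.
move=> c0 h; rewrite [leLHS]/Num.norm /= mx_normrE; apply/bigmax_leP; split=> //=.
by move=> [i j] _ /=; rewrite ord1.
Qed.

Lemma int_rV_norm_lt1 (x : 'rV[R]_m) : x \in @int_rV R m -> `|x| < 1 -> x = 0.
Proof.
move=> /int_rVP xi x1; apply/rowP => i; rewrite mxE; apply/eqP.
by rewrite -[_ == _]negbK; apply/negP => /(norm_intr_ge1 (xi i)); rewrite leNgt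
  (le_lt_trans (rV_coord_le x i)).
Qed.

Lemma int_dist_gt0 (c : R) : c \isn't a Num.int ->
  exists2 e, 0 < e & forall k : R, k \is a Num.int -> e <= `|c - k|.
Proof.
move=> cZ; have /andP[f1 f2] := floor_itv c.
have f3 : (Num.floor c)%:~R < c.
  rewrite lt_neqAle f1 andbT; apply: contra cZ => /eqP <-; exact: intr_int.
exists (Num.min (c - (Num.floor c)%:~R) ((Num.floor c + 1)%:~R - c)).
  by rewrite lt_min !subr_gt0 f3.
move=> _ /intrP[k ->]; rewrite ge_min.
have [kc|kc] := lerP k (Num.floor c); apply/orP; [left|right].
  have : k%:~R <= (Num.floor c)%:~R :> R by rewrite ler_int.
  by move=> h; rewrite ger0_norm; lra.
have : (Num.floor c + 1)%:~R <= k%:~R :> R by rewrite ler_int lezD1.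
by move=> h; rewrite ltr0_norm; lra.
Qed.

Lemma torus_hausdorff : hausdorff_space T.
Proof.
rewrite open_hausdorff => x y.
have [a ->] := torus_piP x; have [b ->] := torus_piP y => xy.
have [e e0 he] : exists2 e : R, 0 < e &
    forall z, z \in @int_rV R m -> e <= `|a - b - z|.
  have /existsNP[i /negP] : ~ forall i, (a - b) ord0 i \is a Num.int.
    by move=> h; move/eqP: xy; apply; apply/torus_pi_eq/int_rVP.
  move=> /int_dist_gt0[e e0 he]; exists e => // z /int_rVP zi.
  by apply: le_trans (rV_coord_le _ i); rewrite !mxE; have := he _ (zi i); rewrite !mxE.
exists (pi @` ball a (e / 2), pi @` ball b (e / 2)).
  by split; rewrite inE /=; [exists a|exists b] => //; apply: ballxx; rewrite divr_gt0.
split => /=; [apply: torus_pi_open|apply: torus_pi_open|].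
- by apply: ball_open; rewrite divr_gt0.
- by apply: ball_open; rewrite divr_gt0.
apply/eqP/seteqP; split=> // _ [[u /= au <-]] [v /= bv] /torus_pi_eq vu.
have {}vu : u - v \in @int_rV R m by rewrite -rpredN opprB.
have := he _ vu.
move: au bv; rewrite -!ball_normE /= => au bv; apply/negP; rewrite -ltNge.
rewrite (_ : a - b - _ = (a - u) - (b - v)); last first.
  by apply/rowP => i; rewrite !mxE; ring.
by rewrite (le_lt_trans (ler_normB _ _)) // (splitr e) ltrD.
Qed.

Lemma torus_compact_closed (K : set 'rV[R]_m) : compact K -> closed (pi @` K).
Proof.
move=> cK; apply: compact_closed; first exact: torus_hausdorff.
apply: continuous_compact => //; apply: continuous_subspaceT.
exact: torus_pi_continuous.
Qed.

Lemma torus_add_open (O : set T) (a b : 'rV[R]_m) : open O -> O (pi a + pi b) ->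
  exists2 e : R, 0 < e & forall a' b', ball a e a' -> ball b e b' ->
    O (pi a' + pi b').
Proof.
rewrite torus_openE -torus_piD => oO /= Oab.
have /nbhs_ballP[e /= e0 he] : nbhs (a + b) (pi @^-1` O).
  by apply: open_nbhs_nbhs; split.
exists (e / 2); first by rewrite divr_gt0.
move=> a' b' aa bb; rewrite -torus_piD; apply: he.
move: aa bb; rewrite -!ball_normE /= => aa bb.
by rewrite opprD addrACA (le_lt_trans (ler_normD _ _)) // (splitr e) ltrD.
Qed.

Lemma rV_rat_dense (a : 'rV[R]_m) (e : R) : 0 < e ->
  exists q : 'rV[rat]_m, `|a - map_mx ratr q| < e.
Proof.
move=> e0.
have h i : exists q : rat, `|a ord0 i - ratr q| <= e / 2.
  have [x [ax [q _ qx]]] : ball (a ord0 i) (e / 2) `&` (@ratr R @` setT) !=set0.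
    apply: dense_rat; last by apply: ball_open; rewrite divr_gt0.
    by exists (a ord0 i); apply: ballxx; rewrite divr_gt0.
  by exists q; rewrite qx; move: ax; rewrite -ball_normE /= => /ltW.
exists (\row_i projT1 (cid (h i))).
rewrite (@le_lt_trans _ _ (e / 2)) //; last by rewrite gtr_pMr // invf_lt1 // ltr1n.
apply: rV_norm_le; first by rewrite divr_ge0 // ltW.
by move=> i; rewrite !mxE; case: cid.
Qed.

Lemma mulmx_norm_le (y : 'rV[R]_m) (A : 'M[R]_m) :
  `|y *m A| <= `|y| * \sum_i \sum_j `|A i j|.
Proof.
apply: rV_norm_le.
  by rewrite mulr_ge0 // sumr_ge0 // => i _; rewrite sumr_ge0.
move=> j; rewrite mxE mulr_sumr (le_trans (ler_norm_sum _ _ _)) //.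
apply: ler_sum => i _; rewrite normrM ler_pM // ?rV_coord_le //.
by rewrite (bigD1 j) //= lerDl sumr_ge0.
Qed.

Lemma mulmx_continuous (A : 'M[R]_m) : continuous (fun y : 'rV[R]_m => y *m A).
Proof.
apply: (@bounded_linear_continuous _ _ _ (mulmxr A)).
apply/bounded_funP => r; exists (r * \sum_i \sum_j `|A i j|) => x xr /=.
rewrite (le_trans (mulmx_norm_le _ _)) // ler_wpM2r //.
by rewrite sumr_ge0 // => i _; rewrite sumr_ge0.
Qed.

Lemma mulmx_int_rV (B : 'M[int]_m) (z : 'rV[R]_m) :
  z \in @int_rV R m -> z *m map_mx intr B \in @int_rV R m.
Proof.
move=> /int_rVP zi; apply/int_rVP => i; rewrite mxE rpred_sum // => j _.
by rewrite rpredM // mxE intr_int.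
Qed.

Definition torus_mul (B : 'M[int]_m) (x : T) : T := pi (repr x *m map_mx intr B).

Lemma torus_mul_pi (B : 'M[int]_m) y : torus_mul B (pi y) = pi (y *m map_mx intr B).
Proof.
apply/torus_pi_eq; rewrite -mulmxBl mulmx_int_rV //; apply/torus_pi_eq.
by rewrite /torus_pi reprK.
Qed.

Lemma torus_mulD B (x y : T) : torus_mul B (x + y) = torus_mul B x + torus_mul B y.
Proof.
have [a ->] := torus_piP x; have [b ->] := torus_piP y.
by rewrite -torus_piD !torus_mul_pi mulmxDl torus_piD.
Qed.

Lemma torus_mul0 B : torus_mul B 0 = 0 :> T.
Proof. by apply: (addrI (torus_mul B 0)); rewrite -torus_mulD !addr0. Qed.

Lemma torus_mulN B (x : T) : torus_mul B (- x) = - torus_mul B x.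
Proof. by apply: (addrI (torus_mul B x)); rewrite -torus_mulD !subrr torus_mul0. Qed.

Lemma torus_mulB B (x y : T) : torus_mul B (x - y) = torus_mul B x - torus_mul B y.
Proof. by rewrite torus_mulD torus_mulN. Qed.

Lemma torus_mulA B C (x : T) : torus_mul (B *m C) x = torus_mul C (torus_mul B x).
Proof. by have [a ->] := torus_piP x; rewrite !torus_mul_pi map_mxM mulmxA. Qed.

Lemma torus_mul1 (x : T) : torus_mul 1%:M x = x.
Proof. by have [a ->] := torus_piP x; rewrite torus_mul_pi map_mx1 mulmx1. Qed.

Lemma torus_mul_continuous B : continuous (torus_mul B).
Proof.
apply/quotient_continuous.
rewrite (_ : _ \o _ = pi \o (fun y => y *m map_mx intr B)); last first.
  by apply/funext => y /=; rewrite -torus_mul_pi.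
move=> x; apply: continuous_comp; first exact: mulmx_continuous.
exact: torus_pi_continuous.
Qed.

Section Invertible.
Variable B : 'M[int]_m.
Hypothesis Bu : (map_mx intr B : 'M[R]_m) \in unitmx.

Lemma torus_mul_surj (x : T) : exists y, torus_mul B y = x.
Proof.
have [a ->] := torus_piP x; exists (pi (a *m invmx (map_mx intr B))).
by rewrite torus_mul_pi mulmxKV.
Qed.

Lemma torus_mul_open (O : set T) : open O -> open (torus_mul B @` O).
Proof.
rewrite {1}torus_openE => oO.
rewrite (_ : _ @` O = pi @` ((fun y => y *m invmx (map_mx intr B)) @^-1`
    (pi @^-1` O))).
  apply: torus_pi_open; move: oO; apply: ((continuousP _).1 _).
  exact: mulmx_continuous.
apply/seteqP; split => [_ [x Ox <-]|_ [y /= Oy <-]].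
  have [a xa] := torus_piP x; exists (a *m map_mx intr B) => /=.
    by rewrite mulmxK // -xa.
  by rewrite xa torus_mul_pi.
by exists (pi (y *m invmx (map_mx intr B))) => //; rewrite torus_mul_pi mulmxKV.
Qed.

End Invertible.

End TorusTopology.

(** * Measurability of addition, uniqueness and invariance of the Haar measure *)

Section TorusMeasure.
Variables (R : realType) (m : nat).
Local Notation pi := (@torus_pi R m).
Local Notation T := (torus R m).
Local Notation TB := (torus_borel R m).

Lemma torus_open_measurable (U : set T) : open U ->
  (measurable : set (set TB)) U.
Proof. by move=> oO; apply: sub_sigma_algebra. Qed.

Lemma torus_closed_measurable (U : set T) : closed U ->
  (measurable : set (set TB)) U.
Proof.
move=> cO; rewrite -[U]setCK; apply: measurableC; apply: torus_open_measurable.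
exact: closed_openC.
Qed.

Lemma torus_continuous_measurable (f : T -> T) : continuous f ->
  measurable_fun setT (f : TB -> TB).
Proof.
move=> /continuousP cf; apply: (@measurability _ _ TB TB setT f [set A : set T | open A]) => //.
by move=> _ [U oO <-]; rewrite setTI; apply: torus_open_measurable; exact: cf.
Qed.

Lemma torus_addl_continuous (a : T) : continuous (+%R a : T -> T).
Proof.
apply/quotient_continuous; have [c ->] := torus_piP a.
rewrite (_ : _ \o _ = pi \o (fun y => c + y)); last first.
  by apply/funext => y /=; rewrite torus_piD.
move=> x; apply: continuous_comp; last exact: torus_pi_continuous.
by apply: continuousD; [exact: cst_continuous | exact: cvg_id].
Qed.

(** Continuity alone does not suffice: for the product sigma-algebra the preimage of an open set has
    to be a countable union of measurable rectangles. One side runs over balls around rational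
    vectors, the other is the largest open set whose sum with such a ball stays in [U]. *)
Lemma torus_add_measurable :
  measurable_fun setT (fun p : TB * TB => (p.1 + p.2 : T) : TB).
Proof.
apply: (@measurability _ _ (TB * TB)%type TB setT _ [set A : set T | open A]) => //.
move=> _ [U oO <-]; rewrite setTI.
pose V (q : 'rV[rat]_m * nat) : set T :=
  pi @` ball (map_mx ratr q.1 : 'rV[R]_m) (q.2.+1%:R^-1).
pose W' q : set T := \bigcup_(W in [set W | open W /\
   forall w v : T, W w -> V q v -> U (w + v)]) W.
rewrite (_ : _ @^-1` _ = \bigcup_q (W' q `*` V q)).
  apply: countable_bigcupT_measurable => // q.
  apply: measurableX; apply: torus_open_measurable.
    by apply: bigcup_open => W [].
  by apply/torus_pi_open/ball_open; rewrite invr_gt0.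
apply/seteqP; split => [[x y] /= Oxy|[x y] [q _ [/= [W [oW hW] Wx] Vy]]]; last exact: hW.
have [a xa] := torus_piP x; have [b yb] := torus_piP y.
move: Oxy; rewrite xa yb => /(torus_add_open oO)[e e0 he].
have [k ke] : exists k : nat, k.+1%:R^-1 < e / 2.
  exists (Num.truncn (e / 2)^-1); rewrite invf_plt ?posrE ?divr_gt0 //.
  by rewrite truncnS_gt // invr_ge0 divr_ge0 // ltW.
have [q hq] := @rV_rat_dense _ _ b (k.+1%:R^-1) ltac:(by rewrite invr_gt0).
exists (q, k) => //; split => /=; last first.
  by exists b => //; rewrite -ball_normE /= distrC.
exists (pi @` ball a e); last by exists a => //; exact: ballxx.
split; first exact/torus_pi_open/ball_open.
move=> _ _ [a' aa <-] [b' bb <-]; apply: he => //.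
move: bb hq; rewrite -!ball_normE /= => bb hq.
rewrite -(subrKA (map_mx ratr q)) (le_lt_trans (ler_normD _ _)) //.
by rewrite (splitr e) ltrD // (lt_trans _ ke).
Qed.

Lemma torus_translate_preimage (a : T) (A : set T) :
  [set a + x | x in A] = (fun x => - a + x) @^-1` A.
Proof.
apply/seteqP; split => [_ [x Ax <-]|x /= Ax]; first by rewrite /= addKr.
by exists (- a + x) => //; rewrite addrA subrr add0r.
Qed.

Lemma torus_translate_measurable (a : T) (A : set T) :
  (measurable : set (set TB)) A -> (measurable : set (set TB)) [set a + x | x in A].
Proof.
move=> mA; rewrite torus_translate_preimage.
have := torus_continuous_measurable (@torus_addl_continuous (- a)) measurableT mA.
by rewrite setTI.
Qed.

(** Fubini on the set of pairs (x, y) with x + y in [C]: all its sections are translates of [C], so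
    its product measure is both [mu C] and [nu C]. *)
Lemma haar_unique (mu nu : probability TB R) (C : set T) :
  translation_invariant mu -> translation_invariant nu ->
  (measurable : set (set TB)) C -> mu C = nu C.
Proof.
move=> tmu tnu mC.
pose S : set (TB * TB) := [set p | C (p.1 + p.2)].
have mS : measurable S by have := torus_add_measurable measurableT mC; rewrite setTI.
have := indic_fubini_tonelli mu nu mS.
rewrite indic_fubini_tonelli_FE // indic_fubini_tonelli_GE //.
rewrite (_ : nu \o xsection S = cst (nu C)); last first.
  apply/funext => x /=; rewrite -(tnu (- x) C mC) torus_translate_preimage opprK.
  by congr (nu _); apply/seteqP; split => y /=; rewrite /xsection /= inE.
rewrite (_ : mu \o ysection S = cst (mu C)); last first.
  apply/funext => x /=; rewrite -(tmu (- x) C mC) torus_translate_preimage opprK.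
  by congr (mu _); apply/seteqP; split => y /=; rewrite /ysection /= inE /S /= addrC.
rewrite (integral_cst mu measurableT) (integral_cst nu measurableT).
by rewrite [X in (nu C * X)%E](probability_setT mu)
  [X in (_ = mu C * X)%E](probability_setT nu) !mule1.
Qed.

Section Invariance.
Variable mu : probability TB R.
Hypothesis tmu : translation_invariant mu.
Variable B : 'M[int]_m.
Hypothesis Bu : (map_mx intr B : 'M[R]_m) \in unitmx.

Lemma torus_mul_measurable : measurable_fun setT (torus_mul B : TB -> TB).
Proof. by apply: torus_continuous_measurable; exact: torus_mul_continuous. Qed.

(** The image measure is translation invariant because the endomorphism is onto; uniqueness
    concludes. *)
Lemma haar_torus_mul (C : set T) : (measurable : set (set TB)) C ->
  mu (torus_mul B @^-1` C) = mu C.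
Proof.
move=> mC.
pose X : {mfun TB >-> TB} := HB.pack (torus_mul B : TB -> TB)
  (isMeasurableFun.Build _ _ _ _ _ torus_mul_measurable).
pose nu : probability TB R := distribution mu X.
suff tnu : translation_invariant nu by rewrite (haar_unique tmu tnu mC).
move=> a A mA.
rewrite -[LHS]/(mu (torus_mul B @^-1` _)) -[RHS]/(mu (torus_mul B @^-1` A)).
have [b ba] := torus_mul_surj Bu a.
have mTA : (measurable : set (set TB)) (torus_mul B @^-1` A).
  by have := torus_mul_measurable measurableT mA; rewrite setTI.
apply: (etrans _ (tmu b mTA)); congr (mu _); rewrite !torus_translate_preimage.
by apply/seteqP; split => x /=; rewrite torus_mulD torus_mulN ba.
Qed.

(** The preimage of the image of [N] is covered by the translates of [N] by the elements of [s],
    since [s] contains the kernel. *)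
Lemma haar_image_null (s : seq T) (N : set T) :
  (forall c, torus_mul B c = 0 -> c \in s) ->
  (measurable : set (set TB)) N -> (measurable : set (set TB)) (torus_mul B @` N) ->
  mu N = 0%E -> mu (torus_mul B @` N) = 0%E.
Proof.
move=> hs mN mBN N0; rewrite -haar_torus_mul //.
have mp : (measurable : set (set TB)) (torus_mul B @^-1` (torus_mul B @` N)).
  by have := torus_mul_measurable measurableT mBN; rewrite setTI.
apply/(negligibleP mu mp).
pose F (i : nat) : set T := [set nth 0 s i + x | x in N].
apply: (@negligibleS _ _ _ mu (\bigcup_i F i)).
  move=> x /= [y Ny yx].
  have : x - y \in s by apply: hs; rewrite torus_mulB yx subrr.
  move=> /(nthP 0)[i _ ixy]; exists i => //; exists y => //.
  by rewrite ixy subrK.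
apply: negligible_bigcup => i; apply/negligibleP; first exact: torus_translate_measurable.
by rewrite -N0; exact: tmu.
Qed.

End Invariance.
End TorusMeasure.

(** * Beta-expansions and synchronization *)

Section BetaExpansion.
Variables (R : realType) (beta : R).
Hypothesis beta_gt1 : 1 < beta.
Local Notation tau := (tau beta).

Let beta_gt0 : 0 < beta. Proof. exact: lt_trans ltr01 beta_gt1. Qed.
Let beta_neq0 : beta != 0. Proof. by rewrite gt_eqF. Qed.

Lemma expr_unbounded (M : R) : exists n, M < beta ^+ n.
Proof.
have h n : 1 + n%:R * (beta - 1) <= beta ^+ n.
  elim: n => [|n ih]; first by rewrite mul0r addr0.
  rewrite exprS; have n0 : 0 <= n%:R :> R by [].
  have b0 : 0 < beta - 1 by rewrite subr_gt0.
  rewrite (le_trans _ (ler_wpM2l (ltW beta_gt0) ih)) // -subr_ge0 -natr1.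
  have -> : beta * (1 + n%:R * (beta - 1)) - (1 + (n%:R + 1) * (beta - 1)) =
    n%:R * (beta - 1) ^+ 2 by ring.
  by rewrite mulr_ge0 // sqr_ge0.
have b0 : 0 < beta - 1 by rewrite subr_gt0.
exists (Num.truncn (`|M| / (beta - 1))).+1; apply: lt_le_trans (h _).
rewrite (le_lt_trans (ler_norm M)) // ltr_pwDl // -ler_pdivrMr //.
by rewrite ltW // truncnS_gt.
Qed.

(** The recurring device for equalities: a defect that is multiplied by [beta] at each step and yet
    stays bounded is 0. *)
Lemma expr_bounded_eq0 (x M : R) : (forall n, `|x| * beta ^+ n <= M) -> x = 0.
Proof.
move=> h; apply/eqP; rewrite -normr_le0 leNgt; apply/negP => x0.
have [n] := expr_unbounded (M / `|x|).
by rewrite ltr_pdivrMr // mulrC ltNge h.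
Qed.

Lemma tau_itv x : 0 <= x -> 0 <= tau x < 1.
Proof.
move=> x0; have /truncn_itv/andP[h1 h2] : 0 <= beta * x by rewrite mulr_ge0 // ltW.
by rewrite /tau subr_ge0 h1 /= ltrBlDr nat1r.
Qed.

Lemma tau_digit x d y : beta * x = d%:R + y -> 0 <= y < 1 ->
  Num.truncn (beta * x) = d /\ tau x = y.
Proof.
move=> e /andP[y0 y1]; have -> : tau x = beta * x - (Num.truncn (beta * x))%:R by [].
have -> : Num.truncn (beta * x) = d.
  by apply/truncn_def; rewrite e lerDl y0 -natr1 ltrD2l.
by split=> //; rewrite e addrC addKr.
Qed.

Lemma iter_tau_itv k x : 0 <= x < 1 -> 0 <= iter k tau x < 1.
Proof. by move=> x01; elim: k => //= k /andP[h _]; exact: tau_itv. Qed.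

Lemma tau_rec x k :
  beta * iter k tau x = (digit beta x k)%:R + iter k.+1 tau x.
Proof. by rewrite iterS /digit; set y := iter k _ x; rewrite /tau addrC subrK. Qed.

Lemma tau_lt1 x : 0 <= x -> beta * x < 1 -> tau x = beta * x.
Proof.
move=> x0 bx; have [||_ ->//] := @tau_digit x 0 (beta * x); first by rewrite add0r.
by rewrite bx mulr_ge0 // ltW.
Qed.

Lemma iter_tau0 k : iter k tau 0 = 0.
Proof. by elim: k => //= k ->; rewrite tau_lt1 ?mulr0. Qed.

Lemma iter_tau_small k x : 0 <= x -> x < 1 -> iter k tau (x / beta ^+ k) = x.
Proof.
move=> x0 x1; elim: k => [|k ih]; first by rewrite divr1.
have e : beta * (x / beta ^+ k.+1) = x / beta ^+ k.
  by rewrite exprS; field; rewrite beta_neq0 expf_neq0.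
suff st : tau (x / beta ^+ k.+1) = x / beta ^+ k by rewrite iterSr st.
apply: (etrans _ e); apply: tau_lt1; first by rewrite divr_ge0 // exprn_ge0 // ltW.
by rewrite e ltr_pdivrMr ?exprn_gt0 // mul1r (lt_le_trans x1) // exprn_ege1 // ltW.
Qed.

(** Once the digits vanish, the orbit is multiplied by [beta] at each step while staying below 1, so
    it is 0. *)
Lemma Fin_iter_tau f : Fin beta f -> f < 1 ->
  exists K, forall L, (K <= L)%N -> iter L tau f = 0.
Proof.
move=> [f0 [n [fn [K _ hK]]]] f1; exists K => L KL.
set y := f / beta ^+ n in fn hK.
have y01 : 0 <= y < 1 by rewrite fn divr_ge0 // exprn_ge0 // ltW.
rewrite -(iter_tau_small n f0 f1) -/y -iterD.
have KLn : (K <= L + n)%N by rewrite (leq_trans KL) // leq_addr.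
apply: (@expr_bounded_eq0 _ 1) => j.
have -> : `|iter (L + n) tau y| * beta ^+ j = iter (j + (L + n)) tau y.
  elim: j => [|j ih].
    by rewrite expr0 mulr1 ger0_norm //; have /andP[] := iter_tau_itv (L + n) y01.
  have := tau_rec y (j + (L + n)); rewrite (hK _ _) /=; last first.
    by rewrite (leq_trans KLn) // leq_addl.
  by rewrite add0r => <-; rewrite -ih exprS; ring.
by have /andP[_ /ltW] := iter_tau_itv (j + (L + n)) y01.
Qed.

(** The map [tau] is right-continuous with slope [beta], so a short interval to the right of [x]
    meets no jump during [L] steps. *)
Lemma iter_tau_right_affine L x : 0 <= x < 1 ->
  exists2 e : R, 0 < e & forall s, 0 <= s <= e ->
    iter L tau (x + s) = iter L tau x + beta ^+ L * s.
Proof.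
move=> x01; elim: L => [|L [e e0 ih]].
  by exists 1 => // s _; rewrite expr0 mul1r.
set y := iter L tau x.
have /andP[/= y0 _] := iter_tau_itv L x01.
have /andP[z0 z1] : 0 <= tau y < 1 by exact: tau_itv.
exists (Num.min e ((1 - tau y) / 2 / beta ^+ L.+1)).
  by rewrite lt_min e0 !divr_gt0 ?exprn_gt0 // subr_gt0.
move=> s /andP[s0]; rewrite le_min => /andP[se].
rewrite ler_pdivlMr ?exprn_gt0 // => sb.
rewrite /= ih ?s0 // -/y.
have [||_ ->//] := @tau_digit (y + beta ^+ L * s) (Num.truncn (beta * y))
  (tau y + beta ^+ L.+1 * s).
  by rewrite /tau exprS; ring.
have : 0 <= beta ^+ L.+1 * s by rewrite mulr_ge0 // exprn_ge0 // ltW.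
by move: sb; rewrite mulrC => sb; lra.
Qed.

Lemma Zadj0 : Zadj beta 0.
Proof. by exists 0 => //; rewrite rmorph0 horner0. Qed.

Lemma ZadjD x y : Zadj beta x -> Zadj beta y -> Zadj beta (x + y).
Proof. by move=> [p _ <-] [q _ <-]; exists (p + q) => //; rewrite rmorphD hornerD. Qed.

Lemma ZadjN x : Zadj beta x -> Zadj beta (- x).
Proof. by move=> [p _ <-]; exists (- p) => //; rewrite rmorphN hornerN. Qed.

Lemma ZadjM x y : Zadj beta x -> Zadj beta y -> Zadj beta (x * y).
Proof. by move=> [p _ <-] [q _ <-]; exists (p * q) => //; rewrite rmorphM hornerM. Qed.

Lemma Zadj_int (k : int) : Zadj beta k%:~R.
Proof. by exists k%:P => //; rewrite map_polyC hornerC. Qed.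

Lemma Zadj_beta : Zadj beta beta.
Proof. by exists 'X => //; rewrite map_polyX hornerX. Qed.

Lemma ZadjX x n : Zadj beta x -> Zadj beta (x ^+ n).
Proof.
move=> zx; elim: n => [|n ih]; first exact: (Zadj_int 1).
by rewrite exprS; exact: ZadjM.
Qed.

Lemma iter_tau_Zadj L x : Zadj beta (beta ^+ L * x - iter L tau x).
Proof.
elim: L => [|L ih]; first by rewrite expr0 mul1r subrr; exact: Zadj0.
rewrite (_ : _ - _ = beta * (beta ^+ L * x - iter L tau x) + (digit beta x L)%:~R).
  by apply: ZadjD; [apply: ZadjM => //; exact: Zadj_beta | exact: Zadj_int].
by rewrite mulrBr tau_rec exprS -mulrA -pmulrn; ring.
Qed.

Section Synchronization.
Hypothesis wf : weakly_finitary beta.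

(* Just to the right of a point f with f and f + z finite, both orbits reach
   beta^L s after L steps. *)
Lemma sync_one c z : 0 < c -> c <= 1 -> Zadj beta z ->
  exists f e L, [/\ 0 <= f, 0 < e, f + e < c &
    forall s, 0 <= s <= e -> iter L tau (f + s) = beta ^+ L * s /\
      (0 <= f + s + z < 1 -> iter L tau (f + s + z) = beta ^+ L * s)].
Proof.
move=> c0 c1 zz.
have main f g : Fin beta f -> Fin beta g -> g = f + z -> f < c ->
    exists f e L, [/\ 0 <= f, 0 < e, f + e < c &
    forall s, 0 <= s <= e -> iter L tau (f + s) = beta ^+ L * s /\
      (0 <= f + s + z < 1 -> iter L tau (f + s + z) = beta ^+ L * s)].
  move=> Ff Fg gfz fc; have f1 := lt_le_trans fc c1.
  have [f0 _] := Ff; have [g0 _] := Fg.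
  have [K hK] := Fin_iter_tau Ff f1.
  have [M hM] : exists M, g < 1 -> forall L, (M <= L)%N -> iter L tau g = 0.
    have [g1|g1] := ltP g 1; last by exists 0%N.
    by have [M hM] := Fin_iter_tau Fg g1; exists M.
  have [|e e0 he] := @iter_tau_right_affine (K + M) f; first by rewrite f0.
  have [e' e'0 he'] : exists2 e : R, 0 < e & g < 1 -> forall s, 0 <= s <= e ->
      iter (K + M) tau (g + s) = iter (K + M) tau g + beta ^+ (K + M) * s.
    have [g1|g1] := ltP g 1; last by exists 1.
    have [|e' e'0 he'] := @iter_tau_right_affine (K + M) g; first by rewrite g0.
    by exists e'.
  exists f, (Num.min ((c - f) / 2) (Num.min e e')), (K + M)%N; split => //.
  - by rewrite !lt_min e0 e'0 divr_gt0 // subr_gt0.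
  - by rewrite -ltrBrDl gt_min gtr_pMr ?subr_gt0 // invf_lt1 ?ltr1n.
  move=> s /andP[s0]; rewrite !le_min => /and3P[_ se se']; split.
    by rewrite he ?s0 // hK ?leq_addr // add0r.
  have -> : f + s + z = g + s by rewrite gfz addrAC.
  move=> /andP[_ g1]; have {}g1 : g < 1 by rewrite (le_lt_trans _ g1) // lerDl.
  by rewrite he' ?s0 // hM ?leq_addl // add0r.
have [z0|z0] := leP 0 z.
  have [f [Ff fc Fg]] := wf c0 zz z0.
  by apply: main Ff Fg _ fc; rewrite addrC.
(* If z <= -c, then s + z is negative for s <= c / 2, and nothing has to merge. *)
have [cz|cz] := leP c (- z).
  exists 0, (c / 2), 0%N; split => //; [by rewrite divr_gt0|lra|].
  by move=> s /andP[s0 sc]; rewrite expr0 mul1r add0r; split=> // /andP[]; lra.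
(* Here -c < z < 0. Weak finitarity at -z with bound c + z gives f such that f and f - z are finite;
   the base point is f - z < c, whose translate by z is f. *)
have [||f [Ff fc Fg]] := wf (_ : 0 < c + z) (ZadjN zz); [lra|lra|].
apply: main Fg Ff _ _; lra.
Qed.

(** The induction in [synchronization] needs the difference [w] between the translated orbit and
    beta^L s to be in Z[beta] again; it is, because [tau] only multiplies by [beta] and subtracts
    integers. If x is outside [0, 1), the choice of [e] makes the conclusion void. *)
Lemma affine_or_vacuous L x : Zadj beta (beta ^+ L * x) ->
  exists e w, [/\ 0 < e, Zadj beta w & forall s, 0 <= s <= e -> 0 <= x + s < 1 ->
    iter L tau (x + s) = beta ^+ L * s + w].
Proof.
move=> zx; have [x0|x0] := ltP x 0.
  exists (- x / 2), 0; split; [lra|exact: Zadj0|].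
  by move=> s /andP[_ se] /andP[]; lra.
have [x1|x1] := leP 1 x.
  by exists 1, 0; split => //; [exact: Zadj0|move=> s /andP[s0 _] /andP[]; lra].
have [|e e0 he] := @iter_tau_right_affine L x; first by rewrite x0.
exists e, (iter L tau x); split => //; last by move=> s se _; rewrite he // addrC.
rewrite (_ : iter _ _ _ = beta ^+ L * x - (beta ^+ L * x - iter L tau x)).
  by apply: ZadjD => //; apply: ZadjN; exact: iter_tau_Zadj.
by rewrite subKr.
Qed.

Lemma affine_or_vacuous_seq L f (F : seq R) : Zadj beta (beta ^+ L * f) ->
  (forall z, z \in F -> Zadj beta z) ->
  exists e (G : seq R), [/\ 0 < e, size G = size F, forall w, w \in G -> Zadj beta w &
   forall z, z \in F -> exists2 w, w \in G &
     forall s, 0 <= s <= e -> 0 <= f + s + z < 1 ->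
      iter L tau (f + s + z) = beta ^+ L * s + w].
Proof.
move=> zf; elim: F => [|z F ih] hF; first by exists 1, [::].
have [|e [G [e0 sG zG hG]]] := ih.
  by move=> w wF; apply: hF; rewrite inE wF orbT.
have [|e' [w [e'0 zw hw]]] := @affine_or_vacuous L (f + z).
  rewrite mulrDr; apply: ZadjD => //; apply: ZadjM.
    by apply: ZadjX; exact: Zadj_beta.
  by apply: hF; rewrite mem_head.
exists (Num.min e e'), (w :: G); split => /=.
- by rewrite lt_min e0.
- by rewrite sG.
- by move=> u; rewrite inE => /predU1P[->//|]; exact: zG.
move=> u; rewrite inE => /predU1P[->|uF].
  exists w; first exact: mem_head.
  move=> s; rewrite le_min => /and3P[s0 _ se]; rewrite addrAC => h.
  by apply: hw => //; rewrite s0.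
have [v vG hv] := hG _ uF; exists v; first by rewrite inE vG orbT.
by move=> s; rewrite le_min => /and3P[s0 se _]; apply: hv; rewrite s0.
Qed.

(* After L steps [sync_one] has merged the orbit of y + z with that of y for the
   first z, and the other differences are still in Z[beta], so that induction
   applies to a small multiple of the new interval. *)
Lemma synchronization (F : seq R) c : 0 < c -> c <= 1 ->
  (forall z, z \in F -> Zadj beta z) ->
  exists y0 e L, [/\ 0 <= y0, 0 < e, y0 + e < c &
    forall y, y0 <= y <= y0 + e -> forall z, z \in F -> 0 <= y + z < 1 ->
      iter L tau (y + z) = iter L tau y].
Proof.
elim: {F}(size F) {-2}F (erefl (size F)) c => [|n ih] [|z F] //= sF c c0 c1 zF.
  by exists 0, (c / 2), 0%N; split => //; lra.
have [|f [e [L [f0 e0 fec hL]]]] := @sync_one c z c0 c1; first by apply: zF; rewrite mem_head.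
have zf : Zadj beta (beta ^+ L * f).
  have := iter_tau_Zadj L f; have [|h _] := hL 0; first by rewrite lexx ltW.
  by move: h; rewrite addr0 mulr0 => ->; rewrite subr0.
have [|e' [G [e'0 sG zG hG]]] := @affine_or_vacuous_seq L f F zf.
  by move=> w wF; apply: zF; rewrite inE wF orbT.
have bL : 0 < beta ^+ L by rewrite exprn_gt0.
have sGn : size G = n by rewrite sG; case: sF.
(* The induction hypothesis is used in the variable beta^L s; this bound on it keeps s below [e] and
   [e']. *)
have [|||y2 [e2 [L2 [y20 e20 y2e h2]]]] := @ih G sGn (Num.min 1 (beta ^+ L * Num.min e e')).
- by rewrite lt_min ltr01 mulr_gt0 // lt_min e0.
- by rewrite ge_min lexx.
- by [].
move: y2e; rewrite lt_min => /andP[_]; rewrite -ltr_pdivrMl // lt_min => /andP[y2e y2e'].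
exists (f + (beta ^+ L)^-1 * y2), ((beta ^+ L)^-1 * e2), (L2 + L)%N; split.
- by rewrite addr_ge0 // mulr_ge0 // invr_ge0 ltW.
- by rewrite mulr_gt0 // invr_gt0.
- by rewrite -addrA -mulrDr; lra.
move=> y /andP[y1]; rewrite -addrA -mulrDr -lerBlDl => y3.
move: y1; rewrite -lerBrDl => y1.
have -> : y = f + (y - f) by rewrite addrC subrK.
set s := y - f in y1 y3 *.
have s0 : 0 <= s by rewrite (le_trans _ y1) // mulr_ge0 // invr_ge0 ltW.
have se : s <= e by rewrite (le_trans y3) // ltW.
have se' : s <= e' by rewrite (le_trans y3) // ltW.
have [|hs1 hs2] := hL s; first by rewrite s0.
move=> u; rewrite inE => /predU1P[->|uF] fsu.
  by rewrite !iterD hs1 hs2.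
have [w wG hw] := hG _ uF.
have {}hw := hw s _ fsu; rewrite !iterD hs1 hw ?s0 //.
apply: h2 => //.
  by apply/andP; split; [rewrite -ler_pdivrMl | rewrite -ler_pdivlMl].
by rewrite -hw ?s0 //; exact: iter_tau_itv.
Qed.

End Synchronization.

End BetaExpansion.

(** * Two-sided admissible sequences *)

Section Admissible.
Variables (R : realType) (beta : R).
Hypothesis beta_gt1 : 1 < beta.
Local Notation tau := (tau beta).
Let beta_gt0 : 0 < beta. Proof. exact: lt_trans ltr01 beta_gt1. Qed.
Let beta_neq0 : beta != 0. Proof. by rewrite gt_eqF. Qed.

Lemma iter_tau1_itv k : 0 <= iter k tau 1 <= 1.
Proof.
elim: k => [|k /andP[ih _]]; first by rewrite ler01 lexx.
by have /andP[-> /ltW] := tau_itv beta_gt1 ih.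
Qed.

Lemma digit_zero x k : iter k tau x = 0 -> digit beta x k = 0%N.
Proof. by move=> h; rewrite /digit h mulr0 truncn0. Qed.

(* The tails sum_(k >= n) d_(k+1) beta^(n-k-1) of the sequence (d_n). *)
Lemma quasi_greedy_tails : exists t : nat -> R,
  [/\ t 0%N = 1, forall k, 0 < t k <= 1 &
      forall k, beta * t k = (quasi_greedy beta k)%:R + t k.+1].
Proof.
rewrite /quasi_greedy; case: pselect => [e|ne]; last first.
  exists (fun k => iter k tau 1); split => // [k|k]; last exact: tau_rec.
  (* If the orbit of 1 reached 0, the digits would vanish from there on; the first digit being
     positive, there would be a last nonzero one. *)
  have /andP[h0 ->] := iter_tau1_itv k; rewrite andbT lt_neqAle h0 andbT eq_sym.
  apply/negP => /eqP tk; apply: ne.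
  have zero j : (k <= j)%N -> digit beta 1 j = 0%N.
    by move=> kj; apply: digit_zero; rewrite -(subnK kj) iterD tk iter_tau0.
  have d0 : (0 < digit beta 1 0)%N.
    by rewrite /digit /= mulr1 truncn_gt0 ltW.
  have ex : exists j, (0 < digit beta 1 j)%N by exists 0%N.
  have bd j : (0 < digit beta 1 j)%N -> (j <= k)%N.
    by have [//|kj] := leqP j k; rewrite (zero _ (ltnW kj)).
  case: (ex_maxnP ex bd) => j dj hj; exists j; split => // i ji.
  by apply/eqP; rewrite -leqn0 leqNgt; apply/negP => /hj; rewrite leqNgt ji.
case: cid => k /= [dk hk].
have tpos j : (j <= k)%N -> 0 < iter j tau 1.
  move=> jk; have /andP[h0 _] := iter_tau1_itv j.
  rewrite lt_neqAle h0 andbT eq_sym; apply/negP => /eqP tj.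
  by move: dk; rewrite digit_zero // -(subnK jk) iterD tj iter_tau0.
have tk1 : iter k.+1 tau 1 = 0.
  apply: (@expr_bounded_eq0 _ beta beta_gt1 _ 1) => j.
  have -> : `|iter k.+1 tau 1| * beta ^+ j = iter (j + k.+1) tau 1.
    elim: j => [|j ih].
      by rewrite expr0 mulr1 ger0_norm //; have /andP[] := iter_tau1_itv k.+1.
    have := tau_rec beta 1 (j + k.+1); rewrite hk; last by rewrite addnS ltnS leq_addl.
    by rewrite add0r => <-; rewrite -ih exprS; ring.
  by have /andP[] := iter_tau1_itv (j + k.+1).
(* At the end of a period the orbit of 1 falls to 0; the last digit lowered by one leaves the
   remainder 1 instead, with which the period starts again. *)
exists (fun n => iter (n %% k.+1) tau 1); split => [|n|n].
- by rewrite mod0n.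
- have /andP[_ ->] := iter_tau1_itv (n %% k.+1).
  by rewrite andbT tpos // -ltnS ltn_mod.
have [nk|nk] := eqVneq (n %% k.+1)%N k.
  rewrite nk tau_rec tk1 addr0 -addn1 -modnDml nk addn1 modnn /=.
  by rewrite natr1 prednK.
suff -> : (n.+1 %% k.+1 = (n %% k.+1).+1)%N by exact: tau_rec.
have lt : (n %% k.+1 < k)%N by rewrite ltn_neqAle nk -ltnS ltn_mod.
by rewrite -addn1 -modnDml addn1 modn_small.
Qed.

Lemma rem_sub (u v : nat -> nat) (r t : nat -> R) n :
  (forall k, beta * r k = (u k)%:R + r k.+1) ->
  (forall k, beta * t k = (v k)%:R + t k.+1) ->
  (forall i, (i < n)%N -> u i = v i) ->
  r n - t n = beta ^+ n * (r 0%N - t 0%N).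
Proof.
move=> hr ht; elim: n => [|n ih] h; first by rewrite expr0 mul1r.
rewrite exprS -mulrA -ih; last by move=> i ilt; apply: h; rewrite ltnS ltnW.
by rewrite mulrBr hr ht h //; ring.
Qed.

(** The tail 1 of the quasi-greedy sequence exceeds the remainder of [u], and the difference grows
    as long as the digits agree, so they part. At the first difference, remainders >= 0 and tails <=
    1 force the digit of [u] to be the smaller one. *)
Lemma lex_lt_quasi_greedy (u : nat -> nat) (r : nat -> R) :
  (forall k, 0 <= r k < 1) -> (forall k, beta * r k = (u k)%:R + r k.+1) ->
  lex_lt u (quasi_greedy beta).
Proof.
move=> r01 hr; have [t [t0 t01 ht]] := quasi_greedy_tails.
have /existsNP[j0 /eqP uj0] : ~ forall j, u j = quasi_greedy beta j.
  move=> h; have /andP[_] := r01 0%N; apply/negP; rewrite -leNgt.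
  suff /eqP : r 0%N - t 0%N = 0 by rewrite subr_eq0 t0 => /eqP ->.
  apply: (@expr_bounded_eq0 _ beta beta_gt1 _ 1) => n.
  have := @rem_sub u _ r t n hr ht (fun i _ => h i).
  move=> /(congr1 Num.norm); rewrite normrM (ger0_norm (exprn_ge0 _ (ltW beta_gt0))).
  rewrite mulrC => <-; rewrite ler_norml.
  by have /andP[] := r01 n; have /andP[] := t01 n; lra.
have ex : exists j, u j != quasi_greedy beta j by exists j0.
case: (ex_minnP ex) => j uj hj; exists j.
have agree i : (i < j)%N -> u i = quasi_greedy beta i.
  by move=> ij; apply/eqP; apply: contraTT ij => /hj; rewrite leqNgt.
split=> //; rewrite ltn_neqAle uj /= -ltnS -(ltr_nat R) -natr1.
have := @rem_sub u _ r t j hr ht agree.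
have : beta ^+ j * (r 0%N - t 0%N) < 0.
  by rewrite pmulr_rlt0 ?exprn_gt0 // t0 subr_lt0; have /andP[] := r01 0%N.
move=> h e; rewrite -e in h.
have /andP[r1 _] := r01 j.+1; have /andP[_ t1] := t01 j.+1.
have := hr j; have := ht j; have : beta * r j < beta * t j.
  by rewrite ltr_pM2l //; lra.
lra.
Qed.

(** At the first digit below the quasi-greedy one, the excess of the remainder over 1 is less than a
    later excess divided by a power of [beta]. Iterating with the bound [C] gives at most 1, and one
    more application gives strictness. *)
Lemma lex_lt_rem_lt1 (u : nat -> nat) (r : nat -> R) (C : R) :
  (forall k, r k <= C) -> (forall k, beta * r k = (u k)%:R + r k.+1) ->
  (forall k, lex_lt (fun i => u (k + i)%N) (quasi_greedy beta)) ->
  forall k, r k < 1.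
Proof.
move=> rC hr hl; have [t [t0 t01 ht]] := quasi_greedy_tails.
have step k : exists j, r k - 1 < (r (k + j).+1 - 1) / beta ^+ j.+1.
  have [j [agree lt]] := hl k; exists j; rewrite ltr_pdivlMr ?exprn_gt0 //.
  have := @rem_sub (fun i => u (k + i)%N) _ (fun i => r (k + i)%N) t j _ ht agree.
  rewrite addn0 t0 => /(_ _) e; rewrite mulrC exprS -mulrA -e; last first.
    by move=> i; rewrite hr addnS.
  rewrite mulrBr hr ht; have /andP[tj _] := t01 j.+1.
  move: lt; rewrite -(ltr_nat R) => lt.
  have : (u (k + j)%N)%:R + 1 <= (quasi_greedy beta j)%:R :> R.
    by rewrite natr1 ler_nat -(ltr_nat R).
  lra.
have le1 k : r k <= 1.
  rewrite leNgt; apply/negP => rk1.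
  have bd n k' : r k' - 1 <= `|C| / beta ^+ n.
    elim: n k' => [|n ih] k'.
      by rewrite divr1; have := rC k'; have := ler_norm C; lra.
    have [j /ltW h] := step k'; apply: le_trans h _.
    rewrite !exprS !invfM !mulrA !(mulrAC _ beta^-1) ler_wpM2r //.
      by rewrite invr_ge0 ltW.
    rewrite ler_pdivrMr ?exprn_gt0 // (le_trans (ih _)) // ler_peMr //.
      by rewrite divr_ge0 // exprn_ge0 // ltW.
    by rewrite exprn_ege1 // ltW.
  have : r k - 1 = 0.
    apply: (@expr_bounded_eq0 _ beta beta_gt1 _ `|C|) => n.
    by rewrite gtr0_norm ?subr_gt0 // -ler_pdivlMr ?exprn_gt0.
  lra.
move=> k; have [j h] := step k; rewrite -subr_lt0 (lt_le_trans h) //.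
by rewrite pmulr_lle0 ?invr_gt0 ?exprn_gt0 // subr_le0.
Qed.

Lemma rem_exists (e : int -> nat) (b : nat) : (forall n, (e n <= b)%N) ->
  exists (r : int -> R) (C : R), forall n, 0 <= r n <= C /\ beta * r n = (e n)%:R + r (n + 1).
Proof.
move=> eb.
pose u n (j : nat) : R := (e (n + j%:Z))%:R * beta ^- j.+1.
have u0 n j : 0 <= u n j by rewrite mulr_ge0 // invr_ge0 exprn_ge0 // ltW.
pose g (j : nat) : R := b%:R / beta * beta^-1 ^+ j.
have ug n j : u n j <= g j.
  rewrite /u /g exprS invfM exprVn mulrA ler_wpM2r ?invr_ge0 ?exprn_ge0 ?(ltW beta_gt0) //.
  by rewrite ler_wpM2r ?invr_ge0 ?ler_nat // ltW.
have cg : cvgn (series g).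
  apply: is_cvg_geometric_series; rewrite ger0_norm ?invr_ge0 ?(ltW beta_gt0) //.
  by rewrite invf_lt1.
have cu n : cvgn (series (u n)).
  apply: series_le_cvg cg => //= j.
  by rewrite /g mulr_ge0 ?exprn_ge0 ?divr_ge0 ?invr_ge0 // ltW.
exists (fun n => limn (series (u n))), (limn (series g)) => n; split.
  apply/andP; split.
    apply: limr_ge => //; apply: nearW => N; rewrite /series /=.
    by apply: sumr_ge0.
  by apply: lim_series_le.
have : (fun N => series (u n) N.+1) @ \oo --> limn (series (u n)).
  by rewrite cvg_shiftS; exact: cu.
have -> : (fun N => series (u n) N.+1) =
   (fun N => u n 0%N + beta^-1 * series (u (n + 1)) N).
  apply/funext => N; rewrite /series /= big_nat_recl //; congr (_ + _).
  rewrite mulr_sumr; apply: eq_bigr => j _.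
  have -> : u n j.+1 = (e (n + 1 + j%:Z))%:R * beta ^- j.+2.
    by rewrite /u (_ : n + j.+1%:Z = n + 1 + j%:Z) //; lia.
  by rewrite /u (exprS _ j.+1) invfM mulrCA.
move=> c1.
have c2 : (u n 0%N + beta^-1 * series (u (n + 1)) N) @[N --> \oo] -->
    u n 0%N + beta^-1 * limn (series (u (n + 1))).
  by apply: cvgD; [exact: cvg_cst | apply: cvgM; [exact: cvg_cst | exact: cu]].
rewrite (cvg_unique (@Rhausdorff R) c1 c2) mulrDr mulVKf //; congr (_ + _).
by rewrite /u addr0 expr1 mulrCA divff // mulr1.
Qed.

(* r n is the sum of the e (n + k) beta^(-k-1) over k >= 0. *)
Lemma X_P (e : int -> nat) : X_ beta e <->
  exists r : int -> R, forall n, 0 <= r n < 1 /\ beta * r n = (e n)%:R + r (n + 1).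
Proof.
split=> [Xe|[r hr] n].
  have [r [C hr]] := rem_exists (fun n => (Xe n).1).
  exists r => n; have [/andP[r0 _] rn] := hr n; split=> //; rewrite r0 /=.
  rewrite -[n]addr0.
  apply: (@lex_lt_rem_lt1 (fun i => e (n + i%:Z)) (fun i => r (n + i%:Z)) C _ _ _ 0%N) => k.
  - by have [/andP[]] := hr (n + k%:Z).
  - have [_ ->] := hr (n + k%:Z); congr (_ + r _); lia.
  - have [_] := Xe (n + k%:Z); congr (lex_lt _ _); apply/funext => i; congr e; lia.
have rn k : 0 <= r (n + k%:Z) < 1 by have [] := hr (n + k%:Z).
have rr (k : nat) : beta * r (n + k%:Z) = (e (n + k%:Z))%:R + r (n + k.+1%:Z).
  by have [_ ->] := hr (n + k%:Z); congr (_ + r _); lia.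
split; last exact: (lex_lt_quasi_greedy rn rr).
have [/andP[r0 r1] e1] := hr n; have [/andP[r2 _] _] := hr (n + 1).
rewrite -(ler_nat R); have bn : beta * r n <= beta by rewrite ler_piMr // ltW.
have : (e n)%:R <= beta by lra.
by move=> h; rewrite ler_nat truncn_ge_nat // ltW.
Qed.

(** The exponent is N + 1 because the digit of index -N has weight beta^N in the tail sum and
    beta^(-1) in its remainder. *)
Lemma tail_sumE (e : int -> nat) (r : int -> R) N :
  (forall n, 0 <= r n < 1 /\ beta * r n = (e n)%:R + r (n + 1)) ->
  tail_sum beta e N = beta ^+ N.+1 * r (- N%:Z).
Proof.
move=> hr; rewrite /tail_sum.
have partial J : series (fun j : nat => (e (j%:Z - N%:Z))%:R * beta ^ (N%:Z - j%:Z)) J =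
    beta ^+ N.+1 * (r (- N%:Z) - (beta ^+ J)^-1 * r (J%:Z - N%:Z)).
  elim: J => [|J ih].
    by rewrite /series /= big_geq // sub0r expr0 invr1 mul1r subrr mulr0.
  rewrite /series /= big_nat_recr //= -/(series _ J) in ih *.
  rewrite ih; have [_ e1] := hr (J%:Z - N%:Z).
  rewrite (_ : J.+1%:Z - N%:Z = J%:Z - N%:Z + 1); last by lia.
  move: e1 => /(congr1 (fun x => x - r (J%:Z - N%:Z + 1))); rewrite addrK => <-.
  rewrite expfzDr // -invr_expz -!exprnP !exprS; field.
  by rewrite beta_neq0 expf_neq0.
apply: cvg_lim; first exact: Rhausdorff.
rewrite (_ : series _ = fun J => beta ^+ N.+1 *
   (r (- N%:Z) - (beta ^+ J)^-1 * r (J%:Z - N%:Z))); last exact/funext.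
apply: cvgM; first exact: cvg_cst.
rewrite -[X in _ --> X]subr0; apply: cvgB; first exact: cvg_cst.
apply: (@squeeze_cvgr _ _ _ _ (fun=> 0) (fun J => (beta^-1) ^+ J)); last 2 first.
- exact: cvg_cst.
- by apply: cvg_expr; rewrite ger0_norm ?invr_ge0 ?(ltW beta_gt0) // invf_lt1.
apply: nearW => J; have [/andP[r0 r1] _] := hr (J%:Z - N%:Z).
rewrite mulr_ge0 ?invr_ge0 ?exprn_ge0 ?(ltW beta_gt0) //= exprVn.
by rewrite ler_piMr ?invr_ge0 ?exprn_ge0 ?(ltW beta_gt0) // ltW.
Qed.

Lemma X_digit (e : int -> nat) (r : int -> R) :
  (forall n, 0 <= r n < 1 /\ beta * r n = (e n)%:R + r (n + 1)) ->
  forall n k, r (n + k%:Z) = iter k tau (r n) /\ e (n + k%:Z) = digit beta (r n) k.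
Proof.
move=> hr n k.
suff h : r (n + k%:Z) = iter k tau (r n).
  split=> //; rewrite /digit -h; have [_ e1] := hr (n + k%:Z).
  by have [//|->] := tau_digit e1; have [] := hr (n + k%:Z + 1).
elim: k => [|k ih]; first by rewrite addr0.
rewrite iterS -ih; have [_ e1] := hr (n + k%:Z).
have [|_ ->] := tau_digit e1; first by have [] := hr (n + k%:Z + 1).
congr r; lia.
Qed.

End Admissible.

(** * Fibres of torus endomorphisms and porous sets *)

Section FiberCount.
Variables (R : realType) (m : nat).
Local Notation pi := (@torus_pi R m).
Local Notation T := (torus R m).

Lemma card_finType (F : finType) : ([set: F] #= `I_#|F|)%card.
Proof.
have -> : `I_#|F| = (fun x : F => enum_rank x : nat) @` [set: F].
  apply/seteqP; split => [k /= kF|_ [x _ <-]] /=; last exact: ltn_ord.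
  by exists (enum_val (Ordinal kF)) => //; rewrite enum_valK.
by rewrite card_eq_sym; apply: inj_card_eq => x y _ _ /val_inj /enum_rank_inj.
Qed.

Lemma torus_mul_diag_fiber (d : 'I_m -> int) (x : T) : (forall i, d i != 0) ->
  ([set y : T | torus_mul (\matrix_(i, j) (d i *+ (i == j :> nat))) y = x]
    #= `I_(\prod_i `|d i|)%N)%card.
Proof.
move=> d0; set D := \matrix_(i, j) _.
have DE (z : 'rV[R]_m) i : (z *m map_mx intr D) ord0 i = z ord0 i * (d i)%:~R.
  rewrite mxE (bigD1 i) //= big1 ?addr0; first by rewrite !mxE eqxx mulr1n.
  by move=> j ji; rewrite !mxE val_eqE (negPf ji) mulr0n mulr0.
have dR i : (d i)%:~R != 0 :> R by rewrite intr_eq0.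
have [a ->] := torus_piP x.
pose F := {dffun forall i : 'I_m, 'I_`|d i|%N}.
pose g (c : F) : T := pi (\row_i ((a ord0 i + (c i : nat)%:R) / (d i)%:~R)).
have -> : (\prod_i `|d i|)%N = #|F|.
  rewrite card_dep_ffun foldrE big_map big_enum /=.
  by apply: eq_bigr => i _; rewrite card_ord.
have -> : [set y : T | torus_mul D y = pi a] = g @` [set: F].
  apply/seteqP; split => [y /=|_ [c _ <-] /=]; last first.
    rewrite torus_mul_pi; apply/torus_pi_eq/int_rVP => i.
    by rewrite mxE DE !mxE divfK // addrAC subrr add0r natr_int.
  have [z ->] := torus_piP y; rewrite torus_mul_pi => /torus_pi_eq /int_rVP zi.
  have {}zi i : exists k : int, z ord0 i * (d i)%:~R = a ord0 i + k%:~R.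
    have /intrP[k] := zi i; rewrite !mxE => e; exists k; rewrite -e.
    by rewrite -DE [LHS]mxE [RHS]addrC subrK.
  pose k i := projT1 (cid (zi i)).
  have kP i : z ord0 i * (d i)%:~R = a ord0 i + (k i)%:~R by rewrite /k; case: cid.
  have lt i : (`|(k i %% d i)%Z| < `|d i|)%N.
    by have := ltz_mod (k i) (d0 i); have := modz_ge0 (k i) (d0 i); lia.
  exists [ffun i => Ordinal (lt i)] => //; apply/torus_pi_eq/int_rVP => i.
  rewrite !mxE ffunE /=.
  have -> : (`|(k i %% d i)%Z|%N)%:R = (k i - (k i %/ d i)%Z * d i)%:~R :> R.
    rewrite pmulrn; apply: congr1.
    by have := divz_eq (k i) (d i); have := modz_ge0 (k i) (d0 i); lia.
  rewrite intrB intrM.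
  have -> : z ord0 i = (a ord0 i + (k i)%:~R) / (d i)%:~R by rewrite -kP mulfK.
  rewrite (_ : _ - _ = - (k i %/ d i)%Z%:~R); first by rewrite rpredN intr_int.
  by field.
rewrite (card_eq_trans _ (card_finType F)) //.
apply: inj_card_eq => c c' _ _ /torus_pi_eq /int_rVP h.
apply/ffunP => i; apply/val_inj => /=.
have /intrP[k] := h i; rewrite !mxE => e.
have {}e : (c i : nat)%:Z - (c' i : nat)%:Z = k * d i.
  apply: (@intr_inj R); rewrite intrB intrM -e -!pmulrn; field; exact: dR.
have k0 : k = 0 by have := ltn_ord (c i); have := ltn_ord (c' i); move: e; nia.
by move: e; rewrite k0 mul0r => /eqP; rewrite subr_eq0 => /eqP[].
Qed.

(** The Smith normal form reduces to a diagonal matrix, where the equation splits into coordinates;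
    the unimodular factors are bijections of the torus. *)
Lemma torus_fiber_card (B : 'M[int]_m) (x : T) : \det B != 0 ->
  ([set y : T | torus_mul B y = x] #= `I_`|\det B|%N)%card.
Proof.
have [L Lu [K Ku [d _ ->]]] := int_Smith_normal_form B.
set D := \matrix_(i, j) _; rewrite !det_mulmx.
have detD : \det D = \prod_(i < m) d`_i.
  have -> : D = diag_mx (\row_i d`_i).
    by apply/matrixP => i j; rewrite !mxE val_eqE.
  by rewrite det_diag; apply: eq_bigr => i _; rewrite mxE.
have unit1 (A : 'M[int]_m) : A \in unitmx -> `|\det A|%N = 1%N.
  by rewrite unitmxE => u; case: (\det A) u => [[|[|k]]|[|k]].
move=> h.
have -> : `|(\det L * \det D * \det K)%R|%N = `|\det D|%N.
  by rewrite !abszM (unit1 L) // (unit1 K) // mul1n muln1.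
have d0 (i : 'I_m) : d`_i != 0.
  apply: contraNneq h => di; rewrite detD (bigD1 i) //= di mul0r mulr0.
  by rewrite mul0r.
rewrite detD (big_morph absz abszM (erefl _)).
have -> : [set y : T | torus_mul (L *m D *m K) y = x] =
    torus_mul (invmx L) @` [set y | torus_mul D y = torus_mul (invmx K) x].
  apply/seteqP; split => [y /= e|_ [y /= e <-]].
    exists (torus_mul L y); last by rewrite -torus_mulA mulmxV // torus_mul1.
    by rewrite -e -!torus_mulA mulmxK.
  by rewrite -torus_mulA !mulmxA mulVmx // mul1mx torus_mulA e -torus_mulA mulVmx // torus_mul1.
apply: (card_eq_trans _ (torus_mul_diag_fiber _ d0)).
apply: inj_card_eq => u v _ _ /(congr1 (torus_mul L)).
by rewrite -!torus_mulA mulVmx // !torus_mul1.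
Qed.

End FiberCount.

(** * Sets that are porous along an expanding line are null *)

Section Porosity.
Variables (R : realType) (m : nat) (beta : R).
Hypothesis beta_gt1 : 1 < beta.
Local Notation pi := (@torus_pi R m).
Local Notation T := (torus R m).
Local Notation TB := (torus_borel R m).
Variable mu : probability TB R.
Hypothesis tmu : translation_invariant mu.

(* Integrate the hypothesis over x. *)
Lemma sampling (E : set T) (s : nat -> T) (K q : nat) :
  (measurable : set (set TB)) E ->
  (forall x : T, (\sum_(i < K) ((x + s i)%R \in E) <= q)%N) ->
  (mu E * K%:R%:E <= q%:R%:E)%E.
Proof.
move=> mE h.
pose E' i : set T := [set - s i + x | x in E].
have mE' i : (measurable : set (set TB)) (E' i) by exact: torus_translate_measurable.
have muE i : mu (E' i) = mu E by exact: tmu.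
have -> : (mu E * K%:R%:E = \sum_(i < K) \int[mu]_x (\1_(E' i) x)%:E)%E.
  transitivity (\sum_(i < K) mu E)%E; last first.
    by apply: eq_bigr => i _; rewrite integral_indic // setIT; exact/esym/muE.
  have mufin : mu E \is a fin_num by exact: fin_num_measure.
  by rewrite -(fineK mufin) sumEFin sumr_const card_ord -EFinM mulr_natr.
rewrite -ge0_integral_sum //; last first.
  by move=> i; apply/measurable_EFinP; exact: measurable_indic.
rewrite (@le_trans _ _ (\int[mu]_x (cst q%:R%:E x))%E) //; last first.
  rewrite integral_cst // [X in (_ * X <= _)%E](probability_setT mu) mule1 //.
apply: ge0_le_integral => //.
- by move=> x _; apply: sume_ge0 => i _; rewrite lee_fin.
- apply: emeasurable_sum => i; apply/measurable_EFinP; exact: measurable_indic.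
- move=> x _; rewrite sumEFin lee_fin /cst; move: (h x); rewrite -(ler_nat R).
  apply: le_trans; rewrite natr_sum ler_sum // => i _.
  rewrite indicE /E' torus_translate_preimage opprK.
  by rewrite (_ : (x \in _) = (x + s i \in E)) //; apply/idP/idP; rewrite !inE /= addrC.
Qed.

Variables (F : R -> T) (S : T -> T).
Hypothesis FD : forall s t, F (s + t) = F s + F t.
Hypothesis SF : forall x s, S (x + F s) = S x + F (beta * s).
Variables (A : set T) (e : R).
Hypothesis e_gt0 : 0 < e.
Hypothesis dense : forall x, exists2 a : R, 0 <= a <= 2 - e &
  forall s, a <= s <= a + e -> A (x + F s).

Let E : set T := [set x | forall j, ~ A (iter j S x)].

Let iter_SF N x s : iter N S (x + F s) = iter N S x + F (beta ^+ N * s).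
Proof.
elim: N => [|N ih]; first by rewrite expr0 mul1r.
by rewrite !iterS ih SF exprS mulrA.
Qed.

Let E_iter N x : E x -> E (iter N S x).
Proof. by move=> Ex j; rewrite -iterD; exact: Ex. Qed.

Let size_flatten_le (I : eqType) (r : seq I) (f : I -> seq R) b :
  (forall i, size (f i) <= b)%N -> (size (flatten [seq f i | i <- r]) <= size r * b)%N.
Proof.
by move=> h; elim: r => //= i r ih; rewrite size_cat mulSn leq_add.
Qed.

(* Cutting [0, 2) into pieces of length 2 / beta^N <= e / 3, two of them lie in A;
   the map S^N expands each of the others to an interval of length 2, where the
   argument is repeated. *)
Lemma porous_cover : exists N p, [/\ (p%:R < beta ^+ N), 1 < beta ^+ N &
  forall k x, exists2 l : seq R, (size l <= p ^ k)%N &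
    forall s, 0 <= s < 2 -> E (x + F s) ->
      exists2 c, c \in l & c <= s < c + 2 / (beta ^+ N) ^+ k].
Proof.
(* With B > 6 / e three pieces of length 2 / B fit into the segment contained in A, so two
   consecutive pieces of the subdivision lie in it wherever it starts. The summand 1 ensures B >
   1. *)
have [N0 hN0] := expr_unbounded beta_gt1 (6 / e + 1).
set N := N0.+1; have bN : 6 / e + 1 < beta ^+ N.
  by rewrite (lt_trans hN0) // /N exprS ltr_pMl // exprn_gt0 // (lt_trans ltr01).
set B := beta ^+ N in bN *.
have e6 : 0 < 6 / e by rewrite divr_gt0.
have B1 : 1 < B by lra.
have B0 : 0 < B by lra.
pose eta := 2 / B; have eta0 : 0 < eta by rewrite divr_gt0.
have eta3 : 3 * eta <= e.
  rewrite /eta mulrA ler_pdivrMr // -ler_pdivrMl // mulrC; lra.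
pose t := Num.truncn B.
have /andP[t1 t2] : t%:R <= B < t.+1%:R by apply: truncn_itv; exact: ltW.
have t_gt0 : (0 < t)%N by rewrite truncn_gt0 ltW.
(* The interval [0, 2) takes t + 1 pieces. Discarding one would leave t, which equals B when B is an
   integer; discarding two leaves t - 1 < B. *)
exists N, t.-1; split => //.
  by rewrite (lt_le_trans _ t1) // ltr_nat prednK.
elim=> [|k ih] x.
  exists [:: 0] => // s s02 _; exists 0; first exact: mem_head.
  by rewrite expr0 divr1 add0r.
have [a /andP[a0 a2] ha] := dense x.
have [i0 i0a i0b] : exists2 i0 : nat, a < i0%:R * eta & i0%:R * eta <= a + eta.
  exists (Num.truncn (a / eta)).+1.
    by rewrite -ltr_pdivrMr // truncnS_gt // divr_ge0 // ltW.
  rewrite -natr1 mulrDl mul1r lerD2r -ler_pdivlMr // truncn_le.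
  by rewrite divr_ge0 // ltW.
have hole i s : i \in [:: i0; i0.+1] -> i%:R * eta <= s < i.+1%:R * eta -> A (x + F s).
  rewrite !inE => /orP[] /eqP -> /andP[s1 s2]; apply: ha; move: s1 s2;
    rewrite -!natr1 => s1 s2; apply/andP; split; lra.
have Beta : B * eta = 2 by rewrite /eta mulrCA divff ?gt_eqF // mulr1.
have i0t : (i0.+1 < t.+1)%N.
  rewrite -(ltr_nat R) (le_lt_trans _ t2) // -(ler_pM2r eta0).
  by rewrite Beta -natr1; lra.
pose y i := iter N S (x + F (i%:R * eta)).
pose good (i : nat) (l : seq R) := (size l <= t.-1 ^ k)%N /\
    forall s, 0 <= s < 2 -> E (y i + F s) -> exists2 c, c \in l & c <= s < c + 2 / B ^+ k.
have ex_good i : exists l, good i l by have [l l1 l2] := ih (y i); exists l.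
have [l hl] := boolp.choice ex_good.
pose I := rem i0.+1 (rem i0 (iota 0 t.+1)).
have uI : uniq (rem i0 (iota 0 t.+1)) by rewrite rem_uniq // iota_uniq.
have i0I : i0 \in iota 0 t.+1 by rewrite mem_iota /= add0n (ltn_trans _ i0t).
have i1I : i0.+1 \in rem i0 (iota 0 t.+1).
  by rewrite rem_filter ?iota_uniq // mem_filter mem_iota add0n i0t andbT /= eqn_leq ltnn.
have sI : size I = t.-1 by rewrite !size_rem // size_iota.
exists (flatten [seq [seq i%:R * eta + c / B | c <- l i] | i <- I]).
  rewrite expnS -{1}sI; apply: size_flatten_le => i; rewrite size_map.
  by have [] := hl i.
move=> s /andP[s0 s2] Es.
pose i := Num.truncn (s / eta).
have /andP[j1 j2] : i%:R <= s / eta < i.+1%:R by apply: truncn_itv; rewrite divr_ge0 // ltW.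
move: j1 j2; rewrite ler_pdivlMr // ltr_pdivrMr // => j1 j2.
have it : (i < t.+1)%N.
  rewrite -(ltr_nat R) (le_lt_trans _ t2) // -(ler_pM2r eta0).
  by rewrite Beta (le_trans j1) // ltW.
have iI : i \in I.
  have ni : i \notin [:: i0; i0.+1].
    by apply/negP => /hole h; apply: (Es 0%N); apply: h; rewrite j1.
  move: ni; rewrite !inE negb_or => /andP[n1 n2].
  rewrite /I rem_filter // mem_filter rem_filter ?iota_uniq // mem_filter.
  by rewrite mem_iota add0n it andbT /= n2 n1.
have Es' : E (y i + F (B * (s - i%:R * eta))).
  rewrite /y -iter_SF -addrA -FD (addrC (i%:R * eta)) subrK; exact: E_iter.
have [|c cl /andP[c1 c2]] := (hl i).2 _ _ Es'.
  rewrite mulr_ge0 ?subr_ge0 ?(ltW B0) //= mulrC -ltr_pdivlMr // -/eta.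
  by move: j2; rewrite -natr1; lra.
exists (i%:R * eta + c / B).
  by apply/flattenP; exists [seq i%:R * eta + c / B | c <- l i]; apply: map_f.
apply/andP; split.
  by rewrite -lerBrDl ler_pdivrMr // mulrC.
have -> : i%:R * eta + c / B + 2 / B ^+ k.+1 = i%:R * eta + (c + 2 / B ^+ k) / B.
  by rewrite exprS invfM; ring.
by rewrite -ltrBlDl ltr_pdivlMr // mulrC.
Qed.

(** Take K = floor(B^k) equally spaced points of [0, 2). Their spacing is at least 2 / B^k, so each
    covering interval contains at most one that lands in [E], and [sampling] gives K mu(E) <= p^k.
    Since 2 K >= B^k and p < B, a large k forces mu(E) = 0. *)
Lemma porous_null : (measurable : set (set TB)) E -> mu E = 0%E.
Proof.
move=> mE; have [N [p [pB B1 hp]]] := porous_cover.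
set B := beta ^+ N in pB B1 hp.
have B0 : 0 < B by rewrite (lt_trans ltr01).
have mufin : mu E \is a fin_num by exact: fin_num_measure.
have bound k : fine (mu E) * B ^+ k <= 2 * p%:R ^+ k.
  pose K := Num.truncn (B ^+ k).
  have Bk1 : 1 <= B ^+ k by rewrite exprn_ege1 // ltW.
  have Bk0 : 0 < B ^+ k by exact: lt_le_trans Bk1.
  have /andP[K1 K2] : K%:R <= B ^+ k < K.+1%:R by apply: truncn_itv; exact: ltW.
  have K0 : (0 < K)%N by rewrite truncn_gt0.
  have KR : 1 <= K%:R :> R by rewrite ler1n.
  have h : fine (mu E) * K%:R <= (p ^ k)%:R.
    rewrite -lee_fin EFinM fineK //.
    apply: (@sampling E (fun i => F (2 * i%:R / K%:R)) K (p ^ k) mE) => x; have [l ls hl] := hp k x.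
    pose sp (i : 'I_K) : R := 2 * i%:R / K%:R.
    have hc (i : 'I_K) : exists c, x + F (sp i) \in E -> c \in l /\ c <= sp i < c + 2 / B ^+ k.
      have [xE|] := boolP (x + F (sp i) \in E); last by exists 0.
      have [||c cl cs] := hl (sp i); last by exists c.
      - rewrite /sp divr_ge0 ?mulr_ge0 //= ltr_pdivrMr ?ltr_pM2l ?ltr_nat //.
        by rewrite ltr0n.
      - by move: xE; rewrite inE.
    pose c i := projT1 (cid (hc i)).
    have cP i : x + F (sp i) \in E -> c i \in l /\ c i <= sp i < c i + 2 / B ^+ k.
      by rewrite /c; case: cid.
    rewrite (leq_trans _ ls) //.
    pose D := [seq i <- enum 'I_K | x + F (sp i) \in E].
    have -> : (\sum_(i < K) ((x + F (2 * (i : nat)%:R / K%:R))%R \in E) = size D)%N.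
      rewrite /D size_filter -sum1_count [RHS]big_mkcond [RHS]big_enum /=.
      by apply: eq_bigr => i _; rewrite -/(sp i); case: (_ \in E).
    rewrite -(size_map c); apply: uniq_leq_size.
      rewrite map_inj_in_uniq; first exact/filter_uniq/enum_uniq.
      move=> i j.
      rewrite !mem_filter => /andP[/cP[_ /andP[i1 i2]] _] /andP[/cP[_ /andP[j1 j2]] _] cij.
      rewrite cij in i1 i2.
      have sep (u v : 'I_K) : c j <= sp u -> sp v < c j + 2 / B ^+ k -> (v <= u)%N.
        move=> h1 h2; rewrite leqNgt; apply/negP => uv.
        have : sp u + 2 / B ^+ k <= sp v.
          rewrite /sp; have : 2 / B ^+ k <= 2 / K%:R.
            by rewrite ler_pM2l // lef_pV2 ?posrE // ltr0n.
          move=> h3; apply: le_trans (lerD (lexx _) h3) _; rewrite -mulrDl.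
          rewrite ler_pM2r ?invr_gt0 ?ltr0n // -{2}(mulr1 2) -mulrDr ler_pM2l //.
          by rewrite natr1 ler_nat.
        lra.
      by apply/val_inj/eqP; rewrite eqn_leq (sep j i) // (sep i j).
    move=> z zD; have [j] := mapP zD.
    by rewrite mem_filter => /andP[/cP[cl _] _] ->.
  have mu0 : 0 <= fine (mu E) by rewrite fine_ge0.
  have : B ^+ k <= 2 * K%:R by move: K2; rewrite -natr1; lra.
  move=> /(ler_wpM2l mu0) h2; rewrite (le_trans h2) // mulrCA ler_pM2l //.
  by rewrite -natrX.
suff : fine (mu E) = 0 by move=> h; rewrite -(fineK mufin) h.
(* The value p = 0 is treated apart because the ratio B / p is used next. *)
case: p pB {hp} bound => [|p] pB bound.
  have := bound 1%N; rewrite !expr1 mulr0 pmulr_lle0 // => h.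
  by apply/eqP; rewrite eq_le h fine_ge0.
apply: (@expr_bounded_eq0 _ (B / p.+1%:R) _ _ 2) => [|k].
  by rewrite ltr_pdivlMr ?mul1r // ltr0n.
rewrite ger0_norm ?fine_ge0 // expr_div_n mulrA ler_pdivrMr ?exprn_gt0 ?ltr0n //.
Qed.

End Porosity.

(** * The coding of the torus by a homoclinic point *)

Lemma geometric_tail (R : realType) (a : nat -> R) (K rho : R) :
  0 < rho -> rho < 1 -> (forall n, `|a n| <= K * rho ^+ n) ->
  exists l, forall N, `|l - \sum_(n < N) a n| <= K / (1 - rho) * rho ^+ N.
Proof.
move=> r0 r1 ha; have r1' : 0 < 1 - rho by rewrite subr_gt0.
have K0 : 0 <= K by have := ha 0%N; rewrite expr0 mulr1; apply: le_trans.
pose g n := K * rho ^+ n.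
have cg : cvgn (series g) by apply: is_cvg_geometric_series; rewrite ger0_norm // ltW.
have cna : cvgn [normed series a].
  apply: series_le_cvg cg => [k|k|k] /=; [by []| |exact: ha].
  by rewrite /g mulr_ge0 // exprn_ge0 // ltW.
have ca := normed_cvg cna.
exists (limn (series a)) => N.
have h J : (N <= J)%N -> `|series a J - \sum_(n < N) a n| <= K / (1 - rho) * rho ^+ N.
  move=> NJ; have -> : \sum_(n < N) a n = series a N by rewrite /series /= big_mkord.
  have geo i : `|series a (N + i)%N - series a N| <= K / (1 - rho) * (rho ^+ N - rho ^+ (N + i)).
    elim: i => [|i ih]; first by rewrite addn0 !subrr normr0 mulr0.
    rewrite addnS {1}/series /= big_nat_recr //= -/(series a (N + i)) addrAC.
    rewrite (le_trans (ler_normD _ _)) // (le_trans (lerD ih (ha _))) //.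
    rewrite -subr_ge0 (_ : _ - _ = 0) // exprS; field; by rewrite gt_eqF.
  rewrite -(subnKC NJ) (le_trans (geo _)) // ler_wpM2l ?divr_ge0 ?(ltW r1') //.
  by rewrite gerBl exprn_ge0 // ltW.
have cd : (`|series a J - \sum_(n < N) a n|) @[J --> \oo] --> `|limn (series a) - \sum_(n < N) a n|.
  by apply: cvg_norm; apply: cvgB; [exact: ca | exact: cvg_cst].
rewrite -(cvg_lim (@Rhausdorff R) cd); apply: limr_le.
  by apply/cvg_ex; eexists; exact: cd.
by exists N => // J /= NJ; exact: h.
Qed.

Lemma int_shift (k : int) (B : nat) : `|k| <= B%:Z ->
  (`|(k + B%:Z)%R|%N < (2 * B).+1)%N /\ (`|(k + B%:Z)%R|%N)%:Z = k + B%:Z.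
Proof. by move=> kB; split; lia. Qed.

Lemma intS_shift (k : int) (j : nat) : k + j.+1%:Z = k + j%:Z + 1.
Proof. by rewrite intS; ring. Qed.
Lemma intS_shiftl (k : int) (j : nat) : k + 1 + j%:Z = k + j.+1%:Z.
Proof. by rewrite intS; ring. Qed.
Lemma intS_unshift (k : int) (j : nat) : k - 1 - j%:Z = k - j.+1%:Z.
Proof. by rewrite intS; ring. Qed.
Lemma oppzS1 (k : nat) : - k.+1%:Z + 1 = - k%:Z.
Proof. by rewrite intS; ring. Qed.
Lemma Posz_add1 (k : nat) : Posz k + 1 = Posz k.+1.
Proof. by rewrite intS addrC. Qed.
Lemma Negz0_add1 : Negz 0 + 1 = 0.
Proof. by []. Qed.
Lemma NegzS_add1 (k : nat) : Negz k.+1 + 1 = Negz k.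
Proof. by rewrite !NegzE intS; ring. Qed.

Section Coding.
Variables (R : realType) (beta : R) (n : nat).
Hypothesis beta_gt1 : 1 < beta.
Variable M : 'M[int]_n.+1.
Hypothesis Munit : M \in unitmx.
Variable lin : 'rV[R]_n.+1 -> R.
Hypothesis linD : forall y z, lin (y + z) = lin y + lin z.
Hypothesis linZ : forall a y, lin (a *: y) = a * lin y.
Local Notation MR := (map_mx intr M : 'M[R]_n.+1).
Hypothesis lin_mulM : forall y, lin (y *m MR) = beta * lin y.
Variables (Cl : R).
Hypothesis lin_le : forall y, `|lin y| <= `|y| * Cl.
Variables (vv e0 : 'rV[R]_n.+1).
Hypothesis lin_vv : lin vv = 1.
Hypothesis vvM : vv *m MR = beta *: vv.
Hypothesis e0_int : e0 \in @int_rV R n.+1.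
Hypothesis lin_e0 : lin e0 = 1.
Variables (C rho : R).
Hypotheses (C0 : 0 <= C) (rho0 : 0 < rho) (rho1 : rho < 1).
(** The projection along [vv] onto the kernel of [lin], which is the contracted hyperplane. *)
Local Notation proj y := (y - lin y *: vv).
Hypothesis contr : forall y N, `|proj y *m MR ^+ N| <= C * rho ^+ N * `|y|.
Hypothesis lin_Zadj : forall z, z \in @int_rV R n.+1 -> Zadj beta (lin z).
Hypothesis wf : weakly_finitary beta.

Local Notation pi := (@torus_pi R n.+1).
Local Notation T := (torus R n.+1).
Local Notation tau := (tau beta).

Let beta0 : 0 < beta. Proof. exact: lt_trans ltr01 beta_gt1. Qed.
Let betaN0 : beta != 0. Proof. by rewrite gt_eqF. Qed.
Let lin0 : lin 0 = 0. Proof. by rewrite -(scale0r 0) linZ mul0r. Qed.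
Let linN y : lin (- y) = - lin y. Proof. by rewrite -scaleN1r linZ mulN1r. Qed.
Let linB y z : lin (y - z) = lin y - lin z. Proof. by rewrite linD linN. Qed.
Let lin_sum (I : finType) (F : I -> 'rV[R]_n.+1) : lin (\sum_i F i) = \sum_i lin (F i).
Proof. by elim/big_rec2: _ => [|i x y _ <-]; rewrite ?lin0 ?linD. Qed.
Let lin_mulMX y N : lin (y *m MR ^+ N) = beta ^+ N * lin y.
Proof.
elim: N => [|N ih]; first by rewrite !expr0 mulmx1 mul1r.
by rewrite [MR ^+ _]exprSr mulmxA lin_mulM ih exprS mulrA.
Qed.
Let vvMX N : vv *m MR ^+ N = beta ^+ N *: vv.
Proof.
elim: N => [|N ih]; first by rewrite !expr0 mulmx1 scale1r.
by rewrite [MR ^+ _]exprSr mulmxA ih -scalemxAl vvM scalerA exprSr.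
Qed.
Let int_mulMX z N : z \in @int_rV R n.+1 -> z *m MR ^+ N \in @int_rV R n.+1.
Proof.
move=> zi; elim: N => [|N ih]; first by rewrite expr0 mulmx1.
by rewrite exprSr mulmxA; exact: mulmx_int_rV.
Qed.

(* As vv - e0 is in the sum of the contracted eigenspaces, [stab N] represents
   beta^N vv modulo Z^m by a vector tending to 0. *)
Definition stab N : 'rV[R]_n.+1 := (vv - e0) *m MR ^+ N.

Let lin_stab N : lin (stab N) = 0.
Proof. by rewrite lin_mulMX linB lin_vv lin_e0 subrr mulr0. Qed.

Let stabS N : stab N *m MR = stab N.+1.
Proof. by rewrite /stab [MR ^+ N.+1]exprSr mulmxA. Qed.

Let Cs := C * `|e0|.
Let Cs0 : 0 <= Cs. Proof. by rewrite mulr_ge0. Qed.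

Let stab_le N : `|stab N| <= Cs * rho ^+ N.
Proof.
have := contr e0 N; rewrite lin_e0 scale1r /stab -(opprB e0 vv) mulNmx normrN.
by rewrite mulrAC.
Qed.

Let pi_vv N (a : nat) : pi ((a%:R * beta ^+ N) *: vv) = pi (a%:R *: stab N).
Proof.
apply/torus_pi_eq; rewrite -scalerA -vvMX -scalerBr -mulmxBl opprB addrC subrK.
rewrite scaler_nat rpredMn //; exact: int_mulMX.
Qed.

Let b := Num.truncn beta.

Definition Cy : R := b%:R * Cs / (1 - rho).

Let r1' : 0 < 1 - rho. Proof. by rewrite subr_gt0. Qed.
Let Cy0 : 0 <= Cy. Proof. by rewrite divr_ge0 ?mulr_ge0 // ltW. Qed.

(** Says that y is the sum of the series of the u_k [stab] k. The tail estimate stands for the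
    limit; its constant does not depend on u, which serves uniqueness and compactness. *)
Definition is_stable (u : nat -> nat) (y : 'rV[R]_n.+1) :=
  forall N, `|y - \sum_(k < N) (u k)%:R *: stab k| <= Cy * rho ^+ N.

Lemma is_stable_exists (u : nat -> nat) : (forall k, (u k <= b)%N) ->
  exists y, is_stable u y.
Proof.
move=> ub.
have h (i : 'I_n.+1) : exists l, forall N,
    `|l - \sum_(k < N) (u k)%:R * stab k ord0 i| <= Cy * rho ^+ N.
  apply: (@geometric_tail _ (fun k => (u k)%:R * stab k ord0 i) (b%:R * Cs)) => // k.
  rewrite normrM normr_nat -mulrA ler_pM // ?ler_nat //.
  by rewrite (le_trans (rV_coord_le _ _)) ?stab_le.
have [l hl] := boolp.choice h.
exists (\row_i l i) => N; apply: rV_norm_le.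
  by rewrite mulr_ge0 ?exprn_ge0 // ltW.
move=> i; rewrite !mxE summxE.
under eq_bigr => k _ do rewrite mxE.
exact: hl.
Qed.

Let geo_small (K e : R) : 0 < e -> exists N, K * rho ^+ N < e.
Proof.
move=> e0'; have [N hN] : exists N, `|K| / e < rho^-1 ^+ N.
  by apply: expr_unbounded; rewrite invf_gt1.
exists N; rewrite (le_lt_trans (ler_wpM2r _ (ler_norm K))) ?exprn_ge0 ?(ltW rho0) //.
by rewrite -ltr_pdivlMr ?exprn_gt0 // -exprVn mulrC -ltr_pdivrMr.
Qed.

Let geo_eq0 (y : 'rV[R]_n.+1) K : (forall N, `|y| <= K * rho ^+ N) -> y = 0.
Proof.
move=> h; apply/eqP; rewrite -normr_le0 leNgt; apply/negP => /(geo_small K)[N].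
by rewrite ltNge h.
Qed.

Lemma is_stable_unique u y y' : is_stable u y -> is_stable u y' -> y = y'.
Proof.
move=> h h'; apply/eqP; rewrite -subr_eq0; apply/eqP/(@geo_eq0 _ (Cy + Cy)) => N.
rewrite -(subrKA (\sum_(k < N) (u k)%:R *: stab k)) (le_trans (ler_normD _ _)) //.
by rewrite mulrDl lerD // distrC.
Qed.

Lemma is_stable_norm u y : is_stable u y -> `|y| <= Cy.
Proof. by move=> /(_ 0%N); rewrite big_ord0 subr0 expr0 mulr1. Qed.

Lemma is_stable_lin u y : is_stable u y -> lin y = 0.
Proof.
move=> h; apply/eqP; rewrite -normr_le0 leNgt; apply/negP => ly.
have [N] := geo_small (Cy * `|Cl|) ly; apply/negP; rewrite -leNgt.
have -> : lin y = lin (y - \sum_(k < N) (u k)%:R *: stab k).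
  rewrite linB lin_sum big1 ?subr0 // => k _; by rewrite linZ lin_stab mulr0.
rewrite (le_trans (lin_le _)) // mulrAC.
rewrite (le_trans (ler_wpM2l (normr_ge0 _) (ler_norm Cl))) // ler_wpM2r //; exact: h.
Qed.

(** Admissibility of the past u followed by zeros: the remainders are these sums divided by beta^N
    and have to be less than 1. *)
Definition left_adm (u : nat -> nat) :=
  forall N, \sum_(k < N) (u k)%:R * beta ^+ k < beta ^+ N.

Lemma left_adm_digit u k : left_adm u -> (u k <= b)%N.
Proof.
move=> /(_ k.+1); rewrite big_ord_recr /= => h.
have s0 : 0 <= \sum_(i < k) (u i)%:R * beta ^+ i.
  by apply: sumr_ge0 => i _; rewrite mulr_ge0 // exprn_ge0 // ltW.
have : (u k)%:R * beta ^+ k < beta * beta ^+ k by rewrite -exprS; lra.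
rewrite ltr_pM2r ?exprn_gt0 // => /ltW; by rewrite -truncn_ge_nat // ltW.
Qed.

Definition stable_set : set 'rV[R]_n.+1 :=
  [set y | exists2 u, left_adm u & is_stable u y].

Lemma ultra_finite (I : Type) (G : set_system I) (f : I -> nat) (c : nat) :
  UltraFilter G -> G [set x | (f x <= c)%N] -> exists a, G [set x | f x = a].
Proof.
move=> UG; elim: c => [|c ih] hG.
  by exists 0%N; apply: filterS hG => x /=; rewrite leqn0 => /eqP.
have [h|h] := in_ultra_setVsetC [set x | f x = c.+1] UG; first by exists c.+1.
apply: ih; near=> x.
have : (f x <= c.+1)%N by near: x.
have : f x <> c.+1 by near: x; exact: h.
by move=> /eqP neq; rewrite leq_eqVlt (negPf neq).
Unshelve. all: by end_near. Qed.

(** Along an ultrafilter each digit settles, having finitely many values. Each inequality of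
    [left_adm] involves finitely many digits, so it passes to the limit, and the uniform tail
    estimate turns agreement of N digits into closeness of order rho^N. *)
Lemma stable_set_compact : compact stable_set.
Proof.
rewrite compact_ultra => G UG GY.
have PG : ProperFilter G by exact: ultra_proper.
have hU y : exists u, stable_set y -> left_adm u /\ is_stable u y.
  have [[u h1 h2]|ny] := pselect (stable_set y); first by exists u.
  by exists (fun=> 0%N).
have [U hUP] := boolp.choice hU.
have hu k : exists a, G [set y | U y k = a].
  apply: (@ultra_finite _ _ (fun y => U y k) b UG).
  by apply: filterS GY => y /hUP[h _] /=; exact: left_adm_digit.
have [u huP] := boolp.choice hu.
have agree N : G [set y | stable_set y /\ forall k, (k < N)%N -> U y k = u k].
  elim: N => [|N ih]; first by apply: filterS GY.
  apply: filterS2 ih (huP N) => y [Yy h] e; split=> // k.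
  by rewrite ltnS leq_eqVlt => /predU1P[->//|]; exact: h.
have sum_eq N y (V : zmodType) (f : nat -> nat -> V) : (forall k, (k < N)%N -> U y k = u k) ->
   \sum_(k < N) f (U y k) k = \sum_(k < N) f (u k) k.
  by move=> h; apply: eq_bigr => k _; rewrite h.
have uadm : left_adm u.
  move=> N; have [y [Yy h]] := filter_ex (agree N).
  by rewrite -(sum_eq N y _ (fun a k => a%:R * beta ^+ k) h); have [+ _] := hUP y Yy; exact.
have [y0 hy0] := is_stable_exists (fun k => left_adm_digit k uadm).
exists y0; split; first by exists u.
apply/cvgrPdist_lt => e e0'; have [N hN] := geo_small (Cy + Cy) e0'.
apply: filterS (agree N) => y [Yy h].
rewrite (le_lt_trans _ hN) // -(subrKA (\sum_(k < N) (u k)%:R *: stab k)).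
rewrite (le_trans (ler_normD _ _)) // mulrDl; apply: lerD; first exact: hy0.
rewrite distrC -(sum_eq N y _ (fun a k => a%:R *: stab k) h).
by have [_] := hUP y Yy; exact.
Qed.

(* The points of the torus whose code has its remainder in I, except that the
   two halves of the code need not match. *)
Definition coded (I : set R) : set T :=
  [set x | exists y s, [/\ stable_set y, I s & x = pi (y + s *: vv)]].

Lemma coded_closed a c : closed (coded `[a, c]%classic).
Proof.
have -> : coded `[a, c]%classic =
    pi @` ((fun p : 'rV[R]_n.+1 * R => p.1 + p.2 *: vv) @` (stable_set `*` `[a, c]%classic)).
  apply/seteqP; split => [x [y [s [Yy Is ->]]]|_ [_ [[y s] [/= Yy Is] <-] <-]].
    by exists (y + s *: vv) => //; exists (y, s).
  by exists y, s.
apply: torus_compact_closed; apply: continuous_compact.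
  apply: continuous_subspaceT => p; apply: cvgD; first exact: cvg_fst.
  by apply: cvgZr_tmp; exact: cvg_snd.
by apply: compact_setX; [exact: stable_set_compact | exact: segment_compact].
Qed.

Lemma int_box (B : R) : exists s : seq 'rV[R]_n.+1,
  forall z, z \in @int_rV R n.+1 -> `|z| <= B -> z \in s.
Proof.
pose B' := (Num.truncn `|B|).+1.
exists [seq \row_i ((f i : nat)%:R - B'%:R) | f : {ffun 'I_n.+1 -> 'I_(2 * B').+1}].
move=> z /int_rVP zi zB.
have h i : exists f : 'I_(2 * B').+1, z ord0 i = (f : nat)%:R - B'%:R.
  have /intrP[k zk] := zi i.
  have kB : `|k%:~R| <= B'%:R :> R.
    rewrite -zk (le_trans (rV_coord_le _ _)) // (le_trans zB) // (le_trans (ler_norm _)) //.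
    by rewrite ltW // truncnS_gt.
  have kb : `|k| <= B'%:Z.
    by rewrite -(ler_int R) intr_norm.
  have [lt e] := int_shift kb; exists (Ordinal lt); rewrite /= zk.
  have -> : (`|(k + B'%:Z)%R|%N)%:R = (k + B'%:Z)%:~R :> R by rewrite pmulrn e.
  by rewrite intrD addrK.
have [f hf] := boolp.choice h.
apply/fintype.imageP; exists (finfun f) => //.
by apply/rowP => i; rewrite !mxE ffunE hf.
Qed.

(* Only finitely many integer vectors have both their stable part and [lin]
   bounded. *)
Lemma gap : exists c : R, [/\ 0 < c, c <= 1 &
  forall z, z \in @int_rV R n.+1 -> `|proj z| <= Cy + Cy + Cs -> 0 < lin z -> c <= lin z].
Proof.
have [s hs] := int_box (Cy + Cy + Cs + `|vv|).
exists (\big[Num.min/1]_(z <- s | 0 < lin z) lin z); split.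
- by elim/big_ind: _ => // x y x0 y0; rewrite lt_min x0.
- exact: bigmin_le_id.
move=> z zi zp lz; have [l1|l1] := leP 1 (lin z).
  by apply: le_trans l1; exact: bigmin_le_id.
apply: ge_bigmin_seq => //; apply: hs => //.
rewrite -[z](subrK (lin z *: vv)) (le_trans (ler_normD _ _)) // lerD //.
by rewrite normrZ gtr0_norm // ler_piMl // ltW.
Qed.

Definition rem_of (e : int -> nat) (r : int -> R) :=
  forall k, 0 <= r k < 1 /\ beta * r k = (e k)%:R + r (k + 1).

Definition past (e : int -> nat) : nat -> nat := fun k => e (- k%:Z).

(* x is the value at e of the coding map attached to the homoclinic point pi vv:
   the part of e of index >= 1 has sum r 1, and the terms of index <= 0, whose sum
   diverges in R^m, are replaced by the [stab k]. *)
Definition codes (e : int -> nat) (x : T) :=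
  exists r y, [/\ rem_of e r, is_stable (past e) y & x = pi (y + r 1 *: vv)].

Let pi_tail e r N : rem_of e r ->
  pi ((beta ^+ N.+1 * r (- N%:Z)) *: vv) =
  pi (\sum_(k < N.+1) (past e k)%:R *: stab k + r 1 *: vv).
Proof.
move=> hr; elim: N => [|N ih].
  have [_] := hr 0; rewrite oppr0 expr1 => ->.
  rewrite big_ord1 scalerDl !torus_piD /past oppr0 add0r; congr (_ + _).
  by have := pi_vv 0 (e 0); rewrite expr0 mulr1.
have [_ e1] := hr (- N.+1%:Z).
rewrite exprSr -mulrA e1 oppzS1 mulrDr scalerDl torus_piD ih.
rewrite mulrC pi_vv [in RHS]big_ord_recr /= -torus_piD; congr pi.
by rewrite addrCA addrA.
Qed.

Lemma codes_tail_cvg e x : codes e x ->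
  pi (tail_sum beta e N *: vv) @[N --> \oo] --> x.
Proof.
move=> [r [y [hr hy ->]]].
have -> : (fun N => pi (tail_sum beta e N *: vv)) =
    (fun N => pi (\sum_(k < N.+1) (past e k)%:R *: stab k + r 1 *: vv)).
  by apply/funext => N; rewrite (tail_sumE beta_gt1 _ hr) (pi_tail _ hr).
apply: continuous_cvg; first exact: torus_pi_continuous.
apply: cvgD; last exact: cvg_cst.
apply/cvgrPdist_lt => e' e'0; have [N hN] := geo_small Cy e'0.
exists N => // k /= Nk; apply: le_lt_trans (hy k.+1) (le_lt_trans _ hN).
rewrite ler_wpM2l // ler_wiXn2l ?ltW //; exact: leqW.
Qed.

Lemma rem_of_unique e r r' : rem_of e r -> rem_of e r' -> r = r'.
Proof.
move=> h h'; apply/funext => k; apply/eqP; rewrite -subr_eq0; apply/eqP.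
apply: (@expr_bounded_eq0 _ beta beta_gt1 _ 1) => j.
have -> : `|r k - r' k| * beta ^+ j = `|r (k + j%:Z) - r' (k + j%:Z)|.
  elim: j => [|j ih]; first by rewrite expr0 mulr1 addr0.
  rewrite exprSr mulrA ih -[X in _ * X](gtr0_norm beta0) -normrM mulrC mulrBr.
  have [_ ->] := h (k + j%:Z); have [_ ->] := h' (k + j%:Z).
  rewrite intS_shift.
  by congr `|_|; ring.
have [/andP[h1 h2] _] := h (k + j%:Z); have [/andP[h3 h4] _] := h' (k + j%:Z).
by rewrite ler_norml; apply/andP; split; lra.
Qed.

Lemma codes_X e x : codes e x -> X_ beta e.
Proof. by move=> [r [y [hr _ _]]]; apply/(X_P beta_gt1); exists r. Qed.

Lemma codes_exists e : X_ beta e -> exists x, codes e x.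
Proof.
move=> Xe; have [r hr] := (X_P beta_gt1 e).1 Xe.
have [y hy] := @is_stable_exists (past e) (fun k => (Xe (- k%:Z)).1).
by exists (pi (y + r 1 *: vv)), r, y.
Qed.

Lemma codes_unique e x x' : codes e x -> codes e x' -> x = x'.
Proof.
move=> [r [y [hr hy ->]]] [r' [y' [hr' hy' ->]]].
by rewrite (rem_of_unique hr hr') (is_stable_unique hy hy').
Qed.

(** The shift moves the digit of index 1 from the future to the past, where e(1) [vv] is replaced by
    e(1) [stab 0], equal to it modulo Z^m. *)
Lemma codes_shift e x : codes e x -> codes (fun k => e (k + 1)) (torus_mul M x).
Proof.
move=> [r [y [hr hy ->]]].
have hr' : rem_of (fun k => e (k + 1)) (fun k => r (k + 1)) by move=> k; exact: hr.
have X' : X_ beta (fun k => e (k + 1)) by apply/(X_P beta_gt1); exists (fun k => r (k + 1)).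
have [y' hy'] := @is_stable_exists (past (fun k => e (k + 1))) (fun k => (X' (- k%:Z)).1).
have yy : y' = y *m MR + (e 1)%:R *: stab 0.
  pose S := \sum_i \sum_j `|MR i j|.
  apply/eqP; rewrite -subr_eq0; apply/eqP/(@geo_eq0 _ (Cy + Cy * S)) => N.
  have e1 : \sum_(k < N.+1) (past (fun k => e (k + 1)) k)%:R *: stab k =
     (e 1)%:R *: stab 0 + (\sum_(k < N) (past e k)%:R *: stab k) *m MR.
    rewrite big_ord_recl /= /past oppr0 add0r; congr (_ + _).
    rewrite mulmx_suml; apply: eq_bigr => k _; rewrite -scalemxAl stabS /bump /= add1n.
    by rewrite oppzS1.
  rewrite -(subrKA (\sum_(k < N.+1) (past (fun k => e (k + 1)) k)%:R *: stab k)).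
  rewrite (le_trans (ler_normD _ _)) // mulrDl; apply: lerD.
    apply: le_trans (hy' N.+1) _; rewrite ler_wpM2l // exprS ler_piMl ?exprn_ge0 ?ltW //.
  rewrite e1 opprD [X in `|X|](_ : _ = - ((y - \sum_(k < N) (past e k)%:R *: stab k) *m MR)).
    rewrite normrN (le_trans (mulmx_norm_le _ _)) // mulrAC ler_wpM2r ?hy //.
    by rewrite sumr_ge0 // => i _; rewrite sumr_ge0.
  rewrite mulmxBl; move: (_ *m MR) (_ *m MR) (_ *: _) => a1 a2 a3.
  by apply/rowP => i; rewrite !mxE; ring.
exists (fun k => r (k + 1)), y'; split => //.
have [_ e1] := hr 1.
rewrite torus_mul_pi mulmxDl -scalemxAl vvM scalerA mulrC e1 scalerDl yy.
rewrite !torus_piD -!addrA; congr (_ + (_ + _)).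
by have := pi_vv 0 (e 1); rewrite expr0 mulr1.
Qed.

Lemma codes_unshift e x : codes e x -> codes (fun k => e (k - 1)) (torus_mul (invmx M) x).
Proof.
move=> cx; have [r [y [hr hy _]]] := cx.
have hr' : rem_of (fun k => e (k - 1)) (fun k => r (k - 1)).
  by move=> k; have [h1 h2] := hr (k - 1); rewrite h2; split => //; rewrite addrAC.
have [|x' cx'] := @codes_exists (fun k => e (k - 1)).
  by apply/(X_P beta_gt1); exists (fun k => r (k - 1)).
have := codes_shift cx'; rewrite (_ : (fun k => _) = e); last first.
  by apply/funext => k; rewrite addrK.
by move=> /(codes_unique cx) ->; rewrite -torus_mulA mulmxV // torus_mul1.
Qed.

Lemma codes_shift_iter j e x : codes e x ->
  codes (fun k => e (k + j%:Z)) (iter j (torus_mul M) x).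
Proof.
elim: j e => [|j ih] e cx.
  by rewrite (_ : (fun k => _) = e) //; apply/funext => k; rewrite addr0.
rewrite iterS; have := codes_shift (ih _ cx).
rewrite (_ : (fun k => _) = (fun k => e (k + j.+1%:Z))) //.
by apply/funext => k; rewrite intS_shiftl.
Qed.

Lemma codes_unshift_iter j e x : codes e x ->
  codes (fun k => e (k - j%:Z)) (iter j (torus_mul (invmx M)) x).
Proof.
elim: j e => [|j ih] e cx.
  by rewrite (_ : (fun k => _) = e) //; apply/funext => k; rewrite subr0.
rewrite iterS; have := codes_unshift (ih _ cx).
rewrite (_ : (fun k => _) = (fun k => e (k - j.+1%:Z))) //.
by apply/funext => k; rewrite intS_unshift.
Qed.

(** The difference is [lin] of an integer vector whose projection to the kernel of [lin] is bounded
    independently of u and N, so [gap] bounds it from below. *)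
Let adm_sum_gap : exists c : R, [/\ 0 < c, c <= 1 & forall u, left_adm u ->
  forall N, c <= beta ^+ N - \sum_(k < N) (u k)%:R * beta ^+ k].
Proof.
have [c [c0 c1 hc]] := gap; exists c; split => // u uadm N.
pose z : 'rV[R]_n.+1 := e0 *m MR ^+ N - \sum_(k < N) (u k)%:R *: (e0 *m MR ^+ k).
have lz : lin z = beta ^+ N - \sum_(k < N) (u k)%:R * beta ^+ k.
  rewrite /z linB lin_mulMX lin_e0 mulr1 lin_sum; congr (_ - _).
  by apply: eq_bigr => k _; rewrite linZ lin_mulMX lin_e0 mulr1.
rewrite -lz; apply: hc.
- rewrite rpredB ?int_mulMX // rpred_sum // => k _; rewrite scaler_nat rpredMn //.
  exact: int_mulMX.
- have e0E k : e0 *m MR ^+ k = beta ^+ k *: vv - stab k.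
    by rewrite /stab mulmxBl vvMX opprB addrC subrK.
  have [y hy] := is_stable_exists (fun k => left_adm_digit k uadm).
  have sN : `|\sum_(k < N) (u k)%:R *: stab k| <= Cy + Cy.
    rewrite -[X in `|X|](subKr y) (le_trans (ler_normB _ _)) // lerD ?(is_stable_norm hy) //.
    by rewrite (le_trans (hy N)) // ler_piMr // exprn_ile1 // ltW.
  rewrite lz (_ : _ - _ = \sum_(k < N) (u k)%:R *: stab k - stab N).
    rewrite (le_trans (ler_normB _ _)) // lerD // (le_trans (stab_le _)) //.
    by rewrite ler_piMr // exprn_ile1 // ltW.
  rewrite /z e0E scalerBl scaler_suml.
  rewrite (eq_bigr (fun k : 'I_N => ((u k)%:R * beta ^+ k) *: vv - (u k)%:R *: stab k)).
    rewrite sumrB; move: (\sum_k _) (\sum_k _) => a1 a2.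
    by apply/rowP => i; rewrite !mxE; ring.
  by move=> k _; rewrite e0E scalerBr scalerA.
by rewrite lz subr_gt0.
Qed.

(** Adding a remainder smaller than the gap keeps all remainders of nonpositive index below 1. *)
Lemma glue : exists c : R, [/\ 0 < c, c <= 1 & forall u s, left_adm u -> 0 <= s < c ->
  exists e r, [/\ rem_of e r, past e = u & r 1 = s]].
Proof.
have [c [c0 c1 hc]] := adm_sum_gap; exists c; split => // u s uadm /andP[s0 sc].
have s01 : 0 <= s < 1 by rewrite s0 (lt_le_trans sc).
pose g N : R := (\sum_(k < N.+1) (u k)%:R * beta ^+ k + s) / beta ^+ N.+1.
have g01 N : 0 <= g N < 1.
  rewrite /g ltr_pdivrMr ?exprn_gt0 // mul1r divr_ge0 ?exprn_ge0 ?(ltW beta0) //=.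
    by have := hc u uadm N.+1; lra.
  rewrite addr_ge0 // sumr_ge0 // => k _; rewrite mulr_ge0 // exprn_ge0 // ltW //.
(* The future consists of the greedy digits of s; [Negz p] is the index -(p + 1). *)
pose e (k : int) : nat := match k with
  | Posz 0 => u 0%N | Posz p.+1 => digit beta s p | Negz p => u p.+1 end.
pose r (k : int) : R := match k with
  | Posz 0 => g 0%N | Posz p.+1 => iter p tau s | Negz p => g p.+1 end.
exists e, r; split.
- move=> [[|p]|[|p]].
  + split; first exact: g01.
    rewrite /= /g big_ord1 !expr1 expr0 mulr1; field; exact: betaN0.
  + rewrite Posz_add1.
    by split; [exact: iter_tau_itv | exact: tau_rec].
  + rewrite Negz0_add1.
    split; first exact: g01.
    rewrite /= /g !big_ord_recr big_ord0 /= !exprS expr0; field; exact: betaN0.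
  + rewrite NegzS_add1.
    split; first exact: g01.
    rewrite /= /g [in LHS]big_ord_recr /= (exprS _ p.+2); field.
    by rewrite betaN0 expf_neq0.
- by apply/funext => k; rewrite /past; case: k => [|k] //=; rewrite -NegzE.
- by [].
Qed.

(* Two codes of one point differ by an integer vector from a finite box, and
   [synchronization] applies to the finitely many values of [lin] on it. *)
Lemma sync_set : exists y0 eps L, [/\ 0 <= y0, 0 < eps, y0 + eps <= 1,
  forall x, coded `[y0, y0 + eps]%classic x -> exists e, codes e x &
  forall x e e', coded `[y0, y0 + eps]%classic x -> codes e x -> codes e' x ->
   forall k : nat, e (1 + (L + k)%N%:Z) = e' (1 + (L + k)%N%:Z)].
Proof.
have [c [c0 c1 hglue]] := glue.
(* Each of the two stable parts has norm at most [Cy], and each of the two multiples of [vv] has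
   norm at most that of [vv]. *)
have [box hbox] := int_box (Cy + Cy + (1 + 1) * `|vv|).
pose F := [seq lin z | z <- box & z \in @int_rV R n.+1].
have FZ w : w \in F -> Zadj beta w.
  by move=> /mapP[z]; rewrite mem_filter => /andP[zi _] ->; exact: lin_Zadj.
have [y0 [eps [L [y00 eps0 yc hsync]]]] := synchronization beta_gt1 wf c0 c1 FZ.
exists y0, eps, L.
have coded_glue x : coded `[y0, y0 + eps]%classic x -> exists e r y,
    [/\ rem_of e r, is_stable (past e) y, x = pi (y + r 1 *: vv) & y0 <= r 1 <= y0 + eps].
  move=> [y [s [[u uadm hy]]]]; rewrite /= in_itv /= => /andP[s1 s2] ->.
  have [|e [r [hr pe r1]]] := hglue u s uadm.
    by rewrite (le_trans y00 s1) (le_lt_trans s2 yc).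
  by exists e, r, y; rewrite pe r1 s1 s2.
split => //; first by rewrite (le_trans (ltW yc)).
  by move=> x /coded_glue[e [r [y [h1 h2 h3 _]]]]; exists e, r, y.
(* The given codes may have remainders outside the interval, so both are compared with a glued code
   whose remainder lies in it. *)
suff main x : coded `[y0, y0 + eps]%classic x -> exists e, forall e', codes e' x ->
    forall k : nat, e (1 + (L + k)%N%:Z) = e' (1 + (L + k)%N%:Z).
  move=> x e e' /main[f hf] ce ce' k; by rewrite -(hf e) // (hf e').
move=> /coded_glue[e [r [y [hr hy -> r01]]]]; exists e => e' [r' [y' [hr' hy' xx]]] k.
have d1 : e (1 + (L + k)%N%:Z) = digit beta (r 1) (L + k).
  by have [] := X_digit beta_gt1 hr 1 (L + k).
have d2 : e' (1 + (L + k)%N%:Z) = digit beta (r' 1) (L + k).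
  by have [] := X_digit beta_gt1 hr' 1 (L + k).
rewrite d1 d2 /digit addnC !iterD; congr (Num.truncn (_ * iter _ _ _)).
pose z := (y' + r' 1 *: vv) - (y + r 1 *: vv).
have zi : z \in @int_rV R n.+1 by apply/torus_pi_eq.
have lz : lin z = r' 1 - r 1.
  by rewrite /z linB !linD !linZ !lin_vv (is_stable_lin hy) (is_stable_lin hy'); ring.
have nvv s : 0 <= s < 1 -> `|s *: vv| <= `|vv|.
  by move=> /andP[s0 s1]; rewrite normrZ ger0_norm // ler_piMl // ltW.
have zF : lin z \in F.
  apply: map_f; rewrite mem_filter zi /=; apply: hbox => //.
  rewrite /z opprD addrACA (le_trans (ler_normD _ _)) // lerD //.
    by rewrite (le_trans (ler_normB _ _)) // lerD // (is_stable_norm hy', is_stable_norm hy).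
  rewrite (le_trans (ler_normB _ _)) // mulrDl mul1r lerD // nvv //.
    by have [] := hr' 1.
  by have [] := hr 1.
have rz : r 1 + lin z = r' 1 by rewrite lz addrC subrK.
have := hsync (r 1) r01 (lin z) zF; rewrite rz => ->//.
by have [] := hr' 1.
Qed.

Lemma torus_rep : exists B : R, forall x : T, exists a,
  [/\ x = pi a, `|a| <= B & 0 <= lin a < 1].
Proof.
exists (1 + (Cl + 1) * `|e0|) => x; have [a ->] := torus_piP x.
pose a1 : 'rV[R]_n.+1 := \row_i (a ord0 i - (Num.floor (a ord0 i))%:~R).
have na1 : `|a1| <= 1.
  apply: rV_norm_le => // i; rewrite mxE; have /andP[f1 f2] := floor_itv (a ord0 i).
  by rewrite intrD in f2; rewrite ger0_norm; lra.
pose f := Num.floor (lin a1); have /andP[f1 f2] := floor_itv (lin a1).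
rewrite intrD in f2.
exists (a1 - f%:~R *: e0); split.
- apply/torus_pi_eq; rewrite opprB addrCA; apply: rpredD.
    by rewrite scaler_int rpredMz.
  by apply/int_rVP => i; rewrite !mxE subKr intr_int.
- rewrite (le_trans (ler_normB _ _)) // lerD // normrZ ler_wpM2r //.
  have l1 : `|lin a1| <= Cl.
    have := lin_le a1; have Cl0 : 0 <= Cl.
      by have := lin_le e0; rewrite lin_e0 normr1; have := normr_ge0 e0; nra.
    move=> h; rewrite (le_trans h) // ler_piMl //.
  by move: l1; rewrite !ler_norml -/f => /andP[l1 l2]; apply/andP; split; lra.
- rewrite linB linZ lin_e0 mulr1 -/f; apply/andP; split; lra.
Qed.

(** The coded points form a closed set, so approximation suffices. Write x as the class of a' M^N
    with a' bounded and lin(a') in [0, 1): the contracted part of a' contributes little, and the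
    rest, beta^N lin(a') [vv], is coded by N digits of lin(a') used as past. *)
Lemma coded_surj x : coded `[0, 1]%classic x.
Proof.
apply: contrapT => nx; have [B hB] := torus_rep.
have B0 : 0 <= B by have [a [_ h _]] := hB 0; apply: le_trans h.
have [a xa] := torus_piP x.
have oc : open (pi @^-1` (~` coded `[0, 1]%classic)).
  have : continuous pi by exact: torus_pi_continuous.
  by move=> /continuousP; apply; apply: closed_openC; exact: coded_closed.
have : nbhs a (pi @^-1` (~` coded `[0, 1]%classic)).
  by apply: open_nbhs_nbhs; split => //=; rewrite -xa.
move=> /nbhs_ballP[eps /= eps0 hball].
have [N hN] := geo_small (C * B) eps0.
have [a' [xa' na' /andP[la0 la1]]] := hB (iter N (torus_mul (invmx M)) x).
have xaN : x = pi (a' *m MR ^+ N).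
  have : iter N (torus_mul M) (iter N (torus_mul (invmx M)) x) = x.
    elim: N {hN xa'} => // N ih; rewrite -[RHS]ih iterSr iterS.
    by congr (iter N _ _); rewrite -torus_mulA mulVmx // torus_mul1.
  rewrite xa' => <-; elim: N {hN xa'} => [|N ih]; first by rewrite expr0 mulmx1.
  by rewrite iterS ih torus_mul_pi [MR ^+ N.+1]exprSr mulmxA.
pose s := lin a'.
(* The first N greedy digits of s in reverse order: beta^N s is the sum of the u_k beta^k plus the
   N-th iterate of s. *)
pose u k := if (k < N)%N then digit beta s (N - k.+1) else 0%N.
have usum J : (J <= N)%N -> \sum_(k < J) (u k)%:R * beta ^+ k + iter N tau s =
    beta ^+ J * iter (N - J) tau s.
  elim: J => [|J ih] JN; first by rewrite big_ord0 add0r expr0 mul1r subn0.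
  rewrite big_ord_recr /= addrAC ih 1?ltnW // /u JN.
  have -> : (N - J = (N - J.+1).+1)%N by rewrite -subSn.
  by rewrite exprSr -mulrA tau_rec; ring.
have s01 : 0 <= s < 1 by rewrite la0.
have uadm : left_adm u.
  have small J : (J <= N)%N -> \sum_(k < J) (u k)%:R * beta ^+ k < beta ^+ J.
    move=> JN; have /andP[t0 t1] := iter_tau_itv beta_gt1 N s01.
    have /andP[t2 t3] := iter_tau_itv beta_gt1 (N - J) s01.
    have := usum J JN; have : beta ^+ J * iter (N - J) tau s < beta ^+ J.
      by rewrite gtr_pMr ?exprn_gt0.
    lra.
  move=> J; have [JN|NJ] := leqP J N; first exact: small.
  have -> : \sum_(k < J) (u k)%:R * beta ^+ k = \sum_(k < N) (u k)%:R * beta ^+ k.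
    rewrite -(subnKC (ltnW NJ)) big_split_ord /= [X in _ + X]big1 ?addr0 // => k _.
    by rewrite /u ltnNge leq_addr /= mul0r.
  rewrite (lt_le_trans (small N (leqnn N))) // ler_weXn2l ?ltW //; exact: ltnW.
have [y hy] := is_stable_exists (fun k => left_adm_digit k uadm).
have yE : y = \sum_(k < N) (u k)%:R *: stab k.
  apply/eqP; rewrite -subr_eq0; apply/eqP/(@geo_eq0 _ Cy) => J.
  have := hy (N + J)%N; rewrite big_split_ord /= [X in _ - (_ + X)]big1 ?addr0; last first.
    by move=> k _; rewrite /u ltnNge leq_addr /= scale0r.
  move=> h; apply: le_trans h _; rewrite ler_wpM2l // exprD ler_piMl ?exprn_ge0 ?(ltW rho0) //.
  by rewrite exprn_ile1 // ltW.
have /andP[t0 t1] := iter_tau_itv beta_gt1 N s01.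
have wcoded : coded `[0, 1]%classic (pi (y + iter N tau s *: vv)).
  exists y, (iter N tau s); split => //; first by exists u.
  by rewrite /= in_itv /= t0 ltW.
have key : pi (y + iter N tau s *: vv) = pi (s *: vv *m MR ^+ N).
  rewrite -scalemxAl vvMX scalerA mulrC; have := usum N (leqnn N).
  rewrite subnn /= => <-; rewrite scalerDl !torus_piD; congr (_ + _).
  rewrite yE scaler_suml; elim: N {hN xa' xaN u usum uadm hy yE t0 t1 wcoded} (u) => [|K ih] v.
    by rewrite !big_ord0.
  by rewrite !big_ord_recr /= !torus_piD ih pi_vv.
have := hball (a - proj a' *m MR ^+ N); rewrite /= => h; apply: h.
  rewrite -ball_normE /= subKr (le_lt_trans _ hN) // (le_trans (contr _ _)) //.
  by rewrite [leRHS]mulrAC ler_wpM2l // mulr_ge0 // exprn_ge0 // ltW.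
rewrite torus_piB -xa xaN -torus_piB -mulmxBl subKr -/s.
by rewrite -scalemxAl scalemxAl -key.
Qed.

(** If x + pi(vv) has remainder s1 in [0, 1], then x + pi(s vv) has remainder s1 + s - 1, which runs
    through the interval from s = y0 + 1 - s1 on. The translation by [vv] makes this starting value
    nonnegative, and it accounts for the length 2. *)
Lemma sync_dense y0 eps : 0 <= y0 -> y0 + eps <= 1 -> forall x,
  exists2 a : R, 0 <= a <= 2 - eps & forall s, a <= s <= a + eps ->
    coded `[y0, y0 + eps]%classic (x + pi (s *: vv)).
Proof.
move=> y00 y1 x; have [y [s1 [Yy]]] := coded_surj (x + pi vv).
rewrite /= in_itv /= => /andP[s10 s11] xE.
exists (y0 + 1 - s1) => [|s /andP[sa sb]]; first by apply/andP; split; lra.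
exists y, (s1 + s - 1); split => //.
  by rewrite /= in_itv /=; apply/andP; split; lra.
have -> : x = pi (y + s1 *: vv) - pi vv by rewrite -xE addrK.
by rewrite -torus_piB -torus_piD; congr pi; apply/rowP => i; rewrite !mxE; ring.
Qed.

End Coding.

(** * Recurrence *)

Lemma reach_index (L j : nat) (i : int) : (L + `|i|.+1 <= j)%N ->
  exists k : nat, i = (1 + (L + k)%N%:Z) - j%:Z.
Proof. move=> h; exists (`|(i + j%:Z - 1 - L%:Z)%R|)%N; lia. Qed.

Section Recurrence.
Variables (R : realType) (n : nat).
Local Notation T := (torus R n).
Local Notation TB := (torus_borel R n).
Local Notation meas := (measurable : set (set TB)).

Lemma iter_torus_mul_continuous (B : 'M[int]_n) N : continuous (iter N (torus_mul B) : T -> T).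
Proof.
elim: N => [|N ih]; first by move=> x; exact: cvg_id.
move=> x; apply: (@continuous_comp _ _ _ (iter N (torus_mul B)) (torus_mul B)); first exact: ih.
exact: torus_mul_continuous.
Qed.

(** The image of an intersection may be smaller than the intersection of the images. Equality holds
    here because the sets decrease and the fibres are finite: if every point of a fibre drops out,
    all have dropped out at the largest of these indices. *)
Lemma image_bigcap_open_measurable (B : 'M[int]_n) (V : nat -> set T) :
  (map_mx intr B : 'M[R]_n) \in unitmx ->
  (forall x : T, finite_set [set y | torus_mul B y = x]) ->
  (forall k, open (V k)) -> (forall j k, (j <= k)%N -> V k `<=` V j) ->
  meas (torus_mul B @` (\bigcap_k V k)).
Proof.
move=> Bu fin oV dV.
rewrite (_ : _ @` _ = \bigcap_k (torus_mul B @` V k)).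
  apply: bigcap_measurable => // k _; apply: torus_open_measurable.
  exact: torus_mul_open.
apply/seteqP; split=> [_ [y Vy <-] k _|x Vx]; first by exists y => //; exact: Vy.
apply: contrapT => nx; have /finite_seqP[s sE] := fin x.
have h y : exists k, torus_mul B y = x -> ~ V k y.
  have [yx|] := pselect (torus_mul B y = x); last by exists 0%N.
  have /existsNP[k nk] : ~ forall k, V k y.
    by move=> Vy; apply: nx; exists y => // k _.
  by exists k.
have [f hf] := boolp.choice h.
have [y Vy yx] := Vx (\max_(z <- s) f z)%N I.
have ys : y \in s by have : [set` s] y by rewrite -sE.
apply: (hf y yx); apply: dV Vy; exact: leq_bigmax_seq.
Qed.

Variable mu : probability TB R.
Hypothesis tmu : translation_invariant mu.

Lemma haar_iter_torus_mul (B : 'M[int]_n) N (C : set T) :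
  (map_mx intr B : 'M[R]_n) \in unitmx -> meas C ->
  mu (iter N (torus_mul B) @^-1` C) = mu C.
Proof.
move=> Bu; elim: N C => // N ih C mC.
rewrite -[RHS](haar_torus_mul tmu Bu mC) -[RHS]ih //.
by have := @torus_mul_measurable R n B measurableT _ mC; rewrite setTI.
Qed.

Variable M : 'M[int]_n.
Hypothesis Mu : (map_mx intr M : 'M[R]_n) \in unitmx.
Hypothesis MuZ : M \in unitmx.
Variable A : set T.
Hypothesis cA : closed A.
Hypothesis EA : mu [set x | forall j, ~ A (iter j (torus_mul M) x)] = 0%E.

Let S := torus_mul M : T -> T.
Let Si := torus_mul (invmx M) : T -> T.

Let iter_SiS i N x : (i <= N)%N -> iter (N - i) Si (iter N S x) = iter i S x.
Proof.
move=> iN; rewrite -{2}(subnK iN) iterD; elim: (N - i)%N (iter i S x) => // j ih z.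
rewrite iterSr iterS (_ : Si (S _) = iter j S z) ?ih //.
by rewrite /Si /S -torus_mulA mulmxV // torus_mul1.
Qed.

Let oA (B : 'M[int]_n) j : open [set x : T | ~ A (iter j (torus_mul B) x)].
Proof.
by have /continuousP/(_ _ (closed_openC cA)) := @iter_torus_mul_continuous B j.
Qed.

Definition avoid (N : nat) : set T := [set x | forall j, (N <= j)%N -> ~ A (iter j Si x)].

Let V N k : set T := \bigcap_(j < k) [set x | ~ A (iter (N + j) Si x)].

Let oV N k : open (V N k).
Proof.
rewrite /V bigcap_mkord; elim: k => [|k ih]; first by rewrite big_ord0; exact: openT.
rewrite big_ord_recr /=; apply: openI => //; exact: oA.
Qed.

Let avoidE N : avoid N = \bigcap_k V N k.
Proof.
apply/seteqP; split=> [x hx k _ j _|x hx j Nj] /=; first by apply: hx; rewrite leq_addr.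
by have := hx j.+1 I (j - N)%N; rewrite /= subnKC //; apply; rewrite ltnS leq_subr.
Qed.

Lemma avoid_measurable N : meas (avoid N).
Proof. by rewrite avoidE; apply: bigcap_measurable => // k _; exact: torus_open_measurable. Qed.

Lemma avoid_image_measurable (B : 'M[int]_n) N :
  (map_mx intr B : 'M[R]_n) \in unitmx ->
  (forall x : T, finite_set [set y | torus_mul B y = x]) ->
  meas (torus_mul B @` avoid N).
Proof.
move=> Bu fin; rewrite avoidE; apply: image_bigcap_open_measurable => // j k jk x hx i ij.
by apply: hx; exact: leq_trans jk.
Qed.

(* The preimage of [avoid N] under S^(N+k) avoids A along k+1 steps forward. *)
Lemma avoid_null N : mu (avoid N) = 0%E.
Proof.
pose W k : set T := \bigcap_(j < k) [set x | ~ A (iter j S x)].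
have mW k : meas (W k).
  by apply: bigcap_measurableType => j _; apply: torus_open_measurable; exact: oA.
have WE : \bigcap_k W k = [set x | forall j, ~ A (iter j S x)].
  apply/seteqP; split=> [x hx j|x hx k _ j _]; last exact: hx.
  exact: (hx j.+1 I j (ltnSn j)).
have cW : mu (W k) @[k --> \oo] --> mu (\bigcap_k W k).
  apply: nonincreasing_cvg_mu => //.
  - by rewrite (le_lt_trans (probability_le1 mu (mW 0%N))) ?ltry.
  - exact: bigcap_measurable.
  - apply/nonincreasing_seqP => k; apply/subsetPset => x hx j jk; apply: hx.
    exact: ltn_trans (ltnSn k).
rewrite WE EA in cW.
apply/eqP; rewrite eq_le measure_ge0 andbT -(cvg_lim (@ereal_hausdorff R) cW).
apply: lime_ge; first by apply/cvg_ex; eexists; exact: cW.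
exists 0%N => // k _ /=.
have mQ : meas (iter (N + k) S @^-1` avoid N).
  have mc := torus_continuous_measurable (@iter_torus_mul_continuous M (N + k)).
  by have := mc measurableT _ (avoid_measurable N); rewrite setTI.
rewrite -(haar_iter_torus_mul (N + k) Mu (avoid_measurable N)) le_measure ?inE //.
move=> x hx j /= jk; have jN : (j <= N + k)%N by rewrite (leq_trans (ltnW jk)) // leq_addl.
rewrite -(iter_SiS x jN); apply: hx.
by rewrite -addnBA ?leq_addr // ltnW.
Qed.

Variable codes : (int -> nat) -> T -> Prop.
Hypothesis codesT : forall j e x, codes e x -> codes (fun k => e (k + j%:Z)) (iter j S x).
Hypothesis codesTi : forall j e x, codes e x -> codes (fun k => e (k - j%:Z)) (iter j Si x).
Hypothesis codesA : forall x, A x -> exists e, codes e x.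
Variable L : nat.
Hypothesis codes_agree : forall x e e', A x -> codes e x -> codes e' x ->
  forall k : nat, e (1 + (L + k)%N%:Z) = e' (1 + (L + k)%N%:Z).

(** After j backward shifts the digit of index i has index i + j, which exceeds L as soon as j >= L
    + |i| + 1. A visit to A at such a time determines it, and infinitely many visits determine all
    digits. *)
Lemma unique_code x : (forall N, ~ avoid N x) -> exists! e, codes e x.
Proof.
move=> hx.
have hit N : exists2 j, (N <= j)%N & A (iter j Si x).
  have /existsNP[j] := hx N.
  by move=> /not_implyP[Nj /contrapT Aj]; exists j.
have [j0 _ Aj0] := hit 0%N.
have [e0 ce0] := codesA Aj0.
have := codesT j0 ce0; rewrite (_ : iter j0 S _ = x); last first.
  rewrite /S /Si; elim: j0 (x) {Aj0 ce0} => // j ih z.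
  by rewrite iterSr iterS -torus_mulA mulVmx // torus_mul1.
move=> ce; exists (fun k => e0 (k + j0%:Z)); split => // e' ce'.
apply/funext => i; have [j ij Aj] := hit (L + `|i|.+1)%N.
have [k ik] : exists k : nat, i = (1 + (L + k)%N%:Z) - j%:Z by exact: reach_index.
have := codes_agree Aj (codesTi j ce) (codesTi j ce') k.
by rewrite ik.
Qed.

Variable B : 'M[int]_n.
Hypothesis detB : \det B != 0.
Variable X : set (int -> nat).
Hypothesis codesX : forall e x, codes e x -> X e.
Hypothesis codes_ex : forall e, X e -> exists x, codes e x.
Hypothesis codes_uniq : forall e x x', codes e x -> codes e x' -> x = x'.
Variable f : (int -> nat) -> T.
Hypothesis fE : forall e x, codes e x -> f e = torus_mul B x.

(** Off the null union of the images of the sets [avoid N], each point of the fibre of [B] has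
    exactly one code, so sending a code to the point it codes is a bijection between the fibres of
    [f] and [B]. *)
Lemma ae_fiber_card : {ae mu, forall x : T,
   ([set e | X e /\ f e = x] #= `I_`|\det B|%N)%card}.
Proof.
have Bu : (map_mx intr B : 'M[R]_n) \in unitmx.
  by rewrite unitmxE det_map_mx unitfE intr_eq0.
have fin (x : T) : finite_set [set y | torus_mul B y = x].
  by exists `|\det B|%N; exact: torus_fiber_card.
have Bavoid N : mu.-negligible (torus_mul B @` avoid N).
  apply/negligibleP; first exact: avoid_image_measurable.
  have /finite_seqP[s sE] := fin 0.
  apply: (@haar_image_null _ _ mu tmu B Bu s).
  - by move=> c Bc; have : [set` s] c by rewrite -sE.
  - exact: avoid_measurable.
  - exact: avoid_image_measurable.
  - exact: avoid_null.
apply: (negligibleS _ (negligible_bigcup Bavoid)) => x /= nx; apply: contrapT => hx.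
apply: nx.
have uniq y : torus_mul B y = x -> exists! e, codes e y.
  by move=> yx; apply: unique_code => N yN; apply: hx; exists N => //; exists y.
apply: (card_eq_trans _ (torus_fiber_card x detB)).
have h e : exists y, X e -> codes e y.
  have [Xe|] := pselect (X e); last by exists 0.
  by have [y] := codes_ex Xe; exists y.
have [g hg] := boolp.choice h.
rewrite (_ : [set y | _] = g @` [set e | X e /\ f e = x]).
  rewrite card_eq_sym; apply: inj_card_eq => e e'; rewrite !inE => -[Xe fe] [Xe' fe'] gg.
  have ce := hg e Xe; have := hg e' Xe'; rewrite -gg => ce'.
  have [e1 [_ u]] := uniq (g e) (etrans (esym (fE ce)) fe).
  by rewrite -(u e) // -(u e').
apply/seteqP; split=> [y /= yx|_ [e [Xe fe] <-]] /=.
  have [e [ce _]] := uniq y yx; exists e.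
    by split; [exact: codesX ce | rewrite (fE ce)].
  exact: codes_uniq (hg e (codesX ce)) ce.
by rewrite -(fE (hg e Xe)).
Qed.

End Recurrence.

(** * Minimal polynomials and companion matrices *)

Local Open Scope complex_scope.

Section MinimalPolynomial.
Variables (R : realType) (beta : R) (p : {poly rat}).
Hypothesis pmin : is_minpoly p beta.

Lemma ratr_intr_poly (S : numFieldType) (q : {poly int}) :
  map_poly (ratr : rat -> S) (map_poly intr q) = map_poly intr q.
Proof. by apply/polyP => i; rewrite !coef_map /= ratr_int. Qed.

Lemma lead_coef_intr (q : {poly int}) :
  lead_coef (map_poly intr q : {poly rat}) = (lead_coef q)%:~R.
Proof. by rewrite lead_coef_map_inj //; exact: intr_inj. Qed.

Lemma minpoly_dvd (q : {poly rat}) : root (map_poly ratr q) beta -> p %| q.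
Proof.
move=> rq; have [_ pirr rp] := pmin; apply: contraT.
rewrite -irreducible_poly_coprime // => /Bezout_eq1_coprimepP[[u v] /= e].
have := congr1 (fun f => (map_poly (ratr : rat -> R) f).[beta]) e.
rewrite rmorphD !rmorphM rmorph1 hornerD !hornerM hornerC.
by rewrite (rootP rp) (rootP rq) !mulr0 addr0 => /eqP; rewrite eq_sym oner_eq0.
Qed.

Lemma minpoly_coprime_deriv : coprimep p p^`().
Proof.
have [pm pirr rp] := pmin; rewrite irreducible_poly_coprime //.
have [s1 _] := pirr.
have p0 : p != 0 by rewrite monic_neq0.
apply/negP => /dvdp_leq h; have := lt_size_deriv p0; rewrite ltnNge h //.
apply/eqP => /(congr1 (fun f : {poly rat} => f`_(size p).-2)).
have [s es] : exists s, size p = s.+2 by exists (size p).-2; case: (size p) s1 => [|[]].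
rewrite es coef0 coef_deriv /=; have := monicP pm; rewrite lead_coefE es /= => ->.
by move/eqP; rewrite pnatr_eq0.
Qed.

Lemma minpoly_dvd_int (q : {poly int}) : root (map_poly intr q) beta ->
  exists (p1 r : {poly int}) (a : rat), [/\ a != 0, p = a *: map_poly intr p1 & q = p1 * r].
Proof.
rewrite -ratr_intr_poly => /minpoly_dvd /dvdpP_rat_int[p1 [a a0 pa] [r qr]].
by exists p1, r, a.
Qed.

Lemma int_mul_eq1 (x y : int) : x * y = 1 -> `|x| = 1 /\ x * x = 1.
Proof.
move=> /(congr1 absz); rewrite abszM => /eqP; rewrite muln_eq1 => /andP[/eqP x1 _].
have nx : `|x| = 1 by rewrite -abszE x1.
by split=> //; have [->|->] : x = 1 \/ x = -1 by lia.
Qed.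

(** By Gauss's lemma an integer polynomial proportional to p divides a monic integer one, so its
    leading coefficient is 1 or -1. *)
Lemma minpoly_int : integralOver (intr : int -> R) beta ->
  exists2 P : {poly int}, P \is monic & p = map_poly intr P.
Proof.
move=> [q qm /minpoly_dvd_int[p1 [r [a [a0 pa qr]]]]].
have [l1 l2] : `|lead_coef p1| = 1 /\ lead_coef p1 * lead_coef p1 = 1.
  by apply: (@int_mul_eq1 _ (lead_coef r)); rewrite -lead_coefM -qr (monicP qm).
have [pm _ _] := pmin.
have al : a * (lead_coef p1)%:~R = 1.
  by have := monicP pm; rewrite pa lead_coefZ lead_coef_intr.
exists (lead_coef p1 *: p1); first by rewrite monicE lead_coefZ l2.
rewrite pa map_polyZ; congr (_ *: _).
have := congr1 (fun z : int => z%:~R : rat) l2; rewrite intrM => l3.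
by rewrite -[LHS]mulr1 -[X in a * X]l3 mulrA al mul1r.
Qed.

(** The reciprocal of a monic equation of 1/beta vanishes at beta and has constant coefficient 1,
    which the constant coefficient of P divides. *)
Lemma minpoly_coef0 (P : {poly int}) : P \is monic -> p = map_poly intr P ->
  beta != 0 -> integralOver (intr : int -> R) beta^-1 -> `|P`_0| = 1.
Proof.
move=> Pm pP b0 [q qm rq].
pose q' : {poly int} := \poly_(i < size q) q`_(size q - i.+1).
have q0 : (0 < size q)%N by rewrite size_poly_gt0 monic_neq0.
have rq' : root (map_poly intr q') beta.
  apply/rootP.
  have -> : (map_poly intr q').[beta] =
      beta ^+ (size q).-1 * (map_poly intr q).[beta^-1].
    rewrite !(@horner_coef_wide _ (size q)); last 2 first.
    - by rewrite size_map_inj_poly //; exact: intr_inj.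
    - rewrite (leq_trans (size_poly _ _)) //; exact: size_poly.
    rewrite mulr_sumr (reindex_inj rev_ord_inj) /=; apply: eq_bigr => i _.
    have hi : (i < size q)%N := ltn_ord i.
    have lt : (size q - i.+1 < size q)%N by lia.
    rewrite !coef_map_id0 // coef_poly lt.
    have -> : (size q - (size q - i.+1).+1 = i)%N by lia.
    rewrite mulrCA; congr (_ * _).
    have -> : (size q - i.+1 = (size q).-1 - i)%N by lia.
    by rewrite exprB ?unitfE ?exprVn //; lia.
  by rewrite (rootP rq) mulr0.
have [p1 [r [a [a0 pa qr]]]] := minpoly_dvd_int rq'.
have c0 : p1`_0 * r`_0 = 1.
  by rewrite -coef0M -qr coef_poly q0 subn1 -/(lead_coef q) (monicP qm).
have [pm _ _] := pmin.
have al : a * (lead_coef p1)%:~R = 1.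
  by have := monicP pm; rewrite pa lead_coefZ lead_coef_intr.
have : P`_0 * lead_coef p1 = p1`_0.
  apply: (@intr_inj rat); rewrite intrM.
  have : (P`_0)%:~R = a * (p1`_0)%:~R.
    by have := congr1 (fun f : {poly rat} => f`_0) pP; rewrite pa coefZ !coef_map_id0.
  by move=> ->; rewrite mulrAC al mul1r.
move=> e; have : P`_0 * (lead_coef p1 * r`_0) = 1 by rewrite mulrA e.
by move=> /int_mul_eq1[].
Qed.

Lemma conjugates_injective m (b : 'I_m -> R[i]) :
  map_poly ratr p = \prod_(i < m) ('X - (b i)%:P) -> injective b.
Proof.
move=> pb; apply/injectiveP; rewrite /injectiveb /dinjectiveb.
rewrite -separable_prod_XsubC big_map big_enum /= -pb.
by rewrite separable_map unlock minpoly_coprime_deriv.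
Qed.

Lemma conjugates_beta m (b : 'I_m -> R[i]) :
  map_poly ratr p = \prod_(i < m) ('X - (b i)%:P) -> exists i0, b i0 = beta%:C.
Proof.
move=> pb; have [_ _ rp] := pmin.
have : root (map_poly ratr p) beta%:C.
  have -> : map_poly (ratr : rat -> R[i]) p = map_poly (real_complex R) (map_poly ratr p).
    rewrite -map_poly_comp; apply: eq_map_poly => x /=.
    by rewrite fmorph_rat.
  by rewrite fmorph_root.
rewrite pb -(big_enum _ _ _ (fun i => 'X - (b i)%:P)) /=.
rewrite -(big_map b xpredT (fun z => 'X - z%:P)) root_prod_XsubC => /mapP[i _ ->].
by exists i.
Qed.

End MinimalPolynomial.

(** * The companion matrix, its eigenvectors and Pisot's theorem *)

Section Companion.
Variables (n : nat) (P : {poly int}).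

(* The transpose of M_beta, since vectors are rows here. *)
Definition comp_mx : 'M[int]_n.+1 :=
  \matrix_(j, i) (if i == ord0 then - P`_(n - j) else (i == j.+1 :> nat)%:R).

Section Eigen.
Variables (K : fieldType) (x : K).
Hypotheses (Pm : P \is monic) (sP : size P = n.+2).
Hypotheses (x0 : x != 0) (rx : root (map_poly intr P) x).

Definition eigen_row : 'rV[K]_n.+1 := \row_i x^-1 ^+ i.

Lemma eigen_rowP : eigen_row *m map_mx intr comp_mx = x *: eigen_row.
Proof.
apply/rowP => i; rewrite !mxE.
have [->|i0] := eqVneq i ord0.
  rewrite expr0 mulr1.
  under eq_bigr => j _ do rewrite !mxE eqxx rmorphN /= mulrN.
  rewrite sumrN.
  have := rootP rx; rewrite (@horner_coef_wide _ n.+2); last first.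
    by rewrite (leq_trans (size_poly _ _)) // sP.
  rewrite big_ord_recr /=.
  have -> : (map_poly intr P)`_n.+1 = 1 :> K.
    by rewrite coef_map_id0 //; have := monicP Pm; rewrite lead_coefE sP /= => ->.
  rewrite mul1r => e.
  apply: (mulfI (expf_neq0 n x0)).
  rewrite mulrN -exprSr; apply/eqP; rewrite eq_sym -addr_eq0 addrC; apply/eqP.
  apply: etrans e; congr (_ + _); rewrite mulr_sumr (reindex_inj rev_ord_inj) /=.
  apply: eq_bigr => j _; have jn : (j <= n)%N by rewrite -ltnS.
  rewrite coef_map_id0 // subSS subKn // mulrA mulrC.
  have -> : x ^+ n * x^-1 ^+ (n - j) = x ^+ j.
    by rewrite exprVn -exprB ?unitfE ?leq_subr // subKn.
  by [].
have [k ik] : exists k : 'I_n.+1, (i = k.+1 :> nat).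
  case: i i0 => [[|i] hi] // _.
  by exists (Ordinal (ltnW hi)).
rewrite (bigD1 k) //= big1 => [|j jk]; last first.
  rewrite !mxE (negPf i0) ik eqSS eq_sym.
  by rewrite (_ : (j == k :> nat) = false) ?mulr0 //; apply/negbTE.
by rewrite !mxE (negPf i0) ik eqxx mulr1 addr0 exprS mulrA divff // mul1r.
Qed.

End Eigen.

Lemma eigen_horner (K : fieldType) (A : 'M[K]_n.+1) (v : 'rV[K]_n.+1) x (f : {poly K}) :
  v *m A = x *: v -> v *m horner_mx A f = f.[x] *: v.
Proof.
move=> vA; elim/poly_ind: f => [|f c ih].
  by rewrite rmorph0 mulmx0 horner0 scale0r.
rewrite rmorphD rmorphM /= horner_mx_X horner_mx_C mulmxDr mulmxA ih -scalemxAl vA.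
by rewrite hornerMXaddC scalerA mul_mx_scalar scalerDl.
Qed.

Variables (R : realType) (beta : R).
Hypotheses (Pm : P \is monic) (sP : size P = n.+2).
Hypotheses (beta_gt1 : 1 < beta) (rbeta : root (map_poly intr P) beta).
Hypothesis P0 : `|P`_0| = 1.

Variable b : 'I_n.+1 -> R[i].
Hypothesis Pb : map_poly intr P = \prod_(i < n.+1) ('X - (b i)%:P).
Hypothesis binj : injective b.
Variable i0 : 'I_n.+1.
Hypothesis bi0 : b i0 = beta%:C.
Hypothesis blt1 : forall i, i != i0 -> `|b i| < 1.

Let beta0 : beta != 0. Proof. by rewrite gt_eqF // (lt_trans ltr01). Qed.

Lemma conj_root k : root (map_poly intr P) (b k).
Proof.
rewrite Pb /root horner_prod prodf_seq_eq0; apply/hasP; exists k.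
  exact: mem_index_enum.
by rewrite /= hornerXsubC subrr.
Qed.

Lemma prod_conj : \prod_k b k = (-1) ^+ n.+1 * (P`_0)%:~R.
Proof.
have := congr1 (fun f : {poly R[i]} => f.[0]) Pb.
rewrite horner_coef0 coef_map_id0 // horner_prod.
under eq_bigr => k _ do rewrite hornerXsubC sub0r.
by rewrite prodrN card_ord => ->; rewrite mulrA -exprMn mulrNN mulr1 expr1n mul1r.
Qed.

Lemma norm_coef0 : `|(P`_0)%:~R| = 1 :> R[i].
Proof. by rewrite -intr_norm P0. Qed.

Lemma prod_conj_norm : `|\prod_k b k| = 1.
Proof. by rewrite prod_conj normrM normrX normrN normr1 expr1n mul1r norm_coef0. Qed.

Lemma conj_neq0 k : b k != 0.
Proof.
apply: contra_eq_neq prod_conj_norm => bk.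
by rewrite (bigD1 k) //= bk mul0r normr0 eq_sym oner_eq0.
Qed.

(** The rows are the eigenvectors for all conjugates, so this Vandermonde matrix in their inverses
    diagonalizes the companion matrix. *)
Definition conj_mx : 'M[R[i]]_n.+1 := \matrix_(k, i) (b k)^-1 ^+ i.
Local Notation M := (map_mx intr comp_mx).

Lemma conj_mx_unit : conj_mx \in unitmx.
Proof.
have -> : conj_mx = (Vandermonde n.+1 (\row_k (b k)^-1))^T.
  by apply/matrixP => k i; rewrite !mxE.
rewrite unitmx_tr unitmxE unitfE det_Vandermonde.
apply/prodf_neq0 => i _; apply/prodf_neq0 => j ij; rewrite !mxE subr_eq0.
apply: contraTneq ij => /invr_inj /binj ->; by rewrite ltnn.
Qed.

Lemma conj_mx_horner (f : {poly R[i]}) :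
  conj_mx *m horner_mx M f = diag_mx (\row_k f.[b k]) *m conj_mx.
Proof.
apply/row_matrixP => k; rewrite row_mul.
transitivity (f.[b k] *: row k conj_mx); last first.
  by apply/rowP => i; rewrite mul_diag_mx !mxE.
have -> : row k conj_mx = eigen_row (b k) by apply/rowP => i; rewrite !mxE.
by apply: eigen_horner; apply: eigen_rowP => //; [exact: conj_neq0 | exact: conj_root].
Qed.

Lemma det_horner (f : {poly R[i]}) : \det (horner_mx M f) = \prod_k f.[b k].
Proof.
have := congr1 determinant (conj_mx_horner f).
rewrite !det_mulmx det_diag mulrC => /(mulIf _) ->.
  by apply: eq_bigr => k _; rewrite mxE.
by have := conj_mx_unit; rewrite unitmxE unitfE.
Qed.

Lemma comp_mx_unit : comp_mx \in unitmx.
Proof.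
rewrite unitmxE; suff : `|\det comp_mx| = 1.
  move=> h; have [->|->] : \det comp_mx = 1 \/ \det comp_mx = -1 by lia.
    exact: unitr1.
  exact: unitrN1.
apply: (@intr_inj R[i]); rewrite intr_norm -det_map_mx /=.
have := det_horner 'X; rewrite horner_mx_X => ->.
rewrite -[RHS]prod_conj_norm; congr `|_|; apply: eq_bigr => k _; exact: hornerX.
Qed.

Lemma map_comp_mx_unit (S : numFieldType) : (map_mx intr comp_mx : 'M[S]_n.+1) \in unitmx.
Proof.
by have := comp_mx_unit; rewrite !unitmxE det_map_mx; exact: rmorph_unit.
Qed.

(* The Horner values of P at beta, from the leading coefficient down; they form
   the left eigenvector of the companion matrix for beta. *)
Definition horner_val (j : nat) : R :=
  \sum_(i < j.+1) (P`_(n.+1 - i))%:~R * beta ^+ (j - i).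

Lemma horner_val0 : horner_val 0 = 1.
Proof.
rewrite /horner_val big_ord1 subn0 expr0 mulr1.
by have := monicP Pm; rewrite lead_coefE sP /= => ->.
Qed.

Lemma horner_valS j : horner_val j.+1 = beta * horner_val j + (P`_(n - j))%:~R.
Proof.
rewrite /horner_val big_ord_recr /= subSS subnn expr0 mulr1 mulr_sumr; congr (_ + _).
apply: eq_bigr => i _; by rewrite mulrCA -exprS [(j.+1 - i)%N]subSn // -ltnS.
Qed.

Lemma horner_val_last : horner_val n.+1 = 0.
Proof.
rewrite -[RHS](rootP rbeta) (@horner_coef_wide _ n.+2); last first.
  by rewrite (leq_trans (size_poly _ _)) // sP.
rewrite /horner_val [RHS](reindex_inj rev_ord_inj) /=; apply: eq_bigr => i _.
by rewrite subSS coef_map_id0.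
Qed.

Definition left_eigen : 'cV[R]_n.+1 := \col_j horner_val j.

Lemma left_eigenP : M *m left_eigen = beta *: left_eigen.
Proof.
apply/colP => j; rewrite !mxE big_ord_recl !mxE eqxx horner_val0 mulr1.
under eq_bigr => i _ do rewrite !mxE /= /bump add1n eqSS.
have -> : \sum_(i < n) (i == j :> nat)%:R%:~R * horner_val i.+1 = horner_val j.+1.
  have [jn|nj] := ltnP j n.
    rewrite (bigD1 (Ordinal jn)) //= eqxx mul1r big1 ?addr0 // => i ij.
    rewrite (_ : (i == j :> nat) = false) ?mul0r //; apply: contraNF ij => /eqP e.
    exact/eqP/val_inj.
  have -> : (j = n :> nat) by apply/eqP; rewrite eqn_leq nj -ltnS ltn_ord.
  rewrite horner_val_last big1 // => i _.
  by rewrite (ltn_eqF (ltn_ord i)) mul0r.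
by rewrite horner_valS rmorphN /= addrC addrK.
Qed.

Definition lin (y : 'rV[R]_n.+1) : R := (y *m left_eigen) ord0 ord0.

Lemma linD y z : lin (y + z) = lin y + lin z.
Proof. by rewrite /lin mulmxDl mxE. Qed.

Lemma linN y : lin (- y) = - lin y.
Proof. by rewrite /lin mulNmx mxE. Qed.

Lemma linZ a y : lin (a *: y) = a * lin y.
Proof. by rewrite /lin -scalemxAl mxE. Qed.

Lemma lin_mulM y : lin (y *m M) = beta * lin y.
Proof. by rewrite /lin -mulmxA left_eigenP -scalemxAr mxE. Qed.

Definition e0 : 'rV[R]_n.+1 := delta_mx ord0 ord0.

Lemma lin_e0 : lin e0 = 1.
Proof. by rewrite /lin /e0 -rowE !mxE horner_val0. Qed.

(* The value P'(beta) / beta ^+ n, see [gamma_deriv]. *)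
Definition gamma : R := lin (eigen_row beta).

(** A row eigenvector and a column eigenvector for different eigenvalues are orthogonal. *)
Lemma conj_lin_eq0 k : k != i0 -> eigen_row (b k) *m map_mx (real_complex R) left_eigen = 0.
Proof.
move=> ki; set LC := map_mx _ _.
have eL : map_mx intr comp_mx *m LC = beta%:C *: LC.
  have := congr1 (map_mx (real_complex R)) left_eigenP.
  rewrite map_mxM map_mxZ /= => <-; congr (_ *m _).
  by apply/matrixP => i j; rewrite !mxE rmorph_int.
have e1 : b k *: (eigen_row (b k) *m LC) = beta%:C *: (eigen_row (b k) *m LC).
  rewrite scalemxAl -(eigen_rowP Pm sP (conj_neq0 k) (conj_root k)) -mulmxA eL.
  by rewrite scalemxAr.
apply/eqP; move/eqP: e1; rewrite -subr_eq0 -scalerBl scaler_eq0 subr_eq0 -bi0.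
by case/orP => // /eqP /binj /eqP; rewrite (negPf ki).
Qed.

(** Otherwise [left_eigen] would be orthogonal to a basis of row eigenvectors, although its first
    entry is 1. *)
Lemma gamma_neq0 : gamma != 0.
Proof.
apply/eqP => g0.
have h : conj_mx *m map_mx (real_complex R) left_eigen = 0.
  apply/row_matrixP => k; rewrite row_mul row0.
  have -> : row k conj_mx = eigen_row (b k) by apply/rowP => i; rewrite !mxE.
  have [->|/conj_lin_eq0 //] := eqVneq k i0.
  have -> : eigen_row (b i0) = map_mx (real_complex R) (eigen_row beta).
    by apply/rowP => i; rewrite !mxE bi0 rmorphXn /= fmorphV.
  rewrite -map_mxM; apply/rowP => j; rewrite !ord1 !mxE.
  by move: g0; rewrite /gamma /lin mxE => ->; rewrite rmorph0.
have : map_mx (real_complex R) left_eigen = 0.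
  by rewrite -(mulKmx conj_mx_unit (map_mx _ _)) h mulmx0.
move=> /(congr1 (fun A : 'cV_n.+1 => A ord0 ord0)); rewrite !mxE horner_val0.
by move=> /eqP; rewrite fmorph_eq0 oner_eq0.
Qed.

Definition vv : 'rV[R]_n.+1 := gamma^-1 *: eigen_row beta.

Lemma lin_vv : lin vv = 1.
Proof. by rewrite /vv linZ mulVf // gamma_neq0. Qed.

Lemma vvM : vv *m M = beta *: vv.
Proof.
by rewrite /vv -scalemxAl (eigen_rowP Pm sP beta0 rbeta) !scalerA mulrC.
Qed.

Lemma vv_horner (f : {poly R}) : vv *m horner_mx M f = f.[beta] *: vv.
Proof. exact: eigen_horner vvM. Qed.

Definition proj (y : 'rV[R]_n.+1) := y - lin y *: vv.

Lemma normCE (z : R[i]) : `|z| = (Normc.normc z)%:C.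
Proof. by case: z => x y; rewrite normc_def. Qed.

Lemma conj_radius : exists rho : R, [/\ 0 < rho, rho < 1 &
  forall k, k != i0 -> Normc.normc (b k) <= rho].
Proof.
(* The default 1/2 keeps the radius positive even when the maximum is over no index. *)
exists (\big[Num.max/2^-1]_(k | k != i0) Normc.normc (b k)); split.
- by apply: lt_le_trans (bigmax_ge_id _ _ _ _); rewrite invr_gt0.
- apply/bigmax_ltP; split; first by rewrite invf_lt1 // ltr1n.
  by move=> k /blt1; rewrite normCE -[1]/(1%:C) ltcR.
- by move=> k ki; apply: le_bigmax_cond.
Qed.

Lemma proj_mx y : proj y = y *m (1%:M - left_eigen *m vv).
Proof.
rewrite mulmxBr mulmx1 mulmxA /proj; congr (_ - _).
by rewrite [y *m left_eigen]mx11_scalar mul_scalar_mx.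
Qed.

(** In the basis of eigenvectors the projection [E] has no component for beta: the column [i0] of
    [cc] vanishes. The other eigenvalues have modulus at most rho, and C collects the entries of the
    base changes. *)
Lemma contraction : exists C rho : R, [/\ 0 <= C, 0 < rho, rho < 1 &
  forall y N, `|proj y *m M ^+ N| <= C * rho ^+ N * `|y|].
Proof.
have [rho [r0 r1 hr]] := conj_radius.
pose E : 'M[R]_n.+1 := 1%:M - left_eigen *m vv.
pose cc := map_mx (real_complex R) E *m invmx conj_mx.
have El : E *m left_eigen = 0.
  rewrite mulmxBl mul1mx -mulmxA (_ : vv *m left_eigen = 1%:M) ?mulmx1 ?subrr //.
  by apply/rowP => i; rewrite ord1 [RHS]mxE -[LHS]/(lin vv) lin_vv.
have cc0 i : cc i i0 = 0.
  have h : cc *m (conj_mx *m map_mx (real_complex R) left_eigen) = 0.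
    by rewrite mulmxA mulmxKV ?conj_mx_unit // -map_mxM El map_mx0.
  have := congr1 (fun A : 'cV_n.+1 => A i ord0) h; rewrite mxE (bigD1 i0) //= big1 ?addr0.
    rewrite [RHS]mxE => /eqP; rewrite mulf_eq0 => /orP[/eqP//|/eqP g0].
    case/eqP: gamma_neq0; apply: (@complexI R); rewrite rmorph0 -[RHS]g0.
    rewrite /gamma /lin !mxE rmorph_sum /=; apply: eq_bigr => k _.
    by rewrite !mxE rmorphM bi0 /= rmorphXn /= fmorphV.
  move=> k ki; rewrite [X in _ * X](_ : _ = 0) ?mulr0 //.
  have := congr1 (fun A : 'rV_1 => A ord0 ord0) (conj_lin_eq0 ki).
  rewrite !mxE => e; rewrite -[RHS]e; apply: eq_bigr => j _; by rewrite !mxE.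
pose C := \sum_(i < n.+1) \sum_(j < n.+1) \sum_(k < n.+1)
  Normc.normc (cc i k) * Normc.normc (conj_mx k j).
have nc0 z : 0 <= Normc.normc z :> R by case: z => ? ?; exact: sqrtr_ge0.
have C0 : 0 <= C.
  by do 3! (apply: sumr_ge0 => ? _); rewrite mulr_ge0.
exists C, rho; split => // y N.
rewrite proj_mx -/E -mulmxA (le_trans (mulmx_norm_le _ _)) // mulrC ler_wpM2r //.
rewrite /C mulr_suml; apply: ler_sum => i _; rewrite mulr_suml; apply: ler_sum => j _.
have VN : conj_mx *m map_mx (real_complex R) (M ^+ N) = diag_mx (\row_k b k ^+ N) *m conj_mx.
  have -> : map_mx (real_complex R) (M ^+ N) = horner_mx (map_mx intr comp_mx) 'X^N.
    rewrite [RHS]rmorphXn /= horner_mx_X [LHS]rmorphXn /=; congr (_ ^+ _).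
    by apply/matrixP => u v; rewrite !mxE rmorph_int.
  by rewrite conj_mx_horner; congr (diag_mx _ *m _); apply/rowP => k; rewrite !mxE hornerXn.
have e : ((E *m M ^+ N) i j)%:C = \sum_k cc i k * (b k ^+ N * conj_mx k j).
  transitivity ((map_mx (real_complex R) (E *m M ^+ N)) i j); first by rewrite [RHS]mxE.
  rewrite map_mxM /= -(mulmxKV conj_mx_unit (map_mx (real_complex R) E)) -/cc -mulmxA VN.
  by rewrite mxE; apply: eq_bigr => k _; rewrite mul_diag_mx !mxE.
have -> : `|(E *m M ^+ N) i j| = Normc.normc (\sum_k cc i k * (b k ^+ N * conj_mx k j)).
  apply: (@complexI R); rewrite -normCE -e normCE /Normc.normc /=.
  by rewrite expr0n addr0 sqrtr_sqr.
suff : (Normc.normc (\sum_k cc i k * (b k ^+ N * conj_mx k j)))%:C <=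
    ((\sum_(k < n.+1) Normc.normc (cc i k) * Normc.normc (conj_mx k j)) * rho ^+ N)%:C.
  by rewrite lecR.
rewrite -normCE (le_trans (ler_norm_sum _ _ _)) // mulr_suml rmorph_sum /=.
apply: ler_sum => k _; rewrite !normrM normrX !normCE -rmorphXn -!rmorphM lecR.
have [->|ki] := eqVneq k i0.
  by rewrite cc0 Normc.normc0 !mul0r.
rewrite mulrAC mulrA ler_wpM2r // ler_wpM2l //.
by rewrite lerXn2r ?nnegrE ?hr // ltW.
Qed.

Lemma Zadj_sum (I : finType) (F : I -> R) : (forall i, Zadj beta (F i)) ->
  Zadj beta (\sum_i F i).
Proof.
by move=> h; elim/big_ind: _ => //; [exact: Zadj0 | exact: ZadjD].
Qed.

Lemma horner_val_Zadj j : Zadj beta (horner_val j).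
Proof.
apply: Zadj_sum => i; apply: ZadjM; first exact: Zadj_int.
by apply: ZadjX; exact: Zadj_beta.
Qed.

Lemma lin_Zadj z : z \in @int_rV R n.+1 -> Zadj beta (lin z).
Proof.
move=> /int_rVP zi; rewrite /lin mxE; apply: Zadj_sum => j; apply: ZadjM.
  by have /intrP[k ->] := zi j; exact: Zadj_int.
by rewrite mxE; exact: horner_val_Zadj.
Qed.

(** Solve P(beta) = 0 for the constant coefficient, which is 1 or -1. *)
Lemma Zadj_inv : Zadj beta beta^-1.
Proof.
have e : (P`_0)%:~R + (map_poly intr (drop_poly 1 P)).[beta] * beta = 0 :> R.
  rewrite -[RHS](rootP rbeta) -{3}(poly_take_drop 1 P) rmorphD rmorphM /=.
  rewrite map_polyXn hornerD hornerM hornerXn expr1; congr (_ + _).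
  have -> : take_poly 1 P = (P`_0)%:P.
    by apply/polyP => i; rewrite coef_take_poly coefC; case: i.
  by rewrite map_polyC hornerC.
have P00 : (P`_0)%:~R * (P`_0)%:~R = 1 :> R.
  by rewrite -intrM; have [->|->] : P`_0 = 1 \/ P`_0 = -1 by lia.
have -> : beta^-1 = - ((P`_0)%:~R * (map_poly intr (drop_poly 1 P)).[beta]).
  apply: (mulIf beta0); rewrite mulVf // mulNr -mulrA.
  by move/eqP: e; rewrite addrC addr_eq0 => /eqP ->; rewrite mulrN opprK P00.
by apply/ZadjN/ZadjM; [exact: Zadj_int | exists (drop_poly 1 P)].
Qed.

Definition near_int (x : R) : R := (Num.floor (x + 2^-1))%:~R.

Lemma dist_int_near (x : R) : `|x - near_int x| <= dist_int x.
Proof.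
apply: lb_le_inf; first by exists `|x - 0%:~R|, 0.
move=> _ [k _ <-]; have /andP[f1 f2] := floor_itv (x + 2^-1); rewrite /near_int.
have [<-//|kf] := eqVneq (Num.floor (x + 2^-1)) k.
have h : `|x - (Num.floor (x + 2^-1))%:~R| <= 2^-1.
  by move: f1 f2; rewrite intrD ler_norml => f1 f2; apply/andP; split; lra.
apply: le_trans h _.
move: f1 f2; set f := Num.floor _ in kf *; rewrite intrD => f1 f2.
have [fk|fk|e] := ltgtP f k; last by rewrite e eqxx in kf.
  have : (f + 1)%:~R <= k%:~R :> R by rewrite ler_int lezD1.
  by rewrite intrD => h; rewrite ler_normr; apply/orP; right; lra.
have : (k + 1)%:~R <= f%:~R :> R by rewrite ler_int lezD1.
by rewrite intrD => h; rewrite ler_normr; apply/orP; left; lra.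
Qed.

Lemma lin_le (y : 'rV[R]_n.+1) : `|lin y| <= `|y| * \sum_(j < n.+1) `|horner_val j|.
Proof.
rewrite /lin mxE mulr_sumr (le_trans (ler_norm_sum _ _ _)) //.
by apply: ler_sum => j _; rewrite normrM mxE ler_wpM2r // rV_coord_le.
Qed.

(* The integers nearest to the coordinates of xi beta^k (1, beta^-1, ...) satisfy
   for large k the recurrence given by P, hence form an orbit of [comp_mx], whose
   [lin] component is then xi * gamma * beta^k. *)
Lemma pisot_theorem xi : P_ beta xi -> Zadj beta (xi * gamma).
Proof.
move=> hxi.
pose S := 1 + \sum_i \sum_j `|(M : 'M[R]_n.+1) i j|.
have S1 : 1 <= S by rewrite lerDl sumr_ge0 // => i _; rewrite sumr_ge0.
have S0 : 0 < S by exact: lt_le_trans S1.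
(* This precision makes the defect w_(N+1) - w_N M of the recurrence an integer vector of norm at
   most 1/2, hence 0. *)
have e0 : 0 < S^-1 / 2 by rewrite divr_gt0 ?invr_gt0.
have [N0 _ hN0] := (cvgr0Pnorm_lt _).1 hxi _ e0.
pose a N := near_int (xi * beta ^+ N).
pose w N : 'rV[R]_n.+1 := \row_i a (N + n - i)%N.
pose x N : 'rV[R]_n.+1 := (xi * beta ^+ (N + n)) *: eigen_row beta.
have xS N : x N.+1 = x N *m M.
  by rewrite /x -scalemxAl (eigen_rowP Pm sP beta0 rbeta) scalerA addSn exprSr mulrA.
have err N : (N0 <= N)%N -> `|x N - w N| <= S^-1 / 2.
  move=> hN; apply: rV_norm_le; first exact: ltW.
  move=> i; rewrite !mxE.
  have iN : (i <= N + n)%N by rewrite (leq_trans _ (leq_addl _ _)) // -ltnS.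
  rewrite -mulrA exprVn -exprB ?unitfE // (le_trans (dist_int_near _)) //.
  have /hN0 : (N0 <= N + n - i)%N.
    by rewrite (leq_trans hN) // -addnBA ?leq_addr // -ltnS.
  by move=> /= /ltW; apply: le_trans; exact: ler_norm.
have wi N : w N \in @int_rV R n.+1.
  by apply/int_rVP => i; rewrite mxE /a /near_int intr_int.
have wS N : (N0 <= N)%N -> w N.+1 = w N *m M.
  move=> hN; apply/eqP; rewrite -subr_eq0; apply/eqP/int_rV_norm_lt1.
    by rewrite rpredB //; exact: mulmx_int_rV.
  have -> : w N.+1 - w N *m M = (x N - w N) *m M - (x N.+1 - w N.+1).
    rewrite mulmxBl xS; move: (x N *m M) (w N *m M) => A B.
    by apply/rowP => i; rewrite !mxE; ring.
  rewrite (le_lt_trans (ler_normB _ _)) //.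
  have h1 := mulmx_norm_le (x N - w N) M.
  have h2 : `|x N - w N| * (S - 1) <= S^-1 / 2 * (S - 1).
    by rewrite ler_wpM2r ?subr_ge0 // err.
  have h3 := err N.+1 (leqW hN).
  rewrite (_ : \sum_i _ = S - 1) in h1; last by rewrite /S addrC addKr.
  have e : S^-1 / 2 * (S - 1) + S^-1 / 2 = 2^-1.
    by field; rewrite gt_eqF.
  rewrite (@le_lt_trans _ _ 2^-1) // ?invf_lt1 ?ltr1n //.
  by rewrite -e lerD // (le_trans h1).
have errS k : x (N0 + k)%N - w (N0 + k)%N = (x N0 - w N0) *m M ^+ k.
  elim: k => [|k ih]; first by rewrite addn0 expr0 mulmx1.
  by rewrite addnS xS wS ?leq_addr // -mulmxBl ih exprSr mulmxA.
have lerr : lin (x N0 - w N0) = 0.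
  apply: (@expr_bounded_eq0 _ beta beta_gt1 _ (\sum_(j < n.+1) `|horner_val j|)) => k.
  have -> : `|lin (x N0 - w N0)| * beta ^+ k = `|lin (x (N0 + k)%N - w (N0 + k)%N)|.
    rewrite errS; elim: k => [|k ih]; first by rewrite !expr0 mulmx1 mulr1.
    rewrite exprSr mulrA ih [M ^+ k.+1]exprSr mulmxA lin_mulM normrM mulrC.
    by rewrite gtr0_norm // (lt_trans ltr01).
  rewrite (le_trans (lin_le _)) // ler_piMl ?sumr_ge0 //.
  rewrite (le_trans (err _ (leq_addr _ _))) // ler_pdivrMr // mul1r.
  by rewrite (@le_trans _ _ 1) ?ler1n // invf_le1.
have : Zadj beta (lin (x N0)).
  suff -> : lin (x N0) = lin (w N0) by exact: lin_Zadj.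
  by apply/eqP; rewrite -subr_eq0 -linN -linD lerr.
rewrite /x linZ -/gamma => h.
have -> : xi * gamma = beta^-1 ^+ (N0 + n) * (xi * beta ^+ (N0 + n) * gamma).
  by rewrite exprVn; field; rewrite expf_neq0.
by apply: ZadjM => //; apply: ZadjX; exact: Zadj_inv.
Qed.

Lemma sum_triangle (F : nat -> R) N :
  \sum_(j < N) \sum_(i < j.+1) F i = \sum_(i < N) F i *+ (N - i).
Proof.
elim: N => [|N ih]; first by rewrite !big_ord0.
rewrite big_ord_recr /= ih [in RHS]big_ord_recr /= subSnn mulr1n big_ord_recr /= addrA.
congr (_ + _); rewrite -big_split /=; apply: eq_bigr => i _.
by rewrite subSn ?mulrSr // ltnW.
Qed.

(** Summing the Horner values against the powers of 1/beta counts the coefficient of degree d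
    exactly d times, as the derivative does. *)
Lemma gamma_deriv : beta ^+ n * gamma = (map_poly intr P^`()).[beta].
Proof.
rewrite /gamma /lin mxE mulr_sumr.
transitivity (\sum_(j < n.+1) \sum_(i < j.+1) (P`_(n.+1 - i))%:~R * beta ^+ (n - i)).
  apply: eq_bigr => j _; rewrite !mxE mulrA exprVn -exprB ?unitfE //; last by rewrite -ltnS.
  rewrite mulr_sumr; apply: eq_bigr => i _; rewrite mulrCA -exprD; congr (_ * _ ^+ _).
  by have := ltn_ord i; have := ltn_ord j; lia.
rewrite (sum_triangle (fun i => (P`_(n.+1 - i))%:~R * beta ^+ (n - i))).
rewrite (@horner_coef_wide _ n.+1); last first.
  rewrite (leq_trans (size_poly _ _)) // -ltnS -sP lt_size_deriv //.
  by rewrite monic_neq0.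
rewrite [RHS](reindex_inj rev_ord_inj) /=; apply: eq_bigr => i _.
rewrite coef_map_id0 // coef_deriv !subSS subSn ?rmorphMn /= ?mulrnAl //.
by rewrite -ltnS.
Qed.

(** * The norm of xi and the discriminant *)

Hypothesis pmin : is_minpoly (map_poly intr P) beta.

Lemma conj_relation (f : {poly rat}) : (map_poly ratr f).[beta] = 0 ->
  forall k, (map_poly ratr f).[b k] = 0.
Proof.
move=> fb k; have /dvdpP[g ->] := minpoly_dvd pmin (introT eqP fb).
by rewrite rmorphM /= hornerM ratr_intr_poly (rootP (conj_root k)) mulr0.
Qed.

Lemma deriv_conj k :
  (map_poly intr P^`()).[b k] = \prod_(j | j != k) (b k - b j).
Proof.
rewrite -deriv_map Pb (bigD1 k) //= derivM derivXsubC mul1r hornerD hornerM.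
rewrite hornerXsubC subrr mul0r addr0 horner_prod.
by apply: eq_bigr => j _; rewrite hornerXsubC.
Qed.

(** The product of the P'(b_k) runs over ordered pairs of conjugates; the pairs with k < j and those
    with k > j agree up to sign, which the absolute value removes. *)
Lemma norm_discr : `|discr b| = `|\prod_k (map_poly intr P^`()).[b k]|.
Proof.
under [in RHS]eq_bigr => k _ do rewrite deriv_conj (bigID (fun j : 'I__ => (k < j)%N)) /=.
rewrite big_split /= normrM.
have e1 : \prod_(i < n.+1) \prod_(j < n.+1 | (j != i) && (i < j)%N) (b i - b j) =
    \prod_(i < n.+1) \prod_(j < n.+1 | (i < j)%N) (b i - b j).
  apply: eq_bigr => i _; apply: eq_bigl => j.
  by case: ltnP => ij; rewrite ?andbF // andbT -val_eqE gtn_eqF.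
have e2 : `|\prod_(i < n.+1) \prod_(j < n.+1 | (j != i) && ~~ (i < j)%N) (b i - b j)| =
    `|\prod_(i < n.+1) \prod_(j < n.+1 | (i < j)%N) (b i - b j)|.
  rewrite !normr_prod; under eq_bigr => i _ do rewrite normr_prod.
  under [in RHS]eq_bigr => i _ do rewrite normr_prod.
  rewrite (exchange_big_dep predT) //=; apply: eq_bigr => i _.
  apply: eq_big => [j|j _]; last by rewrite distrC.
  by rewrite -leqNgt -val_eqE /= ltn_neqAle.
rewrite e1 e2 -normrM /discr; congr `|_|; rewrite -expr2 -prodrXl.
by apply: eq_bigr => i _; rewrite -prodrXl.
Qed.

Lemma deriv_conj_neq0 k : (map_poly intr P^`()).[b k] != 0.
Proof.
rewrite deriv_conj; apply/prodf_neq0 => j jk; rewrite subr_eq0.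
by apply: contra jk => /eqP /binj ->.
Qed.

(** Rules out the default value of [field_norm]. With v inverse to P' modulo P, xi = q(beta) beta^n
    v(beta), and the rows of the matrix come from reduction modulo P. *)
Lemma norm_matrix_exists xi (q : {poly int}) : xi * gamma = (map_poly intr q).[beta] ->
  exists A : 'M[rat]_n.+1, forall i : 'I_n.+1,
    xi * beta ^+ i = \sum_(j < n.+1) ratr (A i j) * beta ^+ j.
Proof.
move=> hxi; set p : {poly rat} := map_poly intr P.
have pm : p \is monic by case: pmin.
have sp : size p = n.+2 by rewrite size_map_inj_poly //; exact: intr_inj.
have /Bezout_eq1_coprimepP[[u v] /= e] := minpoly_coprime_deriv pmin.
have ev : (map_poly ratr v).[beta] * (map_poly intr P^`()).[beta] = 1.
  have := congr1 (fun f => (map_poly (ratr : rat -> R) f).[beta]) e.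
  rewrite deriv_map rmorphD /= !rmorphM /= rmorph1 hornerD !hornerM hornerC.
  by rewrite !ratr_intr_poly (rootP rbeta) mulr0 add0r.
pose f (i : nat) : {poly rat} := (map_poly intr q * 'X^n * v * 'X^i) %% p.
exists (\matrix_(i, j) (f i)`_j) => i.
under eq_bigr => j _ do rewrite mxE -coef_map.
rewrite -(@horner_coef_wide _ n.+1); last first.
  by rewrite size_map_poly -ltnS -sp ltn_modp monic_neq0.
have := congr1 (fun g => (map_poly (ratr : rat -> R) g).[beta])
  (divp_eq (map_poly intr q * 'X^n * v * 'X^i) p).
rewrite -/(f i) !rmorphD !rmorphM /= !hornerD !hornerM !ratr_intr_poly.
rewrite (rootP rbeta) mulr0 add0r => <-.
rewrite !map_polyXn !hornerXn -hxi; congr (_ * _).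
by rewrite -[LHS]mulr1 -ev -gamma_deriv; ring.
Qed.

(** Rational relations at beta hold at every conjugate, so the Vandermonde matrix [W] diagonalizes
    A, with eigenvalues q(b_k) b_k^n / P'(b_k), the conjugates of xi. All such A thus have the same
    determinant, and the choice made by [field_norm] is harmless. *)
Lemma norm_matrix_det xi (q : {poly int}) (A : 'M[rat]_n.+1) :
  xi * gamma = (map_poly intr q).[beta] ->
  (forall i : 'I_n.+1, xi * beta ^+ i = \sum_(j < n.+1) ratr (A i j) * beta ^+ j) ->
  ratr (\det A) * \prod_k (map_poly intr P^`()).[b k] =
  \prod_k ((map_poly intr q).[b k] * b k ^+ n).
Proof.
move=> hxi hA.
pose W : 'M[R[i]]_n.+1 := \matrix_(j, k) b k ^+ j.
pose c k := (map_poly intr q).[b k] * b k ^+ n / (map_poly intr P^`()).[b k].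
have AW : map_mx ratr A *m W = W *m diag_mx (\row_k c k).
  apply/matrixP => i k; rewrite mul_mx_diag !mxE.
  pose g : {poly rat} := 'X^i * map_poly intr q * 'X^n -
    map_poly intr P^`() * \sum_(j < n.+1) (A i j) *: 'X^j.
  have ge (S : numFieldType) (x : S) : (map_poly ratr g).[x] =
     x ^+ i * (map_poly intr q).[x] * x ^+ n -
     (map_poly intr P^`()).[x] * \sum_(j < n.+1) ratr (A i j) * x ^+ j.
    rewrite /g rmorphB !rmorphM /= !map_polyXn !ratr_intr_poly hornerD hornerN !hornerM.
    rewrite !hornerXn; congr (_ - _ * _); rewrite rmorph_sum /= horner_sum.
    by apply: eq_bigr => j _; rewrite map_polyZ map_polyXn hornerZ hornerXn.
  have : (map_poly ratr g).[beta] = 0.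
    by rewrite ge -hA -gamma_deriv -hxi; ring.
  move=> /conj_relation /(_ k); rewrite ge => /eqP; rewrite subr_eq0 => /eqP e.
  transitivity (\sum_(j < n.+1) ratr (A i j) * b k ^+ j).
    by apply: eq_bigr => j _; rewrite !mxE.
  apply: (mulfI (deriv_conj_neq0 k)); rewrite -e /c; field.
  exact: deriv_conj_neq0.
have Wu : \det W != 0.
  rewrite (_ : W = Vandermonde n.+1 (\row_k b k)); last first.
    by apply/matrixP => i k; rewrite !mxE.
  rewrite det_Vandermonde; apply/prodf_neq0 => i _; apply/prodf_neq0 => j ij.
  by rewrite !mxE subr_eq0; apply: contraTneq ij => /binj ->; rewrite ltnn.
have := congr1 determinant AW; rewrite !det_mulmx det_diag mulrC => /(mulfI Wu).
rewrite det_map_mx /= => ->; rewrite -big_split /=; apply: eq_bigr => k _.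
by rewrite mxE /c divfK // deriv_conj_neq0.
Qed.

Lemma field_norm_formula xi (q : {poly int}) : xi * gamma = (map_poly intr q).[beta] ->
  `|discr b * ratr (field_norm n.+1 beta xi)| =
  (`|\det (horner_mx comp_mx q)|%N)%:R :> R[i].
Proof.
move=> hxi.
have [A hA] := norm_matrix_exists hxi.
have [B hB ->] : [set c | exists2 A : 'M[rat]_n.+1,
    (forall i : 'I_n.+1, xi * beta ^+ i = \sum_(j < n.+1) ratr (A i j) * beta ^+ j) &
    c = \det A] (field_norm n.+1 beta xi).
  by apply: xgetPex; exists (\det A), A.
rewrite normrM norm_discr -normrM mulrC (norm_matrix_det hxi hB) big_split /=.
rewrite prodrXl normrM normrX prod_conj_norm expr1n mulr1.
rewrite -det_horner -map_horner_mx det_map_mx /= -intr_norm.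
by rewrite -abszE.
Qed.

End Companion.

(** * The theorem *)

Section PisotUnit.
Variables (n : nat) (P : {poly int}) (R : realType) (beta : R).
Hypotheses (Pm : P \is monic) (sP : size P = n.+2).
Hypotheses (beta_gt1 : 1 < beta) (rbeta : root (map_poly intr P) beta).
Hypothesis P0 : `|P`_0| = 1.
Variable b : 'I_n.+1 -> R[i].
Hypothesis Pb : map_poly intr P = \prod_(i < n.+1) ('X - (b i)%:P).
Hypothesis binj : injective b.
Variable i0 : 'I_n.+1.
Hypothesis bi0 : b i0 = beta%:C.
Hypothesis blt1 : forall i, i != i0 -> `|b i| < 1.
Hypothesis pmin : is_minpoly (map_poly intr P) beta.
Hypothesis wf : weakly_finitary beta.
Variable mu : probability (torus_borel R n.+1) R.
Hypothesis tmu : translation_invariant mu.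

Local Notation M := (comp_mx n P).
Local Notation vv := (vv n P beta).
Local Notation lin := (lin P beta).
Local Notation gamma := (gamma n P beta).
Local Notation pi := (@torus_pi R n.+1).

Let MuZ : M \in unitmx. Proof. exact: (comp_mx_unit Pm sP beta_gt1 rbeta P0 Pb binj). Qed.
Let Mu : (map_mx intr M : 'M[R]_n.+1) \in unitmx.
Proof. exact: (map_comp_mx_unit Pm sP beta_gt1 rbeta P0 Pb binj). Qed.
Let lin_vv1 : lin vv = 1. Proof. exact: (lin_vv Pm sP rbeta P0 Pb binj bi0). Qed.
Let vvMb : vv *m map_mx intr M = beta *: vv. Proof. exact: vvM. Qed.
Let g0 : gamma != 0. Proof. exact: (gamma_neq0 Pm sP rbeta P0 Pb binj bi0). Qed.

Lemma det_horner_eq0 (q : {poly int}) :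
  (\det (horner_mx M q) == 0) = ((map_poly intr q).[beta] == 0).
Proof.
have -> : (\det (horner_mx M q) == 0) = (\prod_k (map_poly intr q).[b k] == 0).
  by rewrite -(det_horner Pm sP P0 Pb binj) -map_horner_mx det_map_mx intr_eq0.
apply/idP/idP => [|/eqP qb].
  apply: contraTT => qb; apply/prodf_neq0 => k _.
  have [_ irr _] := pmin.
  have cop : coprimep (map_poly intr P) (map_poly intr q : {poly rat}).
    rewrite irreducible_poly_coprime //; apply: contra qb => /dvdpP[g gE].
    rewrite -ratr_intr_poly gE rmorphM /= hornerM (ratr_intr_poly R P).
    by rewrite (rootP rbeta) mulr0.
  have := cop; rewrite -(coprimep_map (ratr : {rmorphism rat -> R[i]})) /=.
  rewrite !ratr_intr_poly => /coprimep_root; apply; exact: (conj_root Pb).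
rewrite (bigD1 i0) //= mulf_eq0; apply/orP; left; apply/eqP.
rewrite -ratr_intr_poly; apply: (conj_relation Pb pmin).
by rewrite ratr_intr_poly.
Qed.

(** Small multiples of [vv] are pairwise distinct modulo Z^m, so for every K at most one of K sample
    points can hit 0. *)
Lemma haar_zero : mu [set 0 : torus R n.+1] = 0%E.
Proof.
have m0 : (measurable : set (set (torus_borel R n.+1))) [set 0 : torus R n.+1].
  apply: torus_closed_measurable; apply: accessible_closed_set1.
  exact/hausdorff_accessible/torus_hausdorff.
have bound K : fine (mu [set 0 : torus R n.+1]) * K%:R <= 1.
  (* Chosen so that |i - j| t |vv| < 1 for i, j < K, which leaves 0 as the only possible integer
     vector. *)
  pose t := (K.+1%:R * (`|vv| + 1))^-1 : R.
  have t0 : 0 < t by rewrite invr_gt0 mulr_gt0 // ltr_wpDl.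
  rewrite -lee_fin EFinM fineK ?fin_num_measure //.
  apply: (@sampling _ _ mu tmu [set 0 : torus R n.+1]
    (fun i => pi ((i%:R * t) *: vv)) K 1%N m0) => x.
  have inj (i j : 'I_K) : x + pi ((i%:R * t) *: vv) \in [set 0 : torus R n.+1] ->
      x + pi ((j%:R * t) *: vv) \in [set 0 : torus R n.+1] -> i = j.
    rewrite !inE /= => xi0 xj0.
    have /torus_pi_eq : pi ((i%:R * t) *: vv) = pi ((j%:R * t) *: vv).
      by apply: (addrI x); rewrite xi0 xj0.
    rewrite -scalerBl -mulrBl => zi.
    have d0 : (i%:R - j%:R : R) * t = 0.
      suff /(congr1 lin) : ((i%:R - j%:R) * t) *: vv = 0.
        by rewrite linZ lin_vv1 mulr1 -(scale0r 0) linZ mul0r.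
      apply: int_rV_norm_lt1 zi _; rewrite normrZ normrM (gtr0_norm t0).
      have iK : (i : nat)%:R <= K%:R :> R by rewrite ler_nat ltnW.
      have jK : (j : nat)%:R <= K%:R :> R by rewrite ler_nat ltnW.
      have h : `|(i : nat)%:R - (j : nat)%:R| <= K%:R :> R.
        have i00 : 0 <= (i : nat)%:R :> R by []. have j00 : 0 <= (j : nat)%:R :> R by [].
        by rewrite ler_norml; apply/andP; split; lra.
      rewrite /t mulrAC ltr_pdivrMr ?mul1r; last by rewrite mulr_gt0 // ltr_wpDl.
      apply: (@le_lt_trans _ _ (K%:R * `|vv|)); first exact: ler_wpM2r.
      rewrite -natr1; have := normr_ge0 vv; have : 0 <= K%:R :> R by []. nra.
    move/eqP: d0; rewrite mulf_eq0 (gt_eqF t0) orbF subr_eq0 eqr_nat => /eqP.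
    exact: val_inj.
  have [/existsP[i xi]|/existsPn nx] := boolP [exists i : 'I_K,
      x + pi (((i : nat)%:R * t) *: vv) \in [set 0 : torus R n.+1]].
    rewrite (bigD1 i) //= xi big1 // => j ji; apply/eqP; rewrite eqb0.
    by apply: contra ji => xj; rewrite (inj _ _ xj xi).
  by rewrite big1 // => i _; apply/eqP; rewrite eqb0 nx.
apply/eqP; rewrite eq_le measure_ge0 andbT -(fineK (fin_num_measure mu _ m0)) lee_fin leNgt.
apply/negP => f0; have := bound (Num.truncn (fine (mu [set 0 : torus R n.+1]))^-1).+1.
apply/negP; rewrite -ltNge mulrC -ltr_pdivrMr // mul1r truncnS_gt //.
Qed.

Lemma phi_zero e : phi n.+1 beta 0 e = 0.
Proof.
rewrite /phi (_ : \row_i _ = 0) ?torus_pi0; last by apply/rowP => i; rewrite !mxE mul0r.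
rewrite (_ : (fun N => _) = (fun=> 0)); last by apply/funext => N; rewrite scaler0 torus_pi0.
by apply: cvg_lim; [exact: torus_hausdorff | exact: cvg_cst].
Qed.

Lemma ae_fiber_card_zero : {ae mu, forall x : torus R n.+1,
  ([set e | X_ beta e /\ phi n.+1 beta 0 e = x] #= `I_0)%card}.
Proof.
apply: (@negligibleS _ _ _ mu [set 0 : torus R n.+1]); last first.
  apply/negligibleP; last exact: haar_zero.
  apply: torus_closed_measurable; apply: accessible_closed_set1.
  exact/hausdorff_accessible/torus_hausdorff.
move=> x /= nx; apply: contrapT => x0; apply: nx.
rewrite II0 card_eq0; apply/eqP/seteqP; split => // e [_].
by rewrite phi_zero => /esym.
Qed.

Variables (xi : R) (q : {poly int}).
Hypothesis xiq : xi * gamma = (map_poly intr q).[beta].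
Hypothesis xi0 : xi != 0.

Lemma phi_tail e N :
  torus_pi (tail_sum beta e N *: \row_(i < n.+1) (xi / beta ^+ i)) =
  torus_mul (horner_mx M q) (pi (tail_sum beta e N *: vv)).
Proof.
rewrite torus_mul_pi map_horner_mx -scalemxAl vv_horner // -xiq; congr (pi (_ *: _)).
by apply/rowP => i; rewrite !mxE mulrA mulfK // exprVn.
Qed.

Lemma ae_phi_fiber_card : {ae mu, forall x : torus R n.+1,
  ([set e | X_ beta e /\ phi n.+1 beta xi e = x] #= `I_`|\det (horner_mx M q)|%N)%card}.
Proof.
have [C [rho [C0 r0 r1 contr]]] := contraction Pm sP rbeta P0 Pb binj bi0 blt1.
have linD' := @linD n P R beta; have linZ' := @linZ n P R beta; have linM' := lin_mulM Pm sP rbeta.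
have linle := @lin_le n P R beta; have e0i : e0 n R \in @int_rV R n.+1.
  by apply/int_rVP => i; rewrite mxE; exact: rpred_nat.
have lin0 := lin_e0 beta Pm sP; have linZadj := @lin_Zadj n P R beta.
have [y0 [eps [L [y00 eps0 yeps code_ex code_agree]]]] :=
  sync_set beta_gt1 linD' linZ' linM' linle lin_vv1 vvMb e0i lin0 C0 r0 r1 contr linZadj wf.
pose A := coded beta M vv (e0 n R) C rho `[y0, y0 + eps]%classic.
have cA : closed A by exact: (coded_closed beta_gt1 lin0 C0 r0 r1 contr).
have dA := sync_dense beta_gt1 MuZ linD' linZ' linle vvMb e0i lin0 C0 r0 r1 contr y00 yeps.
pose F s := pi (s *: vv).
have FD s t : F (s + t) = F s + F t by rewrite /F scalerDl torus_piD.
have SF x s : torus_mul M (x + F s) = torus_mul M x + F (beta * s).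
  by rewrite torus_mulD /F torus_mul_pi -scalemxAl vvMb scalerA mulrC.
have EA : mu [set x | forall j, ~ A (iter j (torus_mul M) x)] = 0%E.
  apply: (porous_null beta_gt1 tmu FD SF eps0 dA).
  rewrite (_ : [set x | _] = \bigcap_j [set x | ~ A (iter j (torus_mul M) x)]).
    apply: bigcap_measurable => // j _; apply: torus_open_measurable.
    by have /continuousP/(_ _ (closed_openC cA)) := @iter_torus_mul_continuous R n.+1 M j.
  by apply/seteqP; split => x hx j; [move=> _; exact: hx | exact: hx].
apply: (@ae_fiber_card R n.+1 mu tmu M Mu MuZ A cA EA
  (codes beta M vv (e0 n R) C rho) _ _ code_ex L code_agree).
- by move=> j e x; apply: codes_shift_iter contr j e x.
- by move=> j e x; apply: codes_unshift_iter contr j e x.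
- rewrite det_horner_eq0 -xiq mulf_eq0 negb_or xi0; exact: g0.
- exact: codes_X.
- by move=> e Xe; apply: codes_exists contr e Xe.
- move=> e x x'; exact: codes_unique.
- move=> e x ce; rewrite /phi; apply: cvg_lim; first exact: torus_hausdorff.
  under eq_fun do rewrite phi_tail.
  apply: continuous_cvg; first exact: torus_mul_continuous.
  exact: (codes_tail_cvg beta_gt1 vvMb e0i C0 r0 r1 ce).
Qed.

End PisotUnit.

Theorem theorem22 (R : realType) (beta xi : R) (m : nat)
    (p : {poly rat}) (b : 'I_m -> R[i])
    (mu : probability (torus_borel R m) R) :
  pisot_unit beta ->
  weakly_finitary beta ->
  is_minpoly p beta ->
  size p = m.+1 ->
  map_poly ratr p = \prod_(i < m) ('X - (b i)%:P) ->
  P_ beta xi ->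
  translation_invariant mu ->
  exists n : nat,
    (n%:R : R[i]) = `|discr b * ratr (field_norm m beta xi)| /\
    {ae mu, forall x : torus R m,
       ([set e | X_ beta e /\ phi m beta xi e = x] #= `I_n)%card}.
Proof.
move=> [[beta_gt1 beta_int conj_lt1] beta_inv] wf pmin sp pb xiP tmu.
have beta0 : beta != 0 by rewrite gt_eqF // (lt_trans ltr01).
have [P Pm pP] := minpoly_int pmin beta_int.
have P0 := minpoly_coef0 pmin Pm pP beta0 beta_inv.
have binj := conjugates_injective pmin pb.
have [i0 bi0] := conjugates_beta pmin pb.
(* Degree 0 is excluded because [i0] indexes a conjugate. *)
case: m b mu sp pb tmu binj i0 bi0 => [|n] b mu sp pb tmu binj i0 bi0; first by case: i0 bi0.
have sP : size P = n.+2 by rewrite -sp pP size_map_inj_poly //; exact: intr_inj.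
have Pb : map_poly intr P = \prod_(i < n.+1) ('X - (b i)%:P).
  by rewrite -pb pP ratr_intr_poly.
have [_ _ rbeta] := pmin; rewrite pP ratr_intr_poly in rbeta.
have blt1 i : i != i0 -> `|b i| < 1.
  move=> ii0; apply: conj_lt1; last by rewrite -bi0 (inj_eq binj).
  by exists p => //; rewrite pP ratr_intr_poly; exact: (conj_root Pb).
rewrite pP in pmin.
have [q _ qE] := pisot_theorem Pm sP beta_gt1 rbeta P0 xiP.
exists `|\det (horner_mx (comp_mx n P) q)|%N; split.
  by rewrite (field_norm_formula Pm sP beta_gt1 rbeta P0 Pb binj pmin (esym qE)).
(* For xi = 0 the matrix q(M) is singular and its fibres cannot be counted by the determinant; the
   count 0 is then checked directly. *)
have [xi0|xi0] := eqVneq xi 0; last first.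
  by apply: (ae_phi_fiber_card Pm sP beta_gt1 rbeta P0 Pb binj bi0 blt1 pmin wf tmu (esym qE)).
rewrite xi0 in qE *; have -> : `|\det (horner_mx (comp_mx n P) q)|%N = 0%N.
  apply/eqP; rewrite absz_eq0 (det_horner_eq0 Pm sP rbeta P0 Pb binj i0 pmin).
  by rewrite qE mul0r.
exact: (ae_fiber_card_zero Pm sP rbeta P0 Pb binj bi0 tmu).
Qed.
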